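(* For each $d\in\mathbb N_0$, $$\lim_{n\to\infty}\frac{\boldsymbol\lambda\bigl(\mathcal P_d(\ell_2^n(\mathbb R))\bigr)}{\sqrt{\binom{n+d-1}{d}}}=\frac{\mathbb E|\mathrm{He}_d(Z)|}{\sqrt{d!}},$$ where $\mathrm{He}_d$ denotes the $d$-th probabilists' Hermite polynomial and $Z\sim N(0,1)$. Equivalently, $$\lim_{n\to\infty}\frac{\boldsymbol\lambda\bigl(\mathcal P_d(\ell_2^n(\mathbb R))\bigr)}{\sqrt{n^d}}=\frac{\mathbb E|\mathrm{He}_d(Z)|}{d!}.$$ The same limits hold with $\boldsymbol\lambda(\mathcal P_d(\mathbb S_{\mathbb R}^{n-1};\mathbb C))$ or $\boldsymbol\lambda(\mathcal P_d(\mathbb S_{\mathbb R}^{n-1};\mathbb R))$ in the numerator.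
   Context: $\ell_2^n(\mathbb R)=(\mathbb R^n,\|\cdot\|_2)$. $\mathcal P_d(\ell_2^n(\mathbb R))$ is the real Banach space of all real-valued $d$-homogeneous polynomials on $\mathbb R^n$ with norm $\|P\|=\sup_{\|x\|_2\le1}|P(x)|$. For $\mathbb K\in\{\mathbb R,\mathbb C\}$, $\mathcal P_d(\mathbb S_{\mathbb R}^{n-1};\mathbb K)$ is the space of restrictions to $\mathbb S_{\mathbb R}^{n-1}=\{x\in\mathbb R^n:\|x\|_2=1\}$ of $d$-homogeneous polynomials on $\mathbb R^n$ with coefficients in $\mathbb K$, with the supremum norm. $\mathrm{He}_d(u)=d!\sum_{m=0}^{\lfloor d/2\rfloor}\frac{(-1)^mu^{d-2m}}{2^mm!(d-2m)!}$. Projection constants: $\boldsymbol\lambda(X,Y)=\inf\{\|P\|: P\in\mathcal L(Y),\ P^2=P,\ P(Y)=X\}$, $\boldsymbol\lambda(X)=\sup_Y\boldsymbol\lambda(X,Y)$ over all Banach spaces $Y$, over the same scalar field as $X$, containing $X$ isometrically. *)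

(* Defs.v *)
From HB Require Import structures.
From mathcomp Require Import all_boot all_order all_algebra complex.
From mathcomp Require mpoly.
From mathcomp Require Import all_classical all_reals all_analysis.
(* The notations of [mpoly] clash with those of the analysis library. *)
Import -(notations) mpoly.
Set Implicit Arguments.
Unset Strict Implicit.
Unset Printing Implicit Defensive.
Import Order.TTheory GRing.Theory Num.Theory.
Import numFieldNormedType.Exports.
Local Open Scope classical_set_scope.
Local Open Scope ring_scope.

(* A field playing the role of R or C: norms of vector spaces over [K] are
   [K]-valued in the library, and [reS] reads them back as elements of [R]. *)
Record scalars (R : realType) := Scalars {
  sfield :> numFieldType;
  ofR : {rmorphism R -> sfield};
  reS : sfield -> R;
  ofRK : cancel ofR reS;
  ofR_norm : forall z : sfield, ofR (reS `|z|) = `|z|;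
  ofR_le : {mono ofR : x y / x <= y}
}.
Arguments ofR {R s}.
Arguments reS {R s}.

Definition real_scalars (R : realType) : scalars R :=
  @Scalars R R idfun id (fun=> erefl) (fun=> erefl) (fun _ _ => erefl).

Lemma Re_real_complexK (R : realType) :
  cancel (real_complex R) (@complex.Re R).
Proof. by []. Qed.

Lemma real_complex_Re_norm (R : realType) (z : R[i]) :
  real_complex R (complex.Re `|z|) = `|z|.
Proof. by rewrite RRe_real ?normr_real. Qed.

Definition complex_scalars (R : realType) : scalars R :=
  @Scalars R R[i] (real_complex R) (@complex.Re R)
    (@Re_real_complexK R) (@real_complex_Re_norm R) (@lecR R).

Section projection_constant.
Context (R : realType) (K : scalars R).

Definition opnorm (Y : normedModType K) (P : Y -> Y) : \bar R :=
  ereal_sup [set (reS `|P y|)%:E | y in [set y : Y | `|y| <= 1]].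

(* [j] is the isometric inclusion of [X] into [Y]. *)
Definition proj_const_in (X Y : normedModType K) (j : X -> Y) : \bar R :=
  ereal_inf [set opnorm P | P in
    [set P : {linear Y -> Y} |
      [/\ continuous P, P \o P =1 P & range P = range j]]].

Definition proj_const (X : normedModType K) : \bar R :=
  ereal_sup [set c | exists (Y : completeNormedModType K) (j : {linear X -> Y}),
    (forall x, `|j x| = `|x|) /\ c = proj_const_in j].

End projection_constant.

Section polynomial_spaces.
Context (R : realType) (K : scalars R).

Definition norm2 n (x : 'rV[R]_n) : R := Num.sqrt (\sum_i x ord0 i ^+ 2).

Definition sphere n := {x : 'rV[R]_n | norm2 x == 1}.

(* The pull-backs along [v : T -> R^n] of the [d]-homogeneous polynomials on
   R^n with coefficients in [K]; the zero polynomial is included. *)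
Definition is_hpoly T n (v : T -> 'rV[R]_n) d : {pred T -> K} :=
  fun f => `[< exists2 p : mpoly n K, p \is ishomog1 d mdeg &
    forall t, f t = meval (fun i => ofR (v t ord0 i)) p >].

Lemma is_hpoly_submod T n (v : T -> 'rV[R]_n) d : submod_closed (is_hpoly v d).
Proof.
split=> [|a f g /asboolP[p hp fp] /asboolP[q hq gq]]; apply/asboolP.
  by exists 0; rewrite ?rpred0// => t; rewrite meval0.
exists (a *: p + q); first by rewrite rpredD// rpredZ.
by move=> t; rewrite mevalD mevalZ -fp -gq.
Qed.

HB.instance Definition _ T n (v : T -> 'rV[R]_n) d :=
  GRing.isSubmodClosed.Build K (T -> K) (is_hpoly v d) (is_hpoly_submod v d).

Record hpoly T n (v : T -> 'rV[R]_n) d := HPoly {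
  hpoly_fun :> T -> K;
  hpolyP : hpoly_fun \in is_hpoly v d
}.

HB.instance Definition _ T n (v : T -> 'rV[R]_n) d :=
  [isSub for @hpoly_fun T n v d].
HB.instance Definition _ T n (v : T -> 'rV[R]_n) d :=
  [Choice of hpoly v d by <:].
HB.instance Definition _ T n (v : T -> 'rV[R]_n) d :=
  [SubChoice_isSubLmodule of hpoly v d by <:].

Definition sup_norm T (B : set T) (f : T -> K) : K :=
  ofR (sup [set reS `|f t| | t in B]).

Lemma reS_norm_ge0 (a : K) : 0 <= reS `|a|.
Proof. by rewrite -(@ofR_le _ K) rmorph0 ofR_norm. Qed.

Lemma reS_norm_eq0 (a : K) : reS `|a| = 0 -> a = 0.
Proof. by move=> a0; apply: normr0_eq0; rewrite -ofR_norm a0 rmorph0. Qed.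

Lemma reS_normD (a b : K) : reS `|a + b| <= reS `|a| + reS `|b|.
Proof. by rewrite -(@ofR_le _ K) rmorphD /= !ofR_norm ler_normD. Qed.

Lemma reS_normM (a b : K) : reS `|a * b| = reS `|a| * reS `|b|.
Proof.
by apply: (can_inj (@ofRK _ K)); rewrite rmorphM /= !ofR_norm normrM.
Qed.

Lemma norm_ofR (x : R) : `|ofR x : K| = ofR `|x|.
Proof.
wlog x0 : x / 0 <= x => [h|].
  have [/h//|/ltW x0] := leP 0 x.
  by rewrite -normrN -rmorphN h ?oppr_ge0// normrN.
by rewrite !ger0_norm// -(rmorph0 ofR) ofR_le.
Qed.

Lemma coord_le_norm2 n (x : 'rV[R]_n) i : `|x ord0 i| <= norm2 x.
Proof.
rewrite -sqrtr_sqr ler_sqrt ?sumr_ge0// => [|j _]; last exact: sqr_ge0.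
by rewrite (bigD1 i)//= lerDl sumr_ge0// => j _; exact: sqr_ge0.
Qed.

Lemma norm2_ge0 n (x : 'rV[R]_n) : 0 <= norm2 x.
Proof. exact: sqrtr_ge0. Qed.

Lemma norm2Z n (x : 'rV[R]_n) a : norm2 (a *: x) = `|a| * norm2 x.
Proof.
rewrite -sqrtr_sqr -sqrtrM ?sqr_ge0// mulr_sumr; congr Num.sqrt.
by apply: eq_bigr => i _; rewrite mxE exprMn.
Qed.

Section sup_norm_theory.
Context T n (v : T -> 'rV[R]_n) (d : nat) (B : set T).
Hypothesis B_le1 : forall t, B t -> norm2 (v t) <= 1.
Implicit Types f g : hpoly v d.

Lemma hpoly_bounded f : has_ubound [set reS `|f t| | t in B].
Proof.
have /asboolP[p _ fp] := hpolyP f.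
exists (reS `|\sum_(m <- msupp p) `|mcoeff m p| |) => _ [t Bt <-].
rewrite -(@ofR_le _ K) !ofR_norm fp mevalE [leRHS]ger0_norm ?sumr_ge0//.
apply: (le_trans (ler_norm_sum _ _ _)); apply: ler_sum => m _.
rewrite normrM ler_piMr// normr_prod prodr_ile1// => i _.
rewrite normr_ge0 normrX exprn_ile1// norm_ofR -(rmorph1 ofR) ofR_le.
exact: le_trans (coord_le_norm2 _ _) (B_le1 Bt).
Qed.

Lemma le_supn f t : B t -> reS `|f t| <= sup [set reS `|f t| | t in B].
Proof. by move=> Bt; apply: ub_le_sup; [exact: hpoly_bounded|exists t]. Qed.

Lemma supn_le f (M : R) : 0 <= M -> (forall t, B t -> reS `|f t| <= M) ->
  sup [set reS `|f t| | t in B] <= M.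
Proof.
move=> M0 fM; have [->|B0] := eqVneq B set0; first by rewrite image_set0 sup0.
by apply: ge_sup => [|_ [t Bt <-]]; [exact/image_nonempty/set0P|exact: fM].
Qed.

Lemma supn_ge0 f : 0 <= sup [set reS `|f t| | t in B].
Proof.
have [->|/set0P[t Bt]] := eqVneq B set0; first by rewrite image_set0 sup0.
exact: le_trans (reS_norm_ge0 _) (le_supn f Bt).
Qed.

Lemma sup_normD f g : sup_norm B (f + g) <= sup_norm B f + sup_norm B g.
Proof.
rewrite /sup_norm -rmorphD ofR_le supn_le ?addr_ge0 ?supn_ge0// => t Bt.
exact: le_trans (reS_normD _ _) (lerD (le_supn f Bt) (le_supn g Bt)).
Qed.

Lemma sup_normZ (a : K) f : sup_norm B (a *: f) = `|a| * sup_norm B f.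
Proof.
rewrite /sup_norm -ofR_norm -rmorphM; congr (ofR _).
have [->|a0] := eqVneq a 0.
  have r0 : reS `|0 : K| = 0.
    by apply: (can_inj (@ofRK _ K)); rewrite ofR_norm normr0 rmorph0.
  rewrite scale0r r0 mul0r; rewrite -[X in X @` B]/(cst 0) set_cst.
  by case: ifP => _; rewrite ?sup0 ?sup1.
have ra0 : 0 < reS `|a|.
  rewrite lt_neqAle reS_norm_ge0 andbT eq_sym.
  by apply: contra_neq a0 => /reS_norm_eq0.
apply/eqP; rewrite eq_le; apply/andP; split.
  rewrite supn_le ?mulr_ge0 ?supn_ge0 ?reS_norm_ge0// => t Bt.
  rewrite [X in reS `|X|](_ : _ = a * f t)// reS_normM.
  by rewrite ler_wpM2l ?reS_norm_ge0// le_supn.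
rewrite -ler_pdivlMl// supn_le ?mulr_ge0 ?invr_ge0 ?reS_norm_ge0 ?supn_ge0//.
by move=> t Bt; rewrite ler_pdivlMl// -reS_normM (le_supn (a *: f)).
Qed.

Lemma sup_norm_eq0 f : sup_norm B f = 0 -> forall t, B t -> f t = 0.
Proof.
move=> f0 t Bt; apply/reS_norm_eq0/eqP; rewrite eq_le reS_norm_ge0 andbT.
rewrite (le_trans (le_supn f Bt))// -(@ofR_le _ K) rmorph0.
by rewrite -/(sup_norm B f) f0.
Qed.

End sup_norm_theory.

Definition sphere_poly n d := hpoly (fun x : sphere n => val x) d.

HB.instance Definition _ n d := GRing.Lmodule.on (sphere_poly n d).

Lemma sphere_setT_le1 n (x : sphere n) : [set: sphere n] x -> norm2 (val x) <= 1.
Proof. by move=> _; rewrite (eqP (valP x)). Qed.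

Lemma sphere_poly_norm_eq0 n d (f : sphere_poly n d) :
  sup_norm [set: sphere n] f = 0 -> f = 0.
Proof.
move=> f0; apply/val_inj/funext => x.
exact: (sup_norm_eq0 (@sphere_setT_le1 n)).
Qed.

HB.instance Definition _ n d :=
  Lmodule_isNormed.Build K (sphere_poly n d)
    (@sup_normD _ _ _ d _ (@sphere_setT_le1 n))
    (@sup_normZ _ _ _ d _ (@sphere_setT_le1 n))
    (@sphere_poly_norm_eq0 n d).

Definition ball_poly n d := hpoly (@idfun 'rV[R]_n) d.

HB.instance Definition _ n d := GRing.Lmodule.on (ball_poly n d).

Definition unit_ball n : set 'rV[R]_n := [set x | norm2 x <= 1].

Lemma unit_ball_le1 n (x : 'rV[R]_n) : unit_ball x -> norm2 (idfun x) <= 1.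
Proof. by []. Qed.

Lemma ball_poly_homog n d (f : ball_poly n d) a x :
  f (a *: x) = ofR a ^+ d * f x.
Proof.
have /asboolP[p /dhomogP hp fp] := hpolyP f.
rewrite !fp !mevalE mulr_sumr big_seq [RHS]big_seq.
apply: eq_bigr => m /hp /= md; rewrite [RHS]mulrCA; congr (_ * _).
rewrite -md mdegE -prodrXr -big_split /=; apply: eq_bigr => i _.
by rewrite mxE rmorphM exprMn.
Qed.

Lemma ball_poly_norm_eq0 n d (f : ball_poly n d) :
  sup_norm (@unit_ball n) f = 0 -> f = 0.
Proof.
move=> f0; apply/val_inj/funext => x.
pose r := norm2 x + 1; have r0 : 0 < r by rewrite ltr_wpDl ?norm2_ge0.
have -> : x = r *: (r^-1 *: x) by rewrite scalerA divff ?scale1r ?gt_eqF.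
rewrite [LHS]ball_poly_homog (sup_norm_eq0 (@unit_ball_le1 n) f0) ?mulr0//.
rewrite /unit_ball /= norm2Z gtr0_norm ?invr_gt0//.
by rewrite mulrC ler_pdivrMr// mul1r lerDl.
Qed.

HB.instance Definition _ n d :=
  Lmodule_isNormed.Build K (ball_poly n d)
    (@sup_normD _ _ _ d _ (@unit_ball_le1 n))
    (@sup_normZ _ _ _ d _ (@unit_ball_le1 n))
    (@ball_poly_norm_eq0 n d).

End polynomial_spaces.

Definition hermite (R : realType) (d : nat) (u : R) : R :=
  d`!%:R * \sum_(0 <= m < d./2.+1)
    ((-1) ^+ m * u ^+ (d - 2 * m) / (2 ^+ m * m`!%:R * (d - 2 * m)`!%:R)).

(* Main.v *)
(* Let g be a standard Gaussian vector of R^n, and Z a standard Gaussian variable.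

   Upper bound. A d-homogeneous polynomial p satisfies the reproducing formula
   d! p(x) = E[p(g) He_d(<x, g>)] for |x| = 1. If X embeds isometrically in Y,
   extend the evaluation at each point y of the sphere to a functional u_y of
   norm at most 1 on Y (Hahn-Banach). Then
   f |-> (1/d!) E[|g|^d u_{g/|g|}(f) He_d(<x, g>)] is a projection of Y onto X,
   of norm at most (1/d!) sup_x E[|g|^d |He_d(<x, g>)|], which is asymptotic to
   n^(d/2) E|He_d(Z)| / d! because |g|^2 / n concentrates at 1.

   Lower bound. Let Q be a projection onto X of the space of all bounded
   functions on the sphere, and let psi be a Lipschitz approximation of the sign
   of He_d, with |psi| <= 1. The mean of |g|^d Q(psi(<g, .>))(g/|g|) is at most
   |Q| E[|g|^d], of the order of |Q| n^(d/2). Expand Q(psi(<g, .>)) by the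
   reproducing formula and exchange Q with the mean over g: since
   E[p(g) psi(<g, .>)] belongs to X for every d-homogeneous p, the result does
   not depend on Q, and it is asymptotic to n^d E[He_d(Z) psi(Z)] / d!. *)

Require Import Defs.
From HB Require Import structures.
From mathcomp Require Import all_boot all_order all_algebra complex.
From mathcomp Require mpoly.
From mathcomp Require Import all_classical all_reals all_analysis.
From mathcomp Require Import measurable_realfun ring lra.
(* The notations of [mpoly] clash with those of the analysis library. *)
Import -(notations) mpoly.
Set Implicit Arguments.
Unset Strict Implicit.
Unset Printing Implicit Defensive.
Import Order.TTheory GRing.Theory Num.Theory.
Import numFieldNormedType.Exports.
Local Open Scope classical_set_scope.
Local Open Scope ring_scope.

(** * The Hahn-Banach theorem *)

(** Hahn-Banach gives no control on how [u_y] depends on [y], so g |-> u_{g/|g|}(f) need not be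
    measurable. All means are therefore taken with a finitely additive extension of the Gaussian
    integral to arbitrary functions, itself produced by Hahn-Banach and iterated over the
    coordinates. Such a mean is linear and monotone, but need not satisfy Fubini or a limit theorem,
    and this shapes the rest. Kernels are expanded into finitely many monomials, so that linearity
    is enough. Rotation invariance is proved for a function of one linear form times a monomial,
    reflecting two coordinates at a time. The exchange of Q with the mean over g rounds g to a
    finite grid, which is why psi is Lipschitz instead of being the sign of He_d. Concentration
    enters through the explicit even moments of |g| and the inequality 2ab <= tau a^2 + b^2 / tau,
    where tau is fixed before n grows. For complex scalars the arguments are run on real parts, and
    K-valued objects are recovered from the R-linear functionals z |-> re (z c). *)

Section hahn_banach.
Variables (R : realType) (V : lmodType R) (W : set V) (p : V -> R).
Hypotheses (W0 : W 0) (WD : forall u v, W u -> W v -> W (u + v))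
  (WZ : forall a u, W u -> W (a *: u)).
Hypotheses (pD : forall u v, W u -> W v -> p (u + v) <= p u + p v)
  (pZ : forall a u, 0 <= a -> W u -> p (a *: u) = a * p u).

Let linear_graph (G : set (V * R)) :=
  [/\ G (0, 0), forall u v r s, G (u, r) -> G (v, s) -> G (u + v, r + s) &
      forall a u r, G (u, r) -> G (a *: u, a * r)].

Let dominated_graph (G : set (V * R)) :=
  forall u r, G (u, r) -> W u -> r <= p u.

Let p0 : p 0 = 0.
Proof. by have := @pZ 0 0 (lexx _) W0; rewrite scale0r mul0r. Qed.

(** Two values over the same [u] differ by a value over 0, which domination bounds by [p 0 = 0] in
    both directions. *)
Let graph_fun G u r s : linear_graph G -> dominated_graph G ->
  G (u, r) -> G (u, s) -> r = s.
Proof.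
move=> [G0 GD GZ] dG Gr Gs.
have h a b : G (u, a) -> G (u, b) -> a <= b.
  move=> Ga Gb; rewrite -subr_le0 -p0; apply: dG => //.
  have := GD _ _ _ _ Ga (GZ (-1) _ _ Gb).
  by rewrite scaleN1r mulN1r subrr.
by apply/eqP; rewrite eq_le !h.
Qed.

(** The one-dimensional extension step. Subadditivity puts every [r - p (u - v)] below every
    [p (u + v) - r], and [c] is the supremum of the former; a multiple [a *: v] reduces to [v] or
    [- v] by homogeneity. *)
Let graph_extend G v : linear_graph G -> dominated_graph G ->
  exists c, dominated_graph
    [set x : V * R | exists a u r, G (u, r) /\ x = (u + a *: v, r + a * c)].
Proof.
move=> [G0 GD GZ] dG.
pose A := [set a : R | exists u r, [/\ G (u, r), W (u - v) & a = r - p (u - v)]].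
have AB u r : G (u, r) -> W (u + v) -> ubound A (p (u + v) - r).
  move=> Gu Wu _ [w [s [Gw Ww ->]]].
  rewrite lerBlDr addrAC lerBrDr -(addrC r).
  have e : (u + v) + (w - v) = u + w by rewrite addrACA subrr addr0.
  apply: le_trans (pD Wu Ww); rewrite e.
  by apply: dG; [exact: GD|rewrite -e; exact: WD].
have [[u0 [r0 [Gu0 Wu0]]]|noW] :=
    pselect (exists u r, G (u, r) /\ W (u + v)); last first.
  (* If no [u + v] lies in [W], neither does any [u + a *: v] with [a != 0], so [c] is
     unconstrained. *)
  exists 0 => _ _ [a [u [r [Gu [-> ->]]]]] Wuv; rewrite mulr0 addr0.
  have [a0|a0] := eqVneq a 0.
    by move: Wuv; rewrite a0 scale0r addr0; exact: dG.
  exfalso; apply: noW; exists (a^-1 *: u), (a^-1 * r); split; first exact: GZ.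
  by have := WZ a^-1 Wuv; rewrite scalerDr scalerA mulVf// scale1r.
have A0 : A !=set0.
  exists (- r0 - p (- u0 - v)), (- u0), (- r0); split=> //.
    by have := GZ (-1) _ _ Gu0; rewrite scaleN1r mulN1r.
  by have := WZ (-1) Wu0; rewrite scaleN1r opprD.
exists (sup A) => _ _ [a [u [r [Gu [-> ->]]]]] Wuv.
have [a0|a0|a0] := ltgtP a 0.
- have na0 : 0 < - a by rewrite oppr_gt0.
  have e : u + a *: v = (- a) *: ((- a)^-1 *: u - v).
    by rewrite scalerBr scalerA divff ?gt_eqF// scale1r scaleNr opprK.
  have Wu : W ((- a)^-1 *: u - v).
    have := WZ (- a)^-1 Wuv; rewrite e scalerA mulVf ?scale1r// gt_eqF//.
  have hc : (- a)^-1 * r - p ((- a)^-1 *: u - v) <= sup A.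
    apply: ub_le_sup; first by exists (p (u0 + v) - r0); exact: AB.
    by exists ((- a)^-1 *: u), ((- a)^-1 * r); split=> //; exact: GZ.
  have := ler_wpM2l (ltW na0) hc.
  rewrite e pZ ?(ltW na0)// mulrBr mulrA mulfV ?gt_eqF// mul1r.
  lra.
- have e : u + a *: v = a *: (a^-1 *: u + v).
    by rewrite scalerDr scalerA divff ?gt_eqF// scale1r.
  have Wu : W (a^-1 *: u + v).
    have := WZ a^-1 Wuv; rewrite e scalerA mulVf ?scale1r// gt_eqF//.
  have hc : sup A <= p (a^-1 *: u + v) - a^-1 * r.
    by apply: ge_sup => //; apply: AB => //; exact: GZ.
  have := ler_wpM2l (ltW a0) hc.
  rewrite e pZ ?(ltW a0)// mulrBr mulrA mulfV ?gt_eqF// mul1r.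
  lra.
- rewrite a0 mul0r addr0; rewrite a0 scale0r addr0 in Wuv *.
  exact: dG.
Qed.

(* [p] only has to be sublinear, and to dominate, on the subspace [W], while
   the extension is total: this spares domain conditions when linearity alone
   is used. *)
Theorem hahn_banach (X : lmodType R) (j : {linear X -> V}) (f : {scalar X}) :
  (forall x, W (j x) -> f x <= p (j x)) ->
  exists g : V -> R, [/\ forall u v, g (u + v) = g u + g v,
    forall a u, g (a *: u) = a * g u, forall x, g (j x) = f x &
    forall u, W u -> g u <= p u].
Proof.
move=> fp; pose G0 : set (V * R) := [set (j x, f x) | x in setT].
have lG0 : linear_graph G0.
  split; first by exists 0 => //; rewrite !linear0.
    move=> _ _ _ _ [x _ [<- <-]] [y _ [<- <-]].
    by exists (x + y) => //; rewrite !linearD.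
  by move=> a _ _ [x _ [<- <-]]; exists (a *: x) => //; rewrite !linearZ.
have dG0 : dominated_graph G0 by move=> _ _ [x _ [<- <-]]; exact: fp.
(* The union with [G0] makes the property hold for the empty set, hence for the union of an empty
   chain in Zorn's lemma. *)
pose P (G : set (V * R)) :=
  linear_graph (G0 `|` G) /\ dominated_graph (G0 `|` G).
have [F FP Ftot|G [[lG dG] Gmax]] := @Zorn_bigcup _ P.
  split; last first.
    move=> u r [/dG0//|[X0 FX0 X0u]].
    by have [_] := FP _ FX0; apply; right.
  split.
  - by left; case: lG0.
  - move=> u v r s.
    have two : forall X1 X2, F X1 -> F X2 -> (G0 `|` X1) (u, r) ->
        (G0 `|` X2) (v, s) -> (G0 `|` \bigcup_(X in F) X) (u + v, r + s).
      move=> X1 X2 F1 F2 h1 h2.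
      have [X3 [F3 h3 h4]] : exists X3, [/\ F X3, (G0 `|` X3) (u, r) &
          (G0 `|` X3) (v, s)].
        have [X12|X21] := Ftot _ _ F1 F2.
          by exists X2; split=> //; case: h1; [left|right; exact: X12].
        by exists X1; split=> //; case: h2; [left|right; exact: X21].
      have [[_ /(_ _ _ _ _ h3 h4)[]]] := FP _ F3; first by left.
      by right; exists X3.
    move=> [h1|[X1 F1 h1]] [h2|[X2 F2 h2]].
    + by left; case: lG0 => _ + _; apply.
    + by apply: (two X2 X2) => //; [left|right].
    + by apply: (two X1 X1) => //; [right|left].
    + by apply: (two X1 X2) => //; right.
  - move=> a u r [h|[X1 F1 h]]; first by left; case: lG0 => _ _; apply.
    have [[_ _ /(_ a u r)[|?|?]]] := FP _ F1; [by right|by left|].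
    by right; exists X1.
pose H := G0 `|` G.
have total v : exists r, H (v, r).
  have [c dc] := graph_extend v lG dG.
  apply/not_existsP => nv.
  pose G' := [set x : V * R | exists a u r, H (u, r) /\ x = (u + a *: v, r + a * c)].
  have HG' : H `<=` G'.
    by move=> [u r] Hu; exists 0, u, r; rewrite scale0r mul0r !addr0.
  have [H0 HD HZ] := lG.
  have G'v : G' (v, c).
    by exists 1, 0, 0; rewrite scale1r mul1r !add0r.
  have e : G0 `|` G' = G'.
    by apply/setUidPr => x G0x; apply: HG'; left.
  apply: (Gmax G').
    split; first by move=> x Gx; apply: HG'; right.
    by move=> /(_ (v, c) G'v) Gv; apply: (nv c); right.
  rewrite /P e; split=> //; split.
  - exact: HG'.
  - move=> _ _ _ _ [a [u [r [Hu [-> ->]]]]] [b [w [s [Hw [-> ->]]]]].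
    exists (a + b), (u + w), (r + s); split; first exact: HD.
    by rewrite scalerDl mulrDl addrACA (addrACA r).
  - move=> b _ _ [a [u [r [Hu [-> ->]]]]].
    exists (b * a), (b *: u), (b * r); split; first exact: HZ.
    by rewrite scalerDr mulrDr scalerA mulrA.
have [g gH] := choice total.
have [H0 HD HZ] := lG.
exists g; split.
- by move=> u v; apply: graph_fun lG dG (gH _) (HD _ _ _ _ (gH u) (gH v)).
- by move=> a u; apply: graph_fun lG dG (gH _) (HZ _ _ _ (gH u)).
- by move=> x; apply: graph_fun lG dG (gH _) _; left; exists x.
- by move=> u Wu; exact: dG (gH u) Wu.
Qed.

End hahn_banach.

(** * The Gaussian integral *)

Section gaussian_integral.
Variable R : realType.
Notation mu := (@lebesgue_measure R).
Implicit Types (F G : R -> R) (m k : nat) (t u v w : R).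

Definition gauss t : R := normal_pdf 0 1 t.

Lemma gaussE t : gauss t = normal_peak 1 * expR (- (t ^+ 2 / 2)).
Proof.
rewrite /gauss normal_pdfE ?oner_eq0//= /normal_fun subr0 expr1n.
by rewrite mulNr.
Qed.

Lemma gauss_ge0 t : 0 <= gauss t.
Proof. exact: normal_pdf_ge0. Qed.

Lemma measurable_gauss : measurable_fun setT gauss.
Proof. exact: measurable_normal_pdf. Qed.

Lemma continuous_gauss : continuous gauss.
Proof. by apply: continuous_normal_pdf; rewrite oner_eq0. Qed.

Definition pgrowth F := exists m, exists2 C, 0 <= C &
  forall t, `|F t| <= C * (1 + t ^+ 2) ^+ m.

Lemma weight_ge1 t m : 1 <= (1 + t ^+ 2) ^+ m.
Proof. by rewrite exprn_ege1// lerDl sqr_ge0. Qed.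

Lemma weight_le t m k : (m <= k)%N -> (1 + t ^+ 2) ^+ m <= (1 + t ^+ 2) ^+ k.
Proof. by move=> mk; rewrite ler_weXn2l// lerDl sqr_ge0. Qed.

Lemma pgrowthD F G : pgrowth F -> pgrowth G -> pgrowth (fun t => F t + G t).
Proof.
move=> [m [C C0 h]] [k [D D0 g]]; exists (m + k)%N, (C + D); first exact: addr_ge0.
move=> t; rewrite (le_trans (ler_normD _ _))// mulrDl lerD//.
  by rewrite (le_trans (h t))// ler_wpM2l// weight_le// leq_addr.
by rewrite (le_trans (g t))// ler_wpM2l// weight_le// leq_addl.
Qed.

Lemma pgrowthM F G : pgrowth F -> pgrowth G -> pgrowth (fun t => F t * G t).
Proof.
move=> [m [C C0 h]] [k [D D0 g]]; exists (m + k)%N, (C * D); first exact: mulr_ge0.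
by move=> t; rewrite normrM exprD mulrACA ler_pM.
Qed.

Lemma pgrowth_cst (c : R) : pgrowth (fun=> c).
Proof. by exists 0%N, `|c| => // t; rewrite mulr1. Qed.

Lemma pgrowth_id : pgrowth id.
Proof.
exists 1%N, 1 => // t; rewrite mul1r expr1.
have := sqr_ge0 (`|t| - 1); rewrite -(real_normK (num_real t)).
have := normr_ge0 t; nra.
Qed.

Lemma pgrowthX m : pgrowth (fun t => t ^+ m).
Proof.
elim: m => [|m ih]; first exact: pgrowth_cst.
by under eq_fun do rewrite exprS; exact: (pgrowthM pgrowth_id ih).
Qed.

Lemma pgrowth_le F G : pgrowth G -> (forall t, `|F t| <= `|G t|) -> pgrowth F.
Proof.
move=> [m [C C0 h]] FG; exists m, C => // t; exact: le_trans (FG t) (h t).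
Qed.

Lemma pgrowthZ c F : pgrowth F -> pgrowth (fun t => c * F t).
Proof. by move=> pF; apply: pgrowthM pF; exact: pgrowth_cst. Qed.

Lemma pgrowth_comp F a b : pgrowth F -> pgrowth (fun t => F (a * t + b)).
Proof.
move=> [m [C C0 h]].
have a2 := sqr_ge0 a; have b2 := sqr_ge0 b.
exists m, (C * (1 + 2 * a ^+ 2 + 2 * b ^+ 2) ^+ m).
  by apply: mulr_ge0 => //; apply: exprn_ge0; lra.
move=> t; rewrite (le_trans (h _))// -mulrA ler_wpM2l// -exprMn lerXn2r//.
- by rewrite nnegrE addr_ge0// sqr_ge0.
- by rewrite nnegrE; have := sqr_ge0 t; nra.
have := sqr_ge0 (a * t - b); have := sqr_ge0 (b * t); have := sqr_ge0 t.
have := sqr_ge0 a; nra.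
Qed.

(** Half of the Gaussian exponent absorbs the weight, since y^m <= m! e^y for y = (1 + t^2) / 4; the
    other half is, up to a constant, the density of variance 2, which is integrable. *)
Lemma weight_gauss_le m : exists2 C, 0 <= C &
  forall t, (1 + t ^+ 2) ^+ m * gauss t <= C * normal_pdf 0 (Num.sqrt 2) t.
Proof.
pose s : R := Num.sqrt 2.
have s0 : s != 0 by rewrite sqrtr_eq0 -ltNge.
have p0 := normal_peak_gt0 s0.
have e0 := expR_gt0 (4^-1 : R).
exists (4 ^+ m * m`!%:R * expR 4^-1 * (normal_peak 1 / normal_peak s)) => [|t].
  by rewrite !mulr_ge0 ?invr_ge0 ?normal_peak_ge0 ?exprn_ge0 ?expR_ge0.
rewrite gaussE normal_pdfE//= /normal_fun subr0 sqr_sqrtr// -mulrnA.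
have -> : - t ^+ 2 / (2 * 2)%:R = - (t ^+ 2 / 4) by field.
have -> : - (t ^+ 2 / 2) = - (t ^+ 2 / 4) + - (t ^+ 2 / 4) :> R by field.
have e1 : expR ((1 + t ^+ 2) / 4) * expR (- (t ^+ 2 / 4)) = expR 4^-1 :> R.
  by rewrite -expRD; congr expR; field.
have y0 : 0 <= (1 + t ^+ 2) / 4 by have := sqr_ge0 t; lra.
have h : (1 + t ^+ 2) ^+ m <= 4 ^+ m * m`!%:R * expR ((1 + t ^+ 2) / 4).
  have -> : (1 + t ^+ 2) ^+ m = 4 ^+ m * ((1 + t ^+ 2) / 4) ^+ m.
    by rewrite -exprMn mulrCA divff// mulr1.
  rewrite -mulrA ler_wpM2l ?exprn_ge0// -ler_pdivrMl ?ltr0n ?fact_gt0// mulrC.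
  case: m => [|k]; last by have := expR_ge1Dxn k y0; lra.
  by rewrite expr0 fact0 invr1 mulr1 -[leLHS]expR0 ler_expR.
rewrite expRD -/s.
have f0 := expR_gt0 (- (t ^+ 2 / 4)).
have h2 := ler_wpM2r (ltW f0) h.
rewrite -(mulrA (4 ^+ m * _)) e1 in h2.
have -> : 4 ^+ m * m`!%:R * expR 4^-1 * (normal_peak 1 / normal_peak s) *
   (normal_peak s * expR (- (t ^+ 2 / 4))) =
   4 ^+ m * m`!%:R * expR 4^-1 * (normal_peak 1 * expR (- (t ^+ 2 / 4))).
  by field; rewrite gt_eqF.
rewrite mulrCA mulrA [X in X <= _](_ : _ =
  (1 + t ^+ 2) ^+ m * expR (- (t ^+ 2 / 4)) *
  (normal_peak 1 * expR (- (t ^+ 2 / 4)))); last by ring.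
by rewrite ler_wpM2r// mulr_ge0 ?normal_peak_ge0 ?ltW.
Qed.

Lemma gauss_integrable F : measurable_fun setT F -> pgrowth F ->
  mu.-integrable setT (EFin \o (fun t => F t * gauss t)).
Proof.
move=> mF [m [C C0 FC]]; have [D D0 DC] := weight_gauss_le m.
apply: (@le_integrable _ _ R mu setT measurableT _
  (fun t => ((C * D)%:E * (normal_pdf 0 (Num.sqrt 2) t)%:E)%E)).
- apply/measurable_EFinP; apply: measurable_funM => //.
  exact: measurable_gauss.
- move=> t _ /=; rewrite lee_fin !normrM (ger0_norm (gauss_ge0 _)).
  rewrite (ger0_norm (normal_pdf_ge0 _ _ _)) (ger0_norm C0) (ger0_norm D0).
  apply: (le_trans (ler_wpM2r (gauss_ge0 _) (FC t))).
  by rewrite -!mulrA ler_wpM2l.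
- by apply: integrableZl => //; exact: integrable_normal_pdf.
Qed.

Definition gint F : R := (\int[mu]_t (F t * gauss t))%R.

(** The integrands on which [gint] is linear and monotone; the class is closed under sums, products
    and affine substitutions. *)
Definition mpg F := measurable_fun setT F /\ pgrowth F.

Lemma gintD F G : mpg F -> mpg G -> gint (fun t => F t + G t) = gint F + gint G.
Proof.
move=> [mF pF] [mG pG]; rewrite /gint; under eq_Rintegral do rewrite mulrDl.
by rewrite RintegralD//; exact: gauss_integrable.
Qed.

Lemma gintZ c F : mpg F -> gint (fun t => c * F t) = c * gint F.
Proof.
move=> [mF pF]; rewrite /gint; under eq_Rintegral do rewrite -mulrA.
by rewrite RintegralZl//; exact: gauss_integrable.
Qed.

Lemma gint_ge0 F : (forall t, 0 <= F t) -> 0 <= gint F.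
Proof.
by move=> F0; apply: Rintegral_ge0 => t _; rewrite mulr_ge0 ?gauss_ge0.
Qed.

Lemma mpgN F : mpg F -> mpg (fun t => - F t).
Proof.
move=> [mF pF]; split; first exact: measurable_funN.
by under eq_fun do rewrite -mulN1r; exact: pgrowthZ.
Qed.

Lemma mpgD F G : mpg F -> mpg G -> mpg (fun t => F t + G t).
Proof.
by move=> [mF pF] [mG pG]; split; [exact: measurable_funD|exact: pgrowthD].
Qed.

Lemma mpgM F G : mpg F -> mpg G -> mpg (fun t => F t * G t).
Proof.
by move=> [mF pF] [mG pG]; split; [exact: measurable_funM|exact: pgrowthM].
Qed.

Lemma mpg_cst (c : R) : mpg (fun=> c).
Proof. by split; [exact: measurable_cst|exact: pgrowth_cst]. Qed.

Lemma mpgX k : mpg (fun t => t ^+ k).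
Proof.
by split; [exact: exprn_measurable|exact: pgrowthX].
Qed.

Lemma mpg_comp F a b : mpg F -> mpg (fun t => F (a * t + b)).
Proof.
move=> [mF pF]; split; last exact: pgrowth_comp.
apply: measurableT_comp => //; exact: measurable_funD.
Qed.

Lemma mpg_norm F : mpg F -> mpg (fun t => `|F t|).
Proof.
move=> [mF pF]; split; first exact: measurableT_comp.
by apply: pgrowth_le pF _ => t; rewrite normr_id.
Qed.

Lemma gint_le F G : mpg F -> mpg G -> (forall t, F t <= G t) -> gint F <= gint G.
Proof.
move=> mF mG FG; rewrite -subr_ge0 -mulN1r -gintZ// -gintD//; last first.
  by apply: mpgM => //; exact: mpg_cst.
by apply: gint_ge0 => t; rewrite mulN1r subr_ge0.
Qed.

Lemma gint1 : gint (fun=> 1) = 1.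
Proof.
rewrite /gint /Rintegral; under eq_integral do rewrite mul1r.
by rewrite integral_normal_pdf.
Qed.

End gaussian_integral.

Section continuous_real.
Variable R : realType.
Implicit Types f g : R -> R.

Lemma continuous_compR f g : continuous f -> continuous g ->
  continuous (fun x => g (f x)).
Proof. by move=> cf cg x; exact: continuous_comp (cf x) (cg (f x)). Qed.

Lemma continuous_mulR f g : continuous f -> continuous g ->
  continuous (fun x => f x * g x).
Proof. by move=> cf cg x; apply: cvgM; [exact: cf|exact: cg]. Qed.

Lemma continuous_addR f g : continuous f -> continuous g ->
  continuous (fun x => f x + g x).
Proof. by move=> cf cg x; apply: cvgD; [exact: cf|exact: cg]. Qed.

Lemma continuous_affine (a b : R) : continuous (fun x => a * x + b).
Proof.
apply: continuous_addR; last by move=> x; exact: cvg_cst.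
by apply: continuous_mulR => x; [exact: cvg_cst|exact: cvg_id].
Qed.

End continuous_real.

(** * Gaussian moments by integration by parts, and affine changes of variable *)

Section gaussian_moments.
Variable R : realType.
Notation mu := (@lebesgue_measure R).
Implicit Types (F G : R -> R) (m k : nat) (t u v w : R).

Lemma is_derive_gauss t : is_derive t 1 (@gauss R) (- t * gauss t).
Proof.
have -> : @gauss R = fun t => normal_peak 1 * (expR \o (fun t => - (t ^+ 2 / 2))) t.
  by apply/funext => x; rewrite gaussE.
have h : is_derive t 1 (fun t : R => - (t ^+ 2 / 2)) (- t).
  have := is_derive_poly (- (2^-1 *: 'X^2) : {poly R}) t.
  rewrite [horner _](_ : _ = fun t : R => - (t ^+ 2 / 2)); last first.
    by apply/funext => x; rewrite hornerN hornerZ hornerXn mulrC.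
  by rewrite derivN derivZ derivXn !hornerE; congr is_derive; field.
have hc := @is_derive1_comp _ expR (fun t : R => - (t ^+ 2 / 2)) _ _ _ (is_derive_expR _) h.
apply: (is_derive_eq (is_deriveZ (normal_peak 1) hc)).
by rewrite /GRing.scale /= mulrC -mulrA mulrC -mulrA.
Qed.

(** This decay in 1 / (1 + t^2) controls the boundary terms of the integration by parts on
    [-n, n]. *)
Lemma monomial_gauss_le k : exists2 D : R, 0 <= D &
  forall t, `|t ^+ k * gauss t| * (1 + t ^+ 2) <= D.
Proof.
have [m [C C0 hC]] := @pgrowthX R k; have [D D0 hD] := @weight_gauss_le R m.+1.
have s0 : Num.sqrt 2 != 0 :> R by rewrite sqrtr_eq0 -ltNge.
exists (C * (D * normal_peak (Num.sqrt 2))) => [|t].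
  by rewrite !mulr_ge0 ?normal_peak_ge0.
rewrite normrM (ger0_norm (gauss_ge0 _)).
have q0 : 0 <= gauss t * (1 + t ^+ 2).
  by rewrite mulr_ge0 ?gauss_ge0// addr_ge0 ?sqr_ge0.
rewrite -mulrA (le_trans (ler_wpM2r q0 (hC t)))// -mulrA ler_wpM2l//.
rewrite [leLHS](_ : _ = (1 + t ^+ 2) ^+ m.+1 * gauss t); last first.
  by rewrite [in RHS]exprSr mulrA mulrAC.
by rewrite (le_trans (hD t))// ler_wpM2l// normal_pdf_ub.
Qed.

(** Since gauss' = - t gauss, the integrand is the derivative of t^k gauss(t) on the interval. For k
    = 0 the junk exponent [k.-1] carries the coefficient 0. *)
Lemma gint_itv k n : (0 < n)%N ->
  gint (fun t : R => (k%:R * t ^+ k.-1 - t ^+ k.+1) * \1_`[- n%:R, n%:R] t) =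
  n%:R ^+ k * gauss n%:R - (- n%:R) ^+ k * gauss (- n%:R).
Proof.
move=> n0; set a : R := n%:R.
have a0 : - a < a by rewrite gtrN// ltr0n.
pose f t := (k%:R * t ^+ k.-1 - t ^+ k.+1) * gauss t : R.
pose F t := t ^+ k * gauss t : R.
have dF t : is_derive t 1 F (f t).
  have hg := is_derive_gauss t.
  have hx : is_derive t 1 (fun t : R => t ^+ k) (k%:R * t ^+ k.-1).
    have := is_derive_poly ('X^k : {poly R}) t.
    rewrite derivXn hornerMn hornerXn mulr_natl.
    by rewrite (_ : horner 'X^k = fun t => t ^+ k)//; apply/funext => x; rewrite hornerXn.
  apply: (is_derive_eq (is_deriveM hx hg)); rewrite /GRing.scale /= /f exprSr.
  ring.
have -> : gint (fun t => (k%:R * t ^+ k.-1 - t ^+ k.+1) * \1_`[- a, a] t) =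
    \int[mu]_(t in `[- a, a]) f t.
  rewrite /gint [RHS]Rintegral_mkcond; apply: eq_Rintegral => t _.
  by rewrite patch_indic /f /=; ring.
have cF t : {for t, continuous F}.
  by apply: differentiable_continuous; apply/derivable1_diffP; case: (dF t).
have cf : continuous f.
  move=> t; apply: cvgM; last exact: continuous_gauss.
  apply: cvgB; first apply: cvgM; [exact: cvg_cst|exact: exprn_continuous|].
  exact: exprn_continuous.
rewrite /Rintegral (@continuous_FTC2 _ f F)//.
- exact: continuous_subspaceT.
- split.
  + by move=> t _; case: (dF t).
  + exact: cvg_at_right_filter (cF _).
  + exact: cvg_at_left_filter (cF _).
- by move=> t _; rewrite derive1E; case: (dF t).
Qed.

Lemma gint_norm_le F : mpg F -> `|gint F| <= gint (fun t => `|F t|).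
Proof.
move=> mF; have mN := mpg_norm mF; rewrite ler_norml.
rewrite -mulN1r -gintZ// !gint_le//.
- by move=> t; rewrite ler_norm.
- by apply: mpgM => //; exact: mpg_cst.
- by move=> t; rewrite mulN1r lerNl -normrN ler_norm.
Qed.

Lemma mpg_indic (A : set R) : measurable A -> mpg (\1_A : R -> R).
Proof.
move=> mA; split; first exact: measurable_indic.
exists 0%N, 1 => // t; rewrite expr0 mulr1 indicE.
by case: (_ \in _); rewrite ?normr1 ?normr0.
Qed.

(** Integration by parts on [-n, n]: the boundary terms are O(1 / n), and outside the interval |h|
    <= |h| t^2 / n. The mean of [h] is thus O(1 / n) for every n, hence 0. *)
Lemma gint_stein k : gint (fun t : R => t ^+ k.+1) =
  k%:R * gint (fun t : R => t ^+ k.-1).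
Proof.
pose h t : R := k%:R * t ^+ k.-1 - t ^+ k.+1.
have mh : mpg h.
  apply: mpgD; last exact/mpgN/mpgX.
  by apply: mpgM; [exact: mpg_cst|exact: mpgX].
suff : gint h = 0.
  rewrite /h; rewrite (@gintD _ (fun t => k%:R * t ^+ k.-1) (fun t => - t ^+ k.+1)).
  - under [X in _ + gint X]eq_fun do rewrite -mulN1r.
    rewrite !gintZ; [|exact: mpgX|exact: mpgX].
    by move/eqP; rewrite mulN1r subr_eq0 => /eqP.
  - by apply: mpgM; [exact: mpg_cst|exact: mpgX].
  - exact/mpgN/mpgX.
have [D D0 hD] := monomial_gauss_le k.
pose g t := `|h t| * t ^+ 2.
have mg : mpg g by apply: mpgM; [exact: mpg_norm|exact: mpgX].
have key n : (0 < n)%N -> `|gint h| <= (2 * D + gint g) / n%:R.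
  move=> n0; have n0' : 0 < n%:R :> R by rewrite ltr0n.
  pose I := `[- n%:R, n%:R]%classic : set R.
  have mI : mpg (\1_I : R -> R) by apply: mpg_indic; exact: measurable_itv.
  have -> : gint h = gint (fun t => h t * \1_I t) + gint (fun t => h t * (1 - \1_I t)).
    rewrite -gintD; first by congr gint; apply/funext => t; ring.
    - exact: mpgM.
    - by apply: mpgM => //; apply: mpgD (mpgN mI); exact: mpg_cst.
  apply: le_trans (ler_normD _ _) _; rewrite mulrDl lerD//.
    rewrite gint_itv//; apply: le_trans (ler_normB _ _) _.
    have b t : `|t| = n%:R -> `|t ^+ k * gauss t| <= D / n%:R.
      move=> tn; rewrite ler_pdivlMr//; apply: le_trans (hD t).
      rewrite ler_wpM2l// -(real_normK (num_real t)) tn.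
      have : (1 : R) <= n%:R by rewrite ler1n.
      nra.
    by rewrite mulr2n !mulrDl mul1r lerD// b ?normrN ?normr_nat.
  have m1 : mpg (fun t => h t * (1 - \1_I t)).
    by apply: mpgM => //; apply: mpgD (mpgN mI); exact: mpg_cst.
  apply: le_trans (gint_norm_le m1) _.
  rewrite mulrC -gintZ//; apply: gint_le.
  - exact: mpg_norm.
  - by apply: mpgM => //; exact: mpg_cst.
  - move=> t; rewrite /g normrM [leRHS]mulrCA ler_wpM2l// indicE.
    have [tI|tI] := boolP (t \in I).
      by rewrite subrr normr0 mulr_ge0 ?sqr_ge0// invr_ge0 ltW.
    rewrite subr0 normr1 mulrC ler_pdivlMr// mul1r.
    have nt : n%:R < `|t|.
      rewrite ltNge; apply: contra tI => tn; rewrite inE /I /= in_itv /=.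
      by rewrite -ler_norml.
    have n1 : (1 : R) <= n%:R by rewrite ler1n.
    rewrite -(real_normK (num_real t)); nra.
apply/eqP; rewrite -normr_le0; apply/ler_addgt0Pl => e e0; rewrite addr0.
have K0 : 0 <= 2 * D + gint g.
  by rewrite addr_ge0 ?mulr_ge0// gint_ge0// => t; rewrite mulr_ge0 ?sqr_ge0.
have [n n0 hn] : exists2 n, (0 < n)%N & (2 * D + gint g) / e <= n%:R.
  exists (Num.truncn ((2 * D + gint g) / e)).+1 => //.
  by rewrite ltW// truncnS_gt.
apply: le_trans (key n n0) _.
by rewrite ler_pdivrMr ?ltr0n// [e * _]mulrC -ler_pdivrMr.
Qed.

Lemma lebesgue_affine (K : R -> R) (a b : R) : 0 < a -> continuous K ->
  (forall t, 0 <= K t) ->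
  (\int[mu]_t (K t)%:E = \int[mu]_t (K (a * t + b) * a)%:E)%E.
Proof.
move=> a0 cK K0; pose F t : R := a * t + b.
have dF t : is_derive t 1 F a.
  have h : is_derive t 1 (fun t : R => a * t) a.
    by have := is_deriveZ a (is_derive_id t (1 : R)); rewrite /GRing.scale /= mulr1.
  by have := is_deriveD h (is_derive_cst b t 1); rewrite addr0.
have F'E : F^`()%classic = cst a.
  by apply/funext => t; rewrite derive1E; case: (dF t).
rewrite (@increasing_ge0_integration_by_substitutionT _ F K)//.
- by apply: eq_integral => t _; rewrite F'E.
- by move=> x y xy; rewrite /F ltrD2r ltr_pM2l.
- by rewrite F'E => t; exact: cvg_cst.
- by rewrite F'E; exact: is_cvg_cst.
- by rewrite F'E; exact: is_cvg_cst.
- exact: (cvg_comp _ _ (gt0_cvgMrNy a0 cvg_id) (cvg_addrr_Ny b)).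
- exact: (cvg_comp _ _ (gt0_cvgMry a0 cvg_id) (cvg_addrr b)).
Qed.

(** The map (u, v) |-> (c u + s v, s u - c v) is an orthogonal reflection, so it preserves u^2 +
    v^2. *)
Lemma gauss_reflect (c s u v : R) : c ^+ 2 + s ^+ 2 = 1 ->
  gauss (c * u + s * v) * gauss (s * u - c * v) = gauss u * gauss v.
Proof.
move=> cs; rewrite !gaussE mulrACA [RHS]mulrACA -!expRD; congr (_ * expR _).
have -> : - ((c * u + s * v) ^+ 2 / 2) - (s * u - c * v) ^+ 2 / 2 =
  - ((c ^+ 2 + s ^+ 2) * (u ^+ 2 + v ^+ 2) / 2) by field.
by rewrite cs; field.
Qed.

End gaussian_moments.

(** * Invariance of the planar Gaussian measure under reflections *)

Section gaussian_plane.
Variable R : realType.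
Notation mu := (@lebesgue_measure R).
Implicit Types (F : R -> R) (G H : R -> R -> R) (m k : nat) (t u v w : R).

Definition pgrowth2 (G : R -> R -> R) := exists m, exists2 C, 0 <= C &
  forall t w, `|G t w| <= C * (1 + t ^+ 2) ^+ m * (1 + w ^+ 2) ^+ m.

Definition mpg2 (G : R -> R -> R) :=
  measurable_fun setT (fun p : R * R => G p.1 p.2) /\ pgrowth2 G.

Lemma mpg2_slice G t : mpg2 G -> mpg (G t).
Proof.
move=> [mG [m [C C0 hC]]]; split.
  exact: (measurableT_comp mG (pair1_measurable t)).
exists m, (C * (1 + t ^+ 2) ^+ m) => //.
by rewrite mulr_ge0// exprn_ge0// addr_ge0// sqr_ge0.
Qed.

Lemma mpg2D G H : mpg2 G -> mpg2 H -> mpg2 (fun t w => G t w + H t w).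
Proof.
move=> [mG [m [C C0 hC]]] [mH [k [D D0 hD]]]; split; first exact: measurable_funD.
exists (m + k)%N, (C + D) => [|t w]; first exact: addr_ge0.
rewrite (le_trans (ler_normD _ _))// !mulrDl lerD//.
  rewrite (le_trans (hC t w))// ler_pM// ?weight_le ?leq_addr//.
  - by rewrite mulr_ge0// exprn_ge0// addr_ge0// sqr_ge0.
  - by rewrite exprn_ge0// addr_ge0// sqr_ge0.
  - by rewrite ler_wpM2l// weight_le// leq_addr.
rewrite (le_trans (hD t w))// ler_pM// ?weight_le ?leq_addl//.
- by rewrite mulr_ge0// exprn_ge0// addr_ge0// sqr_ge0.
- by rewrite exprn_ge0// addr_ge0// sqr_ge0.
- by rewrite ler_wpM2l// weight_le// leq_addl.
Qed.

Lemma gint_ge0E F : mpg F -> (forall t, 0 <= F t) ->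
  (gint F)%:E = (\int[mu]_t (F t * gauss t)%:E)%E.
Proof.
move=> [mF pF] F0; rewrite /gint /Rintegral fineK//.
by apply: integrable_fin_num => //; exact: gauss_integrable.
Qed.

Lemma mpg_gint_ge0 G : mpg2 G -> (forall t w, 0 <= G t w) ->
  mpg (fun t => gint (G t)).
Proof.
move=> mG G0; have [mG' [m [C C0 hC]]] := mG; split.
  rewrite /gint /Rintegral.
  apply: (measurableT_comp (fine_measurable measurableT)).
  have := @measurable_fun_fubini_tonelli_F _ _ _ _ R mu
    (fun p : R * R => (G p.1 p.2 * gauss p.2)%:E).
  apply.
    apply/measurable_EFinP/measurable_funM => //.
    exact: measurableT_comp (@measurable_gauss R) measurable_snd.
  by move=> x; rewrite lee_fin mulr_ge0 ?gauss_ge0.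
have mW : mpg (fun w : R => (1 + w ^+ 2) ^+ m).
  split; last by exists m, 1 => // w; rewrite mul1r ger0_norm// (le_trans ler01)// weight_ge1.
  by apply: measurable_funX; apply: measurable_funD => //; exact: exprn_measurable.
exists m, (C * gint (fun w : R => (1 + w ^+ 2) ^+ m)) => [|t].
  by rewrite mulr_ge0// gint_ge0// => w; rewrite (le_trans ler01)// weight_ge1.
have ms := mpg2_slice t mG.
apply: (le_trans (gint_norm_le ms)).
rewrite mulrAC -gintZ//; apply: gint_le => //; first exact: mpg_norm.
by apply: mpgM => //; exact: mpg_cst.
Qed.

Definition gint2 G : R := gint (fun t => gint (G t)).

Lemma gint2_ge0E G : mpg2 G -> (forall t w, 0 <= G t w) ->
  (gint2 G)%:E =
  (\int[mu]_t \int[mu]_w (gauss t * gauss w * G t w)%:E)%E.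
Proof.
move=> mG G0; rewrite /gint2 gint_ge0E//; last first.
- by move=> t; exact: gint_ge0.
- exact: mpg_gint_ge0.
apply: eq_integral => t _; rewrite EFinM gint_ge0E//; last exact: mpg2_slice.
rewrite -ge0_integralZr//; last first.
- by rewrite lee_fin gauss_ge0.
- by move=> w _; rewrite lee_fin mulr_ge0 ?gauss_ge0.
- apply/measurable_EFinP; apply: measurable_funM; last exact: measurable_gauss.
  by have [] := mpg2_slice t mG.
by apply: eq_integral => w _; rewrite -EFinM; congr EFin; ring.
Qed.

(** Tonelli is applied to nonnegative functions; a signed [G] is treated as the difference of
    [G + B] and [B]. *)
Lemma mpg2_dominated G : mpg2 G -> exists B, [/\ mpg2 B,
  forall t w, 0 <= B t w & forall t w, `|G t w| <= B t w].
Proof.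
move=> [mG [m [C C0 hC]]].
pose B t w : R := C * (1 + t ^+ 2) ^+ m * (1 + w ^+ 2) ^+ m.
have B0 t w : 0 <= B t w.
  by rewrite !mulr_ge0// (le_trans ler01)// weight_ge1.
exists B; split=> //; first split.
- have mw : measurable_fun setT (fun t : R => (1 + t ^+ 2) ^+ m).
    by apply: measurable_funX; apply: measurable_funD => //; exact: exprn_measurable.
  apply: measurable_funM; first apply: measurable_funM => //.
    exact: (measurableT_comp mw measurable_fst).
  exact: (measurableT_comp mw measurable_snd).
- by exists m, C => // t w; rewrite ger0_norm.
Qed.

Lemma mpg_gint G : mpg2 G -> mpg (fun t => gint (G t)).
Proof.
move=> mG; have [B [mB B0 GB]] := mpg2_dominated mG.
have -> : (fun t => gint (G t)) =
    fun t => gint (fun w => G t w + B t w) + - gint (B t).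
  apply/funext => t; rewrite gintD; [by rewrite addrK|exact: mpg2_slice..].
apply: mpgD; first apply: (mpg_gint_ge0 (G := fun t w => G t w + B t w)).
- exact: mpg2D.
- by move=> t w; have := GB t w; rewrite ler_norml; lra.
- exact/mpgN/mpg_gint_ge0.
Qed.

Lemma gint2D G H : mpg2 G -> mpg2 H ->
  gint2 (fun t w => G t w + H t w) = gint2 G + gint2 H.
Proof.
move=> mG mH; rewrite /gint2 -gintD; [|exact: mpg_gint..].
by congr gint; apply/funext => t; rewrite gintD//; exact: mpg2_slice.
Qed.

Section reflection.
Variables c s : R.
Hypotheses (cs : c ^+ 2 + s ^+ 2 = 1) (s0 : 0 < s).

Definition reflect2 G u v : R := G (c * u + s * v) (s * u - c * v).

Lemma mpg2_reflect G : mpg2 G -> mpg2 (reflect2 G).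
Proof.
move=> [mG [m [C C0 hC]]]; split.
  apply: (measurableT_comp (f := fun p : R * R => G p.1 p.2)
    (g := fun p : R * R => (c * p.1 + s * p.2, s * p.1 - c * p.2))) => //.
  apply: measurable_fun_pair => /=.
    by apply: measurable_funD; apply: measurable_funM.
  by apply: measurable_funB; apply: measurable_funM.
exists (m + m)%N, (C * 4 ^+ m * 4 ^+ m) => [|u v].
  by rewrite !mulr_ge0 ?exprn_ge0.
apply: (le_trans (hC _ _)); rewrite -!mulrA ler_wpM2l//.
have u2 := sqr_ge0 u; have v2 := sqr_ge0 v.
have q a b : a ^+ 2 + b ^+ 2 = 1 ->
    1 + (a * u + b * v) ^+ 2 <= 4 * ((1 + u ^+ 2) * (1 + v ^+ 2)).
  move=> ab; have := sqr_ge0 (a * v - b * u) => h.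
  have e : (a * u + b * v) ^+ 2 + (a * v - b * u) ^+ 2 =
    (a ^+ 2 + b ^+ 2) * (u ^+ 2 + v ^+ 2) by ring.
  rewrite ab mul1r in e; nra.
have k := ler_pM _ _ (lerXn2r m _ _ (q _ _ cs))
  (lerXn2r m _ _ (q s (- c) _)).
rewrite !mulNr in k.
apply: le_trans (k _ _ _ _ _ _ _) _.
- by rewrite exprn_ge0// addr_ge0// sqr_ge0.
- by rewrite exprn_ge0// addr_ge0// sqr_ge0.
- by rewrite nnegrE addr_ge0// sqr_ge0.
- by rewrite nnegrE; nra.
- by rewrite nnegrE addr_ge0// sqr_ge0.
- by rewrite nnegrE; nra.
- by rewrite sqrrN addrC.
rewrite !exprMn !exprD le_eqVlt; apply/orP; left; apply/eqP.
set x := 4 ^+ m; set y := _ ^+ m; set z := _ ^+ m; ring.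
Qed.

Let reflectE1 u v : s^-1 * u - c * (s * v + c * u) / s = s * u - c * v.
Proof.
have sn0 : s != 0 by rewrite gt_eqF.
have e : u = (c ^+ 2 + s ^+ 2) * u by rewrite cs mul1r.
by rewrite {1}e; field.
Qed.

Let reflectE2 u t : c * u + s * (s^-1 * t - c * u / s) = t.
Proof. by field; rewrite gt_eqF. Qed.

Let reflectE3 u t : s * u - c * (s^-1 * t - c * u / s) = s^-1 * u - c * t / s.
Proof.
have sn0 : s != 0 by rewrite gt_eqF.
have e : s^-1 * u = s^-1 * ((c ^+ 2 + s ^+ 2) * u) by rewrite cs mul1r.
by rewrite e; field.
Qed.

(** The integrand in the mixed coordinates (t, u), where u = c t + s w: halfway between [G] and its
    reflection. *)
Let L G t u : R := gauss t * gauss (s^-1 * u - c * t / s) *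
  G t (s^-1 * u - c * t / s) * s^-1.

Let L_affine G (u v : R) : L G (s * v + c * u) u * s =
  gauss u * gauss v * reflect2 G u v.
Proof.
by rewrite /L reflectE1 [s * v + _]addrC gauss_reflect// mulfVK// gt_eqF.
Qed.

Let LE G (t u : R) : L G t u = gauss t * gauss (s^-1 * u - c * t / s) *
    reflect2 G u (s^-1 * t - c * u / s) * s^-1.
Proof. by rewrite /L /reflect2 reflectE2 reflectE3. Qed.

(** The planar change of variables is factored into two one-dimensional ones with Tonelli in
    between: w is replaced by u at fixed t, then t by v at fixed u. A reflection with s > 0, unlike
    a rotation, makes both substitutions increasing. *)
Lemma gint2_reflect_ge0 G : mpg2 G -> (forall t w, 0 <= G t w) ->
  (forall t, continuous (G t)) -> (forall u, continuous (reflect2 G u)) ->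
  gint2 G = gint2 (reflect2 G).
Proof.
move=> mG G0 cG cGr; apply: EFin_inj.
have mGr := mpg2_reflect mG.
have Gr0 u v : 0 <= reflect2 G u v by exact: G0.
rewrite (gint2_ge0E mG G0) (gint2_ge0E mGr Gr0).
have L0 t u : 0 <= L G t u.
  by rewrite /L !mulr_ge0 ?gauss_ge0 ?invr_ge0 ?G0 ?ltW.
transitivity (\int[mu]_t \int[mu]_u (L G t u)%:E)%E.
  apply: eq_integral => t _.
  rewrite (@lebesgue_affine _ (fun w => gauss t * gauss w * G t w) s^-1 (- (c * t / s)))//.
  - by rewrite invr_gt0.
  - move=> w; apply: cvgM; last exact: cG.
    by apply: cvgM; [exact: cvg_cst|exact: continuous_gauss].
  - by move=> w; rewrite !mulr_ge0 ?gauss_ge0 ?G0.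
transitivity (\int[mu]_u \int[mu]_t (L G t u)%:E)%E.
  apply: (fubini_tonelli (m1 := mu) (m2 := mu)
    (fun p : R * R => (L G p.1 p.2)%:E)); last by move=> p; rewrite lee_fin.
  apply/measurable_EFinP.
  have ml : measurable_fun setT (fun p : R * R => s^-1 * p.2 - c * p.1 / s).
    apply: measurable_funB; first by apply: measurable_funM.
    by apply: measurable_funM => //; apply: measurable_funM.
  apply: measurable_funM => //; apply: measurable_funM.
    apply: measurable_funM.
      exact: (measurableT_comp (@measurable_gauss R) measurable_fst).
    exact: (measurableT_comp (@measurable_gauss R) ml).
  apply: (measurableT_comp (f := fun p : R * R => G p.1 p.2)
    (g := fun p : R * R => (p.1, s^-1 * p.2 - c * p.1 / s))).
    exact: mG.1.
  exact: measurable_fun_pair.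
apply: eq_integral => u _ /=.
rewrite (@lebesgue_affine _ ((L G) ^~ u) s (c * u))//.
  by apply: eq_integral => v _; rewrite L_affine.
have -> : (L G) ^~ u = fun t : R => gauss t * gauss (s^-1 * u - c * t / s) *
    reflect2 G u (s^-1 * t - c * u / s) * s^-1.
  by apply/funext => t; exact: LE.
apply: continuous_mulR; last by move=> t; exact: cvg_cst.
have c1 : continuous (fun t : R => s^-1 * u - c * t / s).
  have -> : (fun t : R => s^-1 * u - c * t / s) = fun t => - c / s * t + s^-1 * u.
    by apply/funext => t; rewrite mulNr mulrAC [LHS]addrC mulNr.
  exact: continuous_affine.
apply: continuous_mulR; first apply: continuous_mulR.
- exact: continuous_gauss.
- exact: (continuous_compR c1 (@continuous_gauss R)).
- exact: (continuous_compR (@continuous_affine R _ _) (cGr u)).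
Qed.

(** The signed case follows from [G + B] and [B]. The majorant is an explicit weight because it has
    to be continuous, together with its reflection. *)
Lemma gint2_reflect G : mpg2 G ->
  (forall t, continuous (G t)) -> (forall u, continuous (reflect2 G u)) ->
  gint2 G = gint2 (reflect2 G).
Proof.
move=> mG cG cGr; have [m [C C0 hC]] := mG.2.
have [B [mB cB cBr B0 GB]] : exists B, [/\ mpg2 B, forall t, continuous (B t),
    forall u, continuous (reflect2 B u), forall t w, 0 <= B t w &
    forall t w, `|G t w| <= B t w].
  have cw : continuous (fun w : R => (1 + w ^+ 2) ^+ m).
    apply: (continuous_compR (f := fun w : R => 1 + w ^+ 2) (g := fun x => x ^+ m));
      last exact: exprn_continuous.
    by apply: continuous_addR; [move=> x; exact: cvg_cst|exact: exprn_continuous].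
  have mw : measurable_fun setT (fun t : R => (1 + t ^+ 2) ^+ m).
    exact: continuous_measurable_fun.
  have w0 t : 0 <= (1 + t ^+ 2) ^+ m :> R by rewrite (le_trans ler01)// weight_ge1.
  exists (fun t w : R => C * (1 + t ^+ 2) ^+ m * (1 + w ^+ 2) ^+ m); split=> //.
  - split; last by exists m, C => // t w; rewrite ger0_norm// !mulr_ge0.
    apply: measurable_funM; first apply: measurable_funM => //.
      exact: (measurableT_comp mw measurable_fst).
    exact: (measurableT_comp mw measurable_snd).
  - by move=> t; apply: continuous_mulR => // x; exact: cvg_cst.
  - move=> u; rewrite /reflect2; apply: continuous_mulR; first apply: continuous_mulR.
    + by move=> x; exact: cvg_cst.
    + rewrite (_ : (fun x => _) = fun x : R => (1 + (s * x + c * u) ^+ 2) ^+ m).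
        exact: (continuous_compR (@continuous_affine R _ _) cw).
      by apply/funext => x; rewrite addrC (addrC (c * u)) addrC.
    + rewrite (_ : (fun x => _) = fun x : R => (1 + (- c * x + s * u) ^+ 2) ^+ m).
        exact: (continuous_compR (@continuous_affine R _ _) cw).
      by apply/funext => x; rewrite mulNr (addrC (s * u)).
  - by move=> t w; rewrite !mulr_ge0.
have GB0 t w : 0 <= G t w + B t w by have := GB t w; rewrite ler_norml; lra.
have cGB t : continuous (fun w => G t w + B t w) := continuous_addR (cG t) (cB t).
have cGBr u : continuous (reflect2 (fun t w => G t w + B t w) u) :=
  continuous_addR (cGr u) (cBr u).
have h := gint2_reflect_ge0 (mpg2D mG mB) GB0 cGB cGBr.
have h2 : gint2 (reflect2 (fun t w => G t w + B t w)) =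
  gint2 (reflect2 G) + gint2 (reflect2 B) :=
  gint2D (mpg2_reflect mG) (mpg2_reflect mB).
rewrite h2 (gint2D mG mB) (gint2_reflect_ge0 mB B0 cB cBr) in h.
exact: addIr h.
Qed.

End reflection.

Lemma gint_cst (a : R) : gint (fun=> a) = a.
Proof.
have := gintZ a (mpg_cst (1 : R)).
by rewrite gint1 !mulr1.
Qed.

(** An idle second variable does not change the mean of F(t); the reflection then turns t into a u +
    b v. *)
Lemma gint_line F (a b : R) : a ^+ 2 + b ^+ 2 = 1 -> 0 < b -> mpg F ->
  continuous F -> gint F = gint2 (fun u v => F (a * u + b * v)).
Proof.
move=> ab b0 mF cF.
have -> : gint F = gint2 (fun t _ => F t).
  by congr gint; apply/funext => t; rewrite gint_cst.
rewrite (gint2_reflect ab b0)//.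
- split; first exact: (measurableT_comp mF.1 measurable_fst).
  have [m [C C0 hC]] := mF.2; exists m, C => // t w.
  rewrite (le_trans (hC t))// ler_peMr ?weight_ge1// mulr_ge0//.
  by rewrite (le_trans ler01)// weight_ge1.
- by move=> t x; exact: cvg_cst.
- move=> u; rewrite /reflect2.
  under eq_fun do rewrite addrC.
  exact: (continuous_compR (@continuous_affine R b (a * u)) cF).
Qed.

Lemma mpg2_line F (a b : R) : a ^+ 2 + b ^+ 2 = 1 -> 0 < b -> mpg F ->
  mpg2 (fun u v => F (a * u + b * v)).
Proof.
move=> ab b0 mF.
have h := @mpg2_reflect a b ab (fun t _ => F t); apply: h.
split; first exact: (measurableT_comp mF.1 measurable_fst).
have [m [C C0 hC]] := mF.2; exists m, C => // t w.
rewrite (le_trans (hC t))// ler_peMr ?weight_ge1// mulr_ge0//.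
by rewrite (le_trans ler01)// weight_ge1.
Qed.

(** Both sides are means along the direction (-r, r). Exchanging the two variables, which is the
    reflection with c = 0 and s = 1, changes the sign of that coordinate. *)
Lemma gint_sym F : mpg F -> continuous F -> gint (fun t => F (- t)) = gint F.
Proof.
move=> mF cF; pose r : R := (Num.sqrt 2)^-1.
have r0 : 0 < r by rewrite invr_gt0 sqrtr_gt0.
have r2 : (- r) ^+ 2 + r ^+ 2 = 1.
  by rewrite sqrrN exprVn sqr_sqrtr//; field.
have cN : continuous (fun t => F (- t)).
  by apply: continuous_compR cF; exact: oppr_continuous.
have mN : mpg (fun t => F (- t)).
  have := mpg_comp (-1) 0 mF.
  by under [X in mpg X -> _]eq_fun do rewrite addr0 mulN1r.
rewrite (gint_line r2 r0 mN cN) (gint_line r2 r0 mF cF).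
have cl a b : continuous (fun v => F (a + b * v)).
  under eq_fun do rewrite addrC.
  exact: (continuous_compR (@continuous_affine R b a) cF).
rewrite (@gint2_reflect 0 1 _ _ (fun u v => F (- r * u + r * v))) /reflect2.
- congr gint; apply/funext => u; congr gint; apply/funext => v; congr F.
  by rewrite !mul0r !mul1r add0r subr0 opprD mulNr opprK addrC mulNr.
- by rewrite expr0n expr1n add0r.
- exact: ltr01.
- exact: mpg2_line.
- by move=> t; exact: cl.
- move=> u; rewrite (_ : (fun v => _) = fun v => F (r * u + - r * v)); first exact: cl.
  by apply/funext => v; rewrite !mul0r !mul1r add0r subr0 addrC.
Qed.

End gaussian_plane.

(** * A finitely additive Gaussian mean defined on all functions *)

Section gaussian_mean.
Variable R : realType.
Implicit Types (F G : R -> R).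

Let upper_sums F : set R :=
  [set gint G | G in [set G : R -> R | mpg G /\ forall t, F t <= G t]].

(** An upper integral: it is sublinear on functions of polynomial growth, and serves as the
    dominating functional for Hahn-Banach. *)
Let upper F : R := inf (upper_sums F).

Let weight m (C t : R) : R := C * (1 + t ^+ 2) ^+ m.

Let mpg_weight m C : mpg (weight m C).
Proof.
apply: mpgM; first exact: mpg_cst.
split; last by exists m, 1 => // t; rewrite mul1r ger0_norm// (le_trans ler01)// weight_ge1.
by apply: measurable_funX; apply: measurable_funD => //; exact: exprn_measurable.
Qed.

Let upper_has_inf F : pgrowth F -> has_inf (upper_sums F).
Proof.
move=> [m [C C0 hC]]; split.
  exists (gint (weight m C)), (weight m C) => //; split; first exact: mpg_weight.
  by move=> t; rewrite (le_trans (ler_norm _)).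
exists (gint (weight m (- C))) => _ [G [mG FG] <-]; apply: gint_le; [exact: mpg_weight|exact: mG|].
by move=> t; apply: le_trans (FG t); rewrite /weight mulNr lerNl (le_trans _ (hC t))// -normrN ler_norm.
Qed.

Let upper_le F G : pgrowth F -> mpg G -> (forall t, F t <= G t) ->
  upper F <= gint G.
Proof.
by move=> /upper_has_inf[_ lF] mG FG; apply: ge_inf => //; exists G.
Qed.

Let upper_ge F c : pgrowth F ->
  (forall G, mpg G -> (forall t, F t <= G t) -> c <= gint G) -> c <= upper F.
Proof.
move=> /upper_has_inf[nF _] h; apply: lb_le_inf => // _ [G [mG FG] <-].
exact: h.
Qed.

Let upper0 : upper 0 = 0.
Proof.
have g0 : gint (fun=> 0 : R) = 0 by rewrite gint_cst.
apply/eqP; rewrite eq_le; apply/andP; split.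
  by rewrite -[leRHS]g0; apply: upper_le => //; [exact: pgrowth_cst|exact: mpg_cst].
apply: upper_ge; first exact: pgrowth_cst.
by move=> G mG G0; exact: gint_ge0.
Qed.

Let upperD F G : pgrowth F -> pgrowth G -> upper (F + G) <= upper F + upper G.
Proof.
move=> pF pG; rewrite -lerBlDr; apply: upper_ge => // G1 m1 F1.
rewrite lerBlDr -lerBlDl; apply: upper_ge => // G2 m2 F2.
rewrite lerBlDl -gintD//; apply: upper_le; [exact: pgrowthD|exact: mpgD|].
by move=> t; exact: lerD.
Qed.

Let upperZ a F : 0 <= a -> pgrowth F -> upper (a *: (F : R -> R^o)) = a * upper F.
Proof.
have h b H : 0 < b -> pgrowth H -> b * upper H <= upper (b *: (H : R -> R^o)).
  move=> b0 pH; apply: upper_ge; first exact: pgrowthZ.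
  move=> G mG HG; rewrite -ler_pdivlMl// -gintZ//; apply: upper_le => //.
    by apply: mpgM => //; exact: mpg_cst.
  by move=> t; rewrite ler_pdivlMl//; exact: HG.
rewrite le_eqVlt => /predU1P[<- _|a0 pF].
  by rewrite scale0r mul0r upper0.
apply/eqP; rewrite eq_le h// andbT -ler_pdivrMl//.
have := h a^-1 (a *: (F : R -> R^o)); rewrite scalerA mulVf ?gt_eqF// scale1r.
by apply; rewrite ?invr_gt0//; exact: pgrowthZ.
Qed.

(* The functionals obtained from Hahn-Banach are not measurable as functions of
   the evaluation point, so their mean needs an extension of the Gaussian
   integral to all functions. *)
Lemma gmean_exists : exists E : (R -> R) -> R,
  [/\ forall F G, E (fun t => F t + G t) = E F + E G,
      forall a F, E (fun t => a * F t) = a * E F,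
      forall F, mpg F -> E F = gint F &
      forall F, pgrowth F -> (forall t, 0 <= F t) -> 0 <= E F].
Proof.
have W0 : @pgrowth R 0 by exact: pgrowth_cst.
have h0 : forall x : R^o, pgrowth ((\0 : R^o -> (R -> R^o)) x) ->
    (\0 : R^o -> R) x <= upper ((\0 : R^o -> (R -> R^o)) x).
  by move=> x _ /=; rewrite upper0.
(* The functional that is extended is 0 on the trivial subspace. Domination by [upper], applied to F
   and to - F, already forces agreement with [gint] on [mpg] functions, and positivity. *)
have [g [gD gZ _ gp]] := @hahn_banach R (R -> R^o) (@pgrowth R) upper
  W0 (@pgrowthD R) (@pgrowthZ R) upperD upperZ (R^o : lmodType R) \0 \0 h0.
have gN F : g (fun t => - F t) = - g F.
  have := gZ (-1) F; rewrite mulN1r => <-; congr g.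
  by apply/funext => t; rewrite scaleN1r.
have pN F : pgrowth F -> pgrowth (fun t => - F t).
  by move=> pF; under eq_fun do rewrite -mulN1r; exact: pgrowthZ.
exists g; split=> //.
- move=> F [mF pF]; apply/eqP; rewrite eq_le; apply/andP; split.
    by apply: le_trans (gp _ pF) _; apply: upper_le.
  rewrite -lerN2 -gN (le_trans (gp _ (pN _ pF)))//.
  rewrite -mulN1r -gintZ//; apply: upper_le; first exact: pN.
    by apply: mpgM => //; exact: mpg_cst.
  by move=> t; rewrite mulN1r.
- move=> F pF F0; rewrite -oppr_le0 -gN (le_trans (gp _ (pN _ pF)))//.
  rewrite -(gint_cst (0 : R)); apply: upper_le; first exact: pN.
    exact: mpg_cst.
  by move=> t; rewrite oppr_le0.
Qed.

Definition gmean : (R -> R) -> R := projT1 (cid gmean_exists).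

Lemma gmeanD F G : gmean (fun t => F t + G t) = gmean F + gmean G.
Proof. by rewrite /gmean; case: cid => E []. Qed.

Lemma gmeanZ a F : gmean (fun t => a * F t) = a * gmean F.
Proof. by rewrite /gmean; case: cid => E []. Qed.

Lemma gmeanE F : mpg F -> gmean F = gint F.
Proof. by rewrite /gmean; case: cid => E /= [_ _ h _]; exact: h. Qed.

Lemma gmean_ge0 F : pgrowth F -> (forall t, 0 <= F t) -> 0 <= gmean F.
Proof. by rewrite /gmean; case: cid => E /= [_ _ _ h]; exact: h. Qed.

Lemma gmeanN F : gmean (fun t => - F t) = - gmean F.
Proof. by rewrite -mulN1r -gmeanZ; under eq_fun do rewrite -mulN1r. Qed.

Lemma gmean_le F G : pgrowth F -> pgrowth G -> (forall t, F t <= G t) ->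
  gmean F <= gmean G.
Proof.
move=> pF pG FG; rewrite -subr_ge0 -gmeanN -gmeanD; apply: gmean_ge0.
  apply: pgrowthD pG _.
  by under eq_fun do rewrite -mulN1r; exact: pgrowthZ.
by move=> t; rewrite subr_ge0.
Qed.

Lemma gmean_cst a : gmean (fun=> a) = a.
Proof. by rewrite gmeanE ?gint_cst//; exact: mpg_cst. Qed.

Definition scons (t : R) (g : nat -> R) : nat -> R :=
  fun i => if i is j.+1 then g j else t.

(** Vectors are sequences whose first n coordinates are averaged and whose other coordinates are 0,
    so that the recursion on n involves no dependent type. The order of the variables is fixed, as a
    finitely additive mean need not satisfy Fubini. *)
Fixpoint gmeann n (F : (nat -> R) -> R) : R :=
  if n is k.+1 then gmean (fun t => gmeann k (fun g => F (scons t g)))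
  else F (fun=> 0).

End gaussian_mean.

(** * Gaussian means in several variables *)

Section gaussian_mean_n.
Variable R : realType.
Implicit Types (F G : (nat -> R) -> R) (g : nat -> R).

Lemma gmeannD n F G : gmeann n (fun g => F g + G g) = gmeann n F + gmeann n G.
Proof.
elim: n F G => [|n ih] F G //=; rewrite -gmeanD; congr gmean.
by apply/funext => t; rewrite ih.
Qed.

Lemma gmeannZ n a F : gmeann n (fun g => a * F g) = a * gmeann n F.
Proof.
elim: n F => [|n ih] F //=; rewrite -gmeanZ; congr gmean.
by apply/funext => t; rewrite ih.
Qed.

Lemma gmeann_cst n a : gmeann n (fun=> a : R) = a.
Proof. by elim: n => [|n ih] //=; rewrite ih gmean_cst. Qed.

Lemma gmeannZr n a F : gmeann n (fun g => F g * a) = gmeann n F * a.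
Proof. by rewrite mulrC -gmeannZ; congr gmeann; apply/funext => g; rewrite mulrC. Qed.

Lemma gmeannN n F : gmeann n (fun g => - F g) = - gmeann n F.
Proof.
by rewrite -mulN1r -gmeannZ; congr gmeann; apply/funext => g; rewrite mulN1r.
Qed.

Lemma gmeannB n F G : gmeann n (fun g => F g - G g) = gmeann n F - gmeann n G.
Proof. by rewrite gmeannD gmeannN. Qed.

Lemma gmeann_sum n (I : Type) (r : seq I) (P : pred I) (F : I -> (nat -> R) -> R) :
  gmeann n (fun g => \sum_(i <- r | P i) F i g) =
  \sum_(i <- r | P i) gmeann n (F i).
Proof.
elim: r => [|i r ih].
  by rewrite big_nil; under eq_fun do rewrite big_nil; rewrite gmeann_cst.
rewrite big_cons; case: (boolP (P i)) => Pi; rewrite -ih -?gmeannD; congr gmeann;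
  by apply/funext => g; rewrite big_cons ?Pi ?(negbTE Pi).
Qed.

Lemma gmeann_prod n (f : nat -> R -> R) :
  gmeann n (fun g => \prod_(i < n) f i (g i)) = \prod_(i < n) gmean (f i).
Proof.
elim: n f => [|n ih] f; first by rewrite /= !big_ord0.
rewrite big_ord_recl /= mulrC -gmeanZ; congr gmean; apply/funext => t.
rewrite mulrC -(ih (fun i => f i.+1)) -gmeannZ; congr gmeann.
by apply/funext => g; rewrite big_ord_recl.
Qed.

Definition weightn n m g : R := \prod_(i < n) (1 + g i ^+ 2) ^+ m.

Definition growth n F := exists m, exists2 C, 0 <= C &
  forall g, `|F g| <= C * weightn n m g.

Lemma weightn_ge1 n m g : 1 <= weightn n m g.
Proof.
rewrite /weightn; elim/big_ind: _ => // [x y x1 y1|i _].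
  by rewrite -[leLHS]mulr1 ler_pM.
exact: weight_ge1.
Qed.

Lemma weightn_ge0 n m g : 0 <= weightn n m g.
Proof. exact: le_trans (weightn_ge1 _ _ _). Qed.

Lemma weightn_le n m k g : (m <= k)%N -> weightn n m g <= weightn n k g.
Proof.
move=> mk; apply: ler_prod => i _; rewrite weight_le// andbT.
exact: le_trans (weight_ge1 _ _).
Qed.

Lemma weightnD n m k g : weightn n (m + k) g = weightn n m g * weightn n k g.
Proof. by rewrite /weightn -big_split; apply: eq_bigr => i _; rewrite exprD. Qed.

Lemma weightn_scons n m t g :
  weightn n.+1 m (scons t g) = (1 + t ^+ 2) ^+ m * weightn n m g.
Proof. by rewrite /weightn big_ord_recl. Qed.

Lemma growth_le n F G : growth n G -> (forall g, `|F g| <= `|G g|) -> growth n F.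
Proof.
by move=> [m [C C0 hC]] FG; exists m, C => // g; exact: le_trans (FG g) (hC g).
Qed.

Lemma growthD n F G : growth n F -> growth n G -> growth n (fun g => F g + G g).
Proof.
move=> [m [C C0 h]] [k [D D0 h']]; exists (m + k)%N, (C + D); first exact: addr_ge0.
move=> g; rewrite (le_trans (ler_normD _ _))// mulrDl lerD//.
  by rewrite (le_trans (h g))// ler_wpM2l// weightn_le// leq_addr.
by rewrite (le_trans (h' g))// ler_wpM2l// weightn_le// leq_addl.
Qed.

Lemma growthM n F G : growth n F -> growth n G -> growth n (fun g => F g * G g).
Proof.
move=> [m [C C0 h]] [k [D D0 h']]; exists (m + k)%N, (C * D); first exact: mulr_ge0.
by move=> g; rewrite normrM weightnD mulrACA ler_pM.
Qed.

Lemma growth_cst n (c : R) : growth n (fun=> c).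
Proof.
exists 0%N, `|c| => // g; rewrite ler_peMr// /weightn.
by rewrite big1// => i _; rewrite expr0.
Qed.

Lemma growth_coord n (i : nat) : (i < n)%N -> growth n (fun g => g i).
Proof.
move=> ni; exists 1%N, 1 => // g; rewrite mul1r /weightn (bigD1 (Ordinal ni))//=.
have h : `|g i| <= (1 + g i ^+ 2) ^+ 1.
  rewrite expr1 -(real_normK (num_real (g i))).
  by have := sqr_ge0 (`|g i| - 1); have := normr_ge0 (g i); nra.
rewrite -[leLHS]mulr1 ler_pM//.
elim/big_ind: _ => // [x y x1 y1|j _]; last exact: weight_ge1.
by rewrite -[leLHS]mulr1 ler_pM.
Qed.

Lemma growthN n F : growth n F -> growth n (fun g => - F g).
Proof. by move=> /growth_le; apply => g; rewrite normrN. Qed.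

Lemma growthB n F G : growth n F -> growth n G -> growth n (fun g => F g - G g).
Proof. by move=> ? ?; exact/growthD/growthN. Qed.

Lemma growth_norm n F : growth n F -> growth n (fun g => `|F g|).
Proof. by move=> /growth_le; apply => g; rewrite normr_id. Qed.

Lemma growthX n F k : growth n F -> growth n (fun g => F g ^+ k).
Proof.
move=> gF; elim: k => [|k ih]; first exact: growth_cst.
by under eq_fun do rewrite exprS; exact: growthM.
Qed.

Lemma growth_sum n (I : Type) (r : seq I) (P : pred I) (F : I -> (nat -> R) -> R) :
  (forall i, P i -> growth n (F i)) -> growth n (fun g => \sum_(i <- r | P i) F i g).
Proof.
move=> gF; elim: r => [|i r ih].
  by under eq_fun do rewrite big_nil; exact: growth_cst.
under eq_fun do rewrite big_cons; case: (boolP (P i)) => Pi //.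
by apply: growthD => //; exact: gF.
Qed.

Lemma growth_prod n (I : Type) (r : seq I) (P : pred I) (F : I -> (nat -> R) -> R) :
  (forall i, P i -> growth n (F i)) -> growth n (fun g => \prod_(i <- r | P i) F i g).
Proof.
move=> gF; elim: r => [|i r ih].
  by under eq_fun do rewrite big_nil; exact: growth_cst.
under eq_fun do rewrite big_cons; case: (boolP (P i)) => Pi //.
by apply: growthM => //; exact: gF.
Qed.

Lemma growth_slice n F t : growth n.+1 F -> growth n (fun g => F (scons t g)).
Proof.
move=> [m [C C0 h]]; exists m, (C * (1 + t ^+ 2) ^+ m) => [|g].
  by rewrite mulr_ge0// (le_trans ler01)// weight_ge1.
by rewrite -mulrA -weightn_scons.
Qed.

Lemma growth_weightn n m : growth n (weightn n m).
Proof. by exists m, 1 => // g; rewrite mul1r ger0_norm// weightn_ge0. Qed.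

Let mono n := forall F G, growth n F -> growth n G -> (forall g, F g <= G g) ->
  gmeann n F <= gmeann n G.

Let mono_norm n F G : mono n -> growth n F -> growth n G ->
  (forall g, `|F g| <= G g) -> `|gmeann n F| <= gmeann n G.
Proof.
move=> mn gF gG FG; rewrite ler_norml -gmeannN; apply/andP; split; apply: mn => //.
- exact: growthN.
- by move=> g; have := FG g; rewrite ler_norml => /andP[].
- by move=> g; have := FG g; rewrite ler_norml => /andP[].
Qed.

(** Monotonicity in n variables bounds the inner mean, and [gmean_le] asks for such a bound before
    it compares outer means; this is how the induction for [gmeann_le] closes. *)
Let mono_slice n F : mono n -> growth n.+1 F ->
  pgrowth (fun t => gmeann n (fun g => F (scons t g))).
Proof.
move=> mn gF; have [m [C C0 h]] := gF.
exists m, (C * gmeann n (weightn n m)) => [|t].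
  rewrite mulr_ge0//; apply: le_trans (mn (fun=> 1) _ _ _ _).
  - by rewrite gmeann_cst.
  - exact: growth_cst.
  - exact: growth_weightn.
  - by move=> g; exact: weightn_ge1.
rewrite mulrAC -gmeannZ; apply: mono_norm => //; first exact: growth_slice.
  by apply: growthM; [exact: growth_cst|exact: growth_weightn].
by move=> g; rewrite -mulrA -weightn_scons.
Qed.

Lemma gmeann_le n F G : growth n F -> growth n G -> (forall g, F g <= G g) ->
  gmeann n F <= gmeann n G.
Proof.
elim: n F G => [|n ih] F G gF gG FG; first exact: FG.
apply: gmean_le => [||t]; [exact: mono_slice ih gF|exact: mono_slice ih gG|].
by apply: ih => [||g]; [exact: growth_slice|exact: growth_slice|exact: FG].
Qed.

Lemma gmeann_norm_le n F G : growth n F -> growth n G ->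
  (forall g, `|F g| <= G g) -> `|gmeann n F| <= gmeann n G.
Proof. by move=> gF gG FG; apply: mono_norm => //; exact: gmeann_le. Qed.

Lemma gmeann_ge0 n F : growth n F -> (forall g, 0 <= F g) -> 0 <= gmeann n F.
Proof.
move=> gF F0; rewrite -(gmeann_cst n 0); apply: gmeann_le => //.
exact: growth_cst.
Qed.

Lemma gmean_sum (I : Type) (r : seq I) (P : pred I) (F : I -> R -> R) :
  gmean (fun t => \sum_(i <- r | P i) F i t) = \sum_(i <- r | P i) gmean (F i).
Proof. exact: (@gmeann_sum 1 I r P (fun i g => F i (g 0%N))). Qed.

Let poly2_term (c u s t a b q : R) (i x l y k m : nat) :
  (c * u) ^+ i * (s * t) ^+ x *+ k * (q * ((a * u) ^+ l * (b * t) ^+ y *+ m)) =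
  q * (c ^+ i * s ^+ x *+ k) * (a ^+ l * b ^+ y *+ m) *
  (u ^+ i * u ^+ l) * (t ^+ x * t ^+ y).
Proof.
rewrite !exprMn -!(mulr_natr (_ * _) k) -!(mulr_natr (_ * _) m).
move: (c ^+ i) (u ^+ i) (s ^+ x) (t ^+ x) (a ^+ l) (u ^+ l) (b ^+ y) (t ^+ y).
move: (k%:R) (m%:R) => z1 z2 z3 z4 z5 z6 z7 z8 z9 z10; ring.
Qed.

(** Binomial expansion: the moments in v become coefficients, and the degree in u does not exceed
    the total degree. *)
Lemma gmean_poly2 (c s a b : R) i (q : {poly R}) : exists Q : {poly R},
  (size Q <= i + size q)%N /\
  forall u, gmean (fun v => (c * u + s * v) ^+ i * q.[a * u + b * v]) = Q.[u].
Proof.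
pose K l x y : R := q`_l * (c ^+ (i - x) * s ^+ x *+ 'C(i, x)) *
  (a ^+ (l - y) * b ^+ y *+ 'C(l, y)) * gmean (fun t => t ^+ (x + y)).
exists (\sum_(l < size q) \sum_(x < i.+1) \sum_(y < l.+1)
  K l x y *: 'X^((i - x) + (l - y))); split.
  apply: (leq_trans (size_sum _ _ _)); apply/bigmax_leqP => l _.
  apply: (leq_trans (size_sum _ _ _)); apply/bigmax_leqP => x _.
  apply: (leq_trans (size_sum _ _ _)); apply/bigmax_leqP => y _.
  apply: (leq_trans (size_scale_leq _ _)); rewrite size_polyXn -addnS.
  by rewrite leq_add ?leq_subr// (leq_trans _ (ltn_ord l))// ltnS leq_subr.
move=> u; rewrite horner_sum.
under eq_fun do rewrite horner_coef mulr_sumr.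
rewrite gmean_sum; apply: eq_bigr => l _.
rewrite horner_sum.
under eq_fun do rewrite exprDn mulr_suml.
rewrite gmean_sum; apply: eq_bigr => x _.
rewrite horner_sum.
under eq_fun do rewrite exprDn !mulr_sumr.
rewrite gmean_sum; apply: eq_bigr => y _.
rewrite hornerZ hornerXn exprD /K.
rewrite [RHS]mulrAC -gmeanZ; congr gmean; apply/funext => t.
by rewrite exprD poly2_term.
Qed.

Lemma mpg_sum (I : Type) (r : seq I) (P : pred I) (F : I -> R -> R) :
  (forall i, mpg (F i)) -> mpg (fun t => \sum_(i <- r | P i) F i t).
Proof.
move=> mF; elim: r => [|i r ih].
  by under eq_fun do rewrite big_nil; exact: mpg_cst.
by under eq_fun do rewrite big_cons; case: (P i) => //; exact: mpgD.
Qed.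

Lemma mpg_horner (q : {poly R}) : mpg (fun t => q.[t]).
Proof.
under eq_fun do rewrite horner_coef.
by apply: mpg_sum => i; apply: mpgM; [exact: mpg_cst|exact: mpgX].
Qed.

Lemma mpg2M (G H : R -> R -> R) : mpg2 G -> mpg2 H -> mpg2 (fun t w => G t w * H t w).
Proof.
move=> [mG [m [C C0 hC]]] [mH [k [D D0 hD]]]; split; first exact: measurable_funM.
exists (m + k)%N, (C * D) => [|t w]; first exact: mulr_ge0.
rewrite normrM !exprD.
have -> : C * D * ((1 + t ^+ 2) ^+ m * (1 + t ^+ 2) ^+ k) *
    ((1 + w ^+ 2) ^+ m * (1 + w ^+ 2) ^+ k) =
  (C * (1 + t ^+ 2) ^+ m * (1 + w ^+ 2) ^+ m) *
  (D * (1 + t ^+ 2) ^+ k * (1 + w ^+ 2) ^+ k).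
  move: (_ ^+ m) (_ ^+ k) (_ ^+ m) (_ ^+ k) => x y z v; ring.
exact: ler_pM.
Qed.

Lemma mpg2_fst (F : R -> R) : mpg F -> mpg2 (fun t _ : R => F t).
Proof.
move=> mF; split; first exact: (measurableT_comp mF.1 measurable_fst).
have [m [C C0 hC]] := mF.2; exists m, C => // t w.
rewrite (le_trans (hC t))// ler_peMr ?weight_ge1// mulr_ge0//.
by rewrite (le_trans ler01)// weight_ge1.
Qed.

Lemma mpg2_snd (F : R -> R) : mpg F -> mpg2 (fun _ t : R => F t).
Proof.
move=> mF; split; first exact: (measurableT_comp mF.1 measurable_snd).
have [m [C C0 hC]] := mF.2; exists m, C => // t w.
rewrite (le_trans (hC w))// ler_wpM2r//.
  by rewrite (le_trans ler01)// weight_ge1.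
by rewrite ler_peMr ?weight_ge1.
Qed.

Lemma mpg2_lin (F : R -> R) a r : mpg F -> mpg2 (fun t w => F (a * t + r * w)).
Proof.
move=> [mF [m [C C0 hC]]]; split.
  apply: measurableT_comp => //.
  by apply: measurable_funD; apply: measurable_funM.
have a2 := sqr_ge0 a; have r2 := sqr_ge0 r.
exists m, (C * (1 + 2 * a ^+ 2 + 2 * r ^+ 2) ^+ m) => [|t w].
  by apply: mulr_ge0 => //; apply: exprn_ge0; lra.
rewrite (le_trans (hC _))// -!mulrA ler_wpM2l// -!exprMn lerXn2r//.
- by rewrite nnegrE addr_ge0// sqr_ge0.
- by rewrite nnegrE !mulr_ge0// ?addr_ge0// ?sqr_ge0//; lra.
have t2 := sqr_ge0 t; have w2 := sqr_ge0 w.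
have h := sqr_ge0 (a * t - r * w).
have h1 : 0 <= a ^+ 2 * w ^+ 2 by exact: mulr_ge0.
have h2 : 0 <= r ^+ 2 * t ^+ 2 by exact: mulr_ge0.
have h3 := mulr_ge0 a2 (mulr_ge0 t2 w2).
have h4 := mulr_ge0 r2 (mulr_ge0 t2 w2).
have h5 := mulr_ge0 t2 w2.
nra.
Qed.

(** A reflection of the plane turns a t + r w into s u with s^2 = a^2 + r^2. The other coordinate
    then meets only polynomial factors, and [gmean_poly2] integrates it out. *)
Lemma gmean_gint_line a r i k (q : {poly R}) :
  0 <= r -> (size q <= k.+1)%N -> exists Q : {poly R},
  [/\ (size Q <= (i + k).+1)%N,
    (i = 0%N -> (forall w, q.[w] = 1) -> forall w, Q.[w] = 1) &
    forall psi : R -> R, continuous psi -> mpg psi ->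
      gmean (fun t => t ^+ i * gint (fun w => psi (a * t + r * w) * q.[w])) =
      gint (fun w => psi (Num.sqrt (a ^+ 2 + r ^+ 2) * w) * Q.[w])].
Proof.
move=> r0 sq; set s := Num.sqrt _.
have mpsi c (psi : R -> R) : mpg psi -> mpg (fun t => psi (c * t)).
  move=> mp; have := mpg_comp c 0 mp.
  by under [X in mpg X -> _]eq_fun do rewrite addr0.
have cpsi c (psi : R -> R) : continuous psi -> continuous (fun t : R => psi (c * t)).
  move=> cp; have := continuous_compR (@continuous_affine R c 0) cp.
  by under [X in continuous X -> _]eq_fun do rewrite addr0.
(* The reflection requires r / s > 0. For r = 0 the mean splits into a product, and a negative a is
   absorbed by the symmetry t |-> - t. *)
have [rE|rn0] := eqVneq r 0.
  have sE : s = `|a| by rewrite /s rE expr0n addr0 sqrtr_sqr.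
  pose c := gint (fun w => q.[w]).
  have lhs (psi : R -> R) :
      gmean (fun t => t ^+ i * gint (fun w => psi (a * t + r * w) * q.[w])) =
      gmean (fun t => psi (a * t) * (c * t ^+ i)).
    congr gmean; apply/funext => t; rewrite rE.
    under eq_fun do rewrite mul0r addr0.
    by rewrite gintZ; [rewrite /c; ring|exact: mpg_horner].
  have mF (psi : R -> R) : mpg psi -> mpg (fun t => psi (a * t) * (c * t ^+ i)).
    move=> mp; apply: mpgM; first exact: mpsi.
    by apply: mpgM; [exact: mpg_cst|exact: mpgX].
  have sz (x : R) : (size (x *: 'X^i : {poly R}) <= (i + k).+1)%N.
    by rewrite (leq_trans (size_scale_leq _ _))// size_polyXn ltnS leq_addr.
  have c1 : (forall w, q.[w] = 1) -> c = 1.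
    by move=> q1; rewrite /c; under eq_fun do rewrite q1; rewrite gint_cst.
  have [a0|a0] := leP 0 a.
    exists (c *: 'X^i); split=> //.
      by move=> -> /c1 -> w; rewrite hornerZ expr0 hornerC mulr1.
    move=> psi cp mp; rewrite lhs gmeanE; last exact: mF.
    rewrite sE ger0_norm//; congr gint.
    by apply/funext => t; rewrite hornerZ hornerXn.
  exists ((c * (-1) ^+ i) *: 'X^i); split=> //.
    by move=> -> /c1 -> w; rewrite hornerZ expr0 hornerC !mulr1.
  move=> psi cp mp; rewrite lhs gmeanE; last exact: mF.
  rewrite sE ltr0_norm// -gint_sym; first last; [|exact: mF|].
    apply: continuous_mulR; first exact: cpsi.
    apply: continuous_mulR; first by move=> x; exact: cvg_cst.
    exact: exprn_continuous.
  congr gint; apply/funext => t.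
  by rewrite hornerZ hornerXn mulrN mulNr (exprNn t) -[in RHS]mulrA.
have {}r0 : 0 < r by rewrite lt_neqAle eq_sym rn0.
have s20 : 0 < a ^+ 2 + r ^+ 2 by rewrite ltr_wpDl ?sqr_ge0// exprn_gt0.
have s0 : 0 < s by rewrite sqrtr_gt0.
have ss : s ^+ 2 = a ^+ 2 + r ^+ 2 by rewrite sqr_sqrtr// ltW.
pose c := a / s; pose b := r / s.
have cb : c ^+ 2 + b ^+ 2 = 1.
  by rewrite /c /b !expr_div_n -mulrDl ss divff// gt_eqF.
have b0 : 0 < b by rewrite divr_gt0.
have [Q [sQ hQ]] := gmean_poly2 c b b (- c) i q.
have e u v : a * (c * u + b * v) + r * (b * u - c * v) = s * u.
  have -> : a * (c * u + b * v) + r * (b * u - c * v) = (a ^+ 2 + r ^+ 2) / s * u.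
    by rewrite /c /b; field; rewrite gt_eqF.
  by rewrite -ss expr2 mulfK// gt_eqF.
exists Q; split.
- by rewrite (leq_trans sQ)// -addnS leq_add2l.
- move=> i0 q1 w; rewrite -hQ i0.
  by under eq_fun do rewrite expr0 q1 mulr1; rewrite gmean_cst.
move=> psi cp mp.
pose G (t w : R) : R := t ^+ i * (psi (a * t + r * w) * q.[w]).
have mG : mpg2 G.
  apply: mpg2M; first exact/mpg2_fst/mpgX.
  by apply: mpg2M; [exact: mpg2_lin|exact/mpg2_snd/mpg_horner].
have -> : (fun t => t ^+ i * gint (fun w => psi (a * t + r * w) * q.[w])) =
    fun t => gint (G t).
  apply/funext => t; rewrite gintZ//; apply: mpgM; last exact: mpg_horner.
  by have := mpg_comp r (a * t) mp; under eq_fun do rewrite addrC.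
have -> : gmean (fun t => gint (G t)) = gint2 G by rewrite gmeanE//; exact: mpg_gint.
rewrite (gint2_reflect cb b0 mG).
- congr gint; apply/funext => u; rewrite -hQ /reflect2 /G.
  rewrite gmeanE; last first.
    apply: mpgM; last first.
      have := mpg_comp (- c) (b * u) (mpg_horner q).
      by under eq_fun do rewrite addrC.
    have := mpg_comp b (c * u) (mpgX R i).
    by under eq_fun do rewrite addrC.
  rewrite -gintZ; last first.
    apply: mpgM; last first.
      have := mpg_comp (- c) (b * u) (mpg_horner q).
      by under eq_fun do rewrite addrC.
    have := mpg_comp b (c * u) (mpgX R i).
    by under eq_fun do rewrite addrC.
  by congr gint; apply/funext => v; rewrite e mulrCA mulNr.
- move=> t; rewrite /G; apply: continuous_mulR; first by move=> x; exact: cvg_cst.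
  apply: continuous_mulR; last exact: continuous_horner.
  under eq_fun do rewrite addrC.
  exact: (continuous_compR (@continuous_affine R r (a * t)) cp).
- move=> u; rewrite /reflect2 /G.
  under eq_fun do rewrite e.
  apply: continuous_mulR.
    under eq_fun do rewrite addrC.
    exact: (continuous_compR (@continuous_affine R b (c * u)) (@exprn_continuous _ i)).
  apply: continuous_mulR; first by move=> x; exact: cvg_cst.
  under eq_fun do rewrite -mulNr addrC.
  apply: (@continuous_compR _ (fun v : R => - c * v + b * u) (fun t : R => q.[t])).
    exact: continuous_affine.
  exact: continuous_horner.
Qed.

(** Rotation invariance in the form used below, by integrating out one coordinate at a time. [Q] is
    chosen before [psi] because the induction applies it to translates of [psi] that depend on the
    outer variable. *)
Lemma gmeann_line n (y : nat -> R) (al : nat -> nat) : exists Q : {poly R},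
  [/\ (size Q <= (\sum_(i < n) al i).+1)%N,
    ((forall i, (i < n)%N -> al i = 0%N) -> forall w, Q.[w] = 1) &
    forall psi : R -> R, continuous psi -> mpg psi ->
      gmeann n (fun g => psi (\sum_(i < n) y i * g i) * \prod_(i < n) g i ^+ al i) =
      gint (fun w => psi (Num.sqrt (\sum_(i < n) y i ^+ 2) * w) * Q.[w])].
Proof.
elim: n y al => [|n ih] y al.
  exists 1; split=> [|_ w|psi _ mp].
  - by rewrite size_poly1.
  - by rewrite hornerC.
  - rewrite /= !big_ord0 sqrtr0.
    under [in RHS]eq_fun do rewrite mul0r hornerC mulr1.
    by rewrite gint_cst mulr1.
have [Q' [sQ' Q'1 hQ']] := ih (fun i => y i.+1) (fun i => al i.+1).
pose r2 := \sum_(i < n) y i.+1 ^+ 2.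
have r20 : 0 <= r2 by apply: sumr_ge0 => i _; exact: sqr_ge0.
have [Q [sQ Q1 hQ]] := gmean_gint_line (y 0%N) (al 0%N) (sqrtr_ge0 r2) sQ'.
exists Q; split.
- by rewrite big_ord_recl.
- by move=> al0; apply: Q1; [exact: al0|apply: Q'1 => i ni; exact: al0].
move=> psi cp mp; rewrite big_ord_recl /= -/r2.
rewrite sqr_sqrtr// in hQ; rewrite -hQ//; congr gmean; apply/funext => t.
have := hQ' (fun x => psi (x + y 0%N * t)).
rewrite -/r2 => h.
have -> : (fun w => psi (y 0%N * t + Num.sqrt r2 * w) * Q'.[w]) =
  (fun w => psi (Num.sqrt r2 * w + y 0%N * t) * Q'.[w]).
  by apply/funext => w; rewrite addrC.
rewrite -h; last 2 first.
- have := continuous_compR (@continuous_affine R 1 (y 0%N * t)) cp.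
  by under [X in continuous X -> _]eq_fun do rewrite mul1r.
- have := mpg_comp 1 (y 0%N * t) mp.
  by under [X in mpg X -> _]eq_fun do rewrite mul1r.
rewrite -gmeannZ; congr gmeann; apply/funext => g.
by rewrite !big_ord_recl /= [y 0%N * t + _]addrC mulrCA.
Qed.

End gaussian_mean_n.

(** * Hermite polynomials and the reproducing formula *)

Section hermite_theory.
Variable R : realType.

(** The value 0 beyond d / 2 lets Hermite polynomials of different degrees share one range of
    summation. *)
Definition hcoef (d m : nat) : R :=
  if (m.*2 <= d)%N then d`!%:R * ((-1) ^+ m / (2 ^+ m * m`!%:R * (d - m.*2)`!%:R))
  else 0.

Lemma hermiteE N d (u : R) : (d./2 < N)%N ->
  hermite d u = \sum_(m < N) hcoef d m * u ^+ (d - m.*2).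
Proof.
move=> dN; rewrite /hermite big_mkord mulr_sumr.
rewrite (big_ord_widen_cond _ predT (fun m => d`!%:R * ((-1) ^+ m * u ^+ (d - 2 * m) /
  (2 ^+ m * m`!%:R * (d - 2 * m)`!%:R))) dN) big_mkcond /=.
apply: eq_bigr => m _; rewrite /hcoef ltnS geq_half_double.
case: ifP => _; last by rewrite mul0r.
by rewrite mul2n -!mulrA; congr (_ * (_ * _)); rewrite mulrC.
Qed.

Lemma hcoef0 d : hcoef d 0 = 1.
Proof.
by rewrite /hcoef /= subn0 fact0 !expr0 !mul1r divff// pnatr_eq0 -lt0n fact_gt0.
Qed.

Lemma hcoefS d m : hcoef d.+2 m.+1 = hcoef d.+1 m.+1 - d.+1%:R * hcoef d m.
Proof.
rewrite /hcoef doubleS.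
have f0 k : k`!%:R != 0 :> R by rewrite pnatr_eq0 -lt0n fact_gt0.
have n0 k : k.+1%:R != 0 :> R by rewrite pnatr_eq0.
have e0 k : (2 : R) ^+ k != 0 by rewrite expf_neq0// pnatr_eq0.
rewrite !ltnS.
case: (ltngtP m.*2 d) => [md|md|md]; last 2 first.
- by rewrite mulr0 subr0.
- rewrite -md !subSS !subnn fact0 !factS !natrM sub0r exprS exprS.
  have -> : m.*2.+2%:R = 2 * m.+1%:R :> R by rewrite -natrM mul2n.
  have h1 := f0 m; have h2 := n0 m; have h3 := e0 m; have h4 := f0 m.*2.
  move: h1 h2 h3 h4; move: (m`!%:R) (m.+1%:R) (2 ^+ m) (m.*2`!%:R) => x y z w.
  by move=> h1 h2 h3 h4; move: ((-1) ^+ m) => t; field; rewrite h1 h2 h3.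
- have [r dE] : exists r, d = (m.*2 + r.+1)%N.
    by exists (d - m.*2.+1)%N; rewrite -addSnnS subnKC.
  rewrite dE !subSS addKn addnS subSS addKn !factS !natrM exprS exprS.
  have -> : (m.*2 + r).+3%:R = r.+1%:R + 2 * m.+1%:R :> R.
    by rewrite -natrM -natrD mul2n doubleS; congr (_%:R); rewrite addnC !addnS addSn.
  have h1 := f0 m; have h2 := n0 m; have h3 := e0 m; have h4 := f0 r; have h5 := n0 r.
  move: h1 h2 h3 h4 h5; move: (m`!%:R) (m.+1%:R) (2 ^+ m) (r`!%:R) (r.+1%:R).
  move: ((m.*2 + r)`!%:R) ((m.*2 + r).+1%:R) ((m.*2 + r).+2%:R) ((-1) ^+ m).
  move=> x1 x2 x3 x4 x5 x6 x7 x8 x9 h1 h2 h3 h4 h5; field.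
  by rewrite h1 h2 h3 h4 h5.
Qed.

Lemma hermite0 (u : R) : hermite 0 u = 1.
Proof. by rewrite (@hermiteE 1)// big_ord1 hcoef0 mul1r. Qed.

Lemma hermite1 (u : R) : hermite 1 u = u.
Proof. by rewrite (@hermiteE 1)// big_ord1 hcoef0 mul1r. Qed.

Lemma hermiteS d (u : R) :
  hermite d.+2 u = u * hermite d.+1 u - d.+1%:R * hermite d u.
Proof.
pose N := d.+2; have leq_half k : (k./2 <= k)%N by rewrite -divn2 leq_div.
have dN k : (k <= d.+2)%N -> (k./2 < N.+1)%N.
  by move=> kd; rewrite ltnS (leq_trans _ kd)// leq_half.
rewrite (@hermiteE N.+1 d.+2) ?dN// (@hermiteE N.+1 d.+1) ?dN// (@hermiteE N d); last first.
  by rewrite /N ltnS (leq_trans (leq_half _)).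
rewrite big_ord_recl [in X in u * X]big_ord_recl /= !hcoef0 !mul1r !subn0.
rewrite mulrDr -exprS -addrA; congr (_ + _).
rewrite !mulr_sumr -sumrB; apply: eq_bigr => m _.
rewrite /bump /= add1n hcoefS mulrBl doubleS !subSS; congr (_ - _); last by rewrite mulrA.
rewrite /hcoef doubleS ltnS; case: ifP => [md|_]; last by rewrite !mul0r mulr0.
rewrite [RHS]mulrCA; congr (_ * _).
by rewrite -exprS -(subSn md).
Qed.

End hermite_theory.

(** * Gaussian means of polynomials, by Stein's identity *)

Section gaussian_polynomials.
Variables (R : realType) (n : nat).
Notation mp := (mpoly n R).
Notation mX i := (@mpolyX n R (mnm1 i)).

Definition pmean (p : mp) : R :=
  gmeann n (fun g => meval (fun i : 'I_n => g i) p).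

Lemma pmeanD p q : pmean (p + q) = pmean p + pmean q.
Proof. by rewrite -gmeannD; congr gmeann; apply/funext => g; rewrite mevalD. Qed.

Lemma pmeanZ a p : pmean (a *: p) = a * pmean p.
Proof. by rewrite -gmeannZ; congr gmeann; apply/funext => g; rewrite mevalZ. Qed.

Lemma pmean_sum (I : Type) (r : seq I) (P : pred I) (F : I -> mp) :
  pmean (\sum_(i <- r | P i) F i) = \sum_(i <- r | P i) pmean (F i).
Proof.
rewrite -gmeann_sum; congr gmeann; apply/funext => g.
by rewrite (raddf_sum (meval _)).
Qed.

Lemma pmean1 : pmean 1 = 1.
Proof.
by rewrite -[RHS](gmeann_cst n); congr gmeann; apply/funext => g; rewrite meval1.
Qed.

Lemma pmeanB p q : pmean (p - q) = pmean p - pmean q.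
Proof. by rewrite -gmeannB; congr gmeann; apply/funext => g; rewrite mevalB. Qed.

Definition moment k : R := gmean (fun t => t ^+ k).

Lemma momentS k : moment k.+1 = k%:R * moment k.-1.
Proof. by rewrite /moment !gmeanE ?gint_stein//; exact: mpgX. Qed.

Lemma pmeanX m : pmean (mpolyX R m) = \prod_(i < n) moment (m i).
Proof.
have := @gmeann_prod R n (fun i t => t ^+ nth 0%N (val m) i).
rewrite /pmean => h; rewrite -[RHS](_ : \prod_(i < n) gmean (fun t => t ^+ nth 0%N m i) = _).
  by rewrite -h; congr gmeann; apply/funext => g; rewrite mevalX;
    apply: eq_bigr => i _; rewrite (mnm_nth 0%N).
by apply: eq_bigr => i _; rewrite (mnm_nth 0%N).
Qed.

(** By linearity this concerns monomials, whose means are products of moments; the i-th factor is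
    then the moment recurrence [momentS]. *)
Lemma pmean_stein i p : pmean (mX i * p) = pmean (mderiv i p).
Proof.
rewrite (mpolyE p) mulr_sumr (raddf_sum (mderiv i)) !pmean_sum.
apply: eq_bigr => m _; rewrite /= mderivZ -scalerAr !pmeanZ; congr (_ * _).
rewrite -mpolyXD mderivX pmeanZ !pmeanX.
rewrite (bigD1 i)//= [in RHS](bigD1 i)//= mulrA mnmDE mnm1E eqxx add1n momentS.
rewrite mnmBE mnm1E eqxx subn1; congr (_ * _).
apply: eq_bigr => j ji; rewrite mnmDE mnmBE mnm1E eq_sym (negbTE ji).
by rewrite add0n subn0.
Qed.

Definition linp (x : nat -> R) : mp := \sum_(i < n) x i *: mX i.

Lemma mderiv_linp x i : mderiv i (linp x) = (x i)%:A.
Proof.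
rewrite (raddf_sum (mderiv i)) (bigD1 i)//= big1 => [|j ji]; last first.
  by rewrite mderivZ mderivX mnm1E (negbTE ji) scale0r scaler0.
rewrite addr0 mderivZ mderivX mnm1E eqxx scale1r; congr (_ *: _).
by rewrite -mpolyX0; congr mpolyX; apply/mnmP => j; rewrite mnmBE subnn mnm0E.
Qed.

(** He_k and He_(k+1) of the linear form <x, .>, as formal polynomials so that they can be
    differentiated; the pair carries the three-term recurrence. *)
Fixpoint hermp2 (x : nat -> R) (k : nat) : mp * mp :=
  if k is j.+1 then
    let: (a, b) := hermp2 x j in (b, linp x * b - j.+1%:R *: a)
  else (1, linp x).

Definition hermp x k := (hermp2 x k).1.

Lemma hermpS x k : hermp x k.+2 = linp x * hermp x k.+1 - k.+1%:R *: hermp x k.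
Proof. by rewrite /hermp /=; case: (hermp2 x k). Qed.

Lemma meval_hermp x k (g : nat -> R) :
  meval (fun i : 'I_n => g i) (hermp x k) = hermite k (\sum_(i < n) x i * g i).
Proof.
have e : meval (fun i : 'I_n => g i) (linp x) = \sum_(i < n) x i * g i.
  rewrite (raddf_sum (meval _)); apply: eq_bigr => i _.
  by rewrite /= mevalZ mevalXU.
have [] : meval (fun i : 'I_n => g i) (hermp x k) = hermite k (\sum_(i < n) x i * g i) /\
  meval (fun i : 'I_n => g i) (hermp x k.+1) = hermite k.+1 (\sum_(i < n) x i * g i).
  elim: k => [|k [ih1 ih2]]; first by rewrite /hermp /= meval1 e hermite0 hermite1.
  split=> //; rewrite hermpS hermiteS mevalB mevalM mevalZ e ih1 ih2.
  by [].
by [].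
Qed.

Lemma mderiv_hermp x k i :
  mderiv i (hermp x k.+1) = (k.+1%:R * x i) *: hermp x k.
Proof.
have [] : mderiv i (hermp x k.+1) = (k.+1%:R * x i) *: hermp x k /\
  mderiv i (hermp x k.+2) = (k.+2%:R * x i) *: hermp x k.+1; last by [].
have d1 : mderiv i (1 : mp) = 0 by rewrite -mpolyC1 mderivC.
have h0 : hermp x 0 = 1 by [].
elim: k => [|k [ih1 ih2]].
  have h1 : mderiv i (hermp x 1) = (1%:R * x i) *: hermp x 0.
    by rewrite /hermp /= mderiv_linp mul1r.
  split=> //; rewrite hermpS mderivB mderivM mderivZ h0 d1 scaler0 subr0.
  rewrite [hermp x 1]/(linp x) mderiv_linp mulr_algl.
  by rewrite -scalerAr mulr1 -scalerDl -mulr2n mulr_natl.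
split=> //; rewrite hermpS mderivB mderivM mderivZ mderiv_linp ih1 ih2.
have e : k.+3%:R * x i = k.+2%:R * x i + x i by rewrite mulrSr mulrDl mul1r.
rewrite mulr_algl e scalerDl addrC addrCA [RHS]addrC; congr (_ + _).
rewrite [in RHS]hermpS scalerBr addrC -scalerAr; congr (_ - _).
by rewrite !scalerA -mulrA; congr (_ *: _); congr (_ * _); exact: mulrC.
Qed.

Lemma pmean_linp_hermp (x : nat -> R) k : \sum_(i < n) x i ^+ 2 = 1 ->
  pmean (linp x * hermp x k.+1) = k.+1%:R * pmean (hermp x k).
Proof.
move=> x1; rewrite mulr_suml pmean_sum -[RHS]mulr1 -[X in _ * X]x1 mulr_sumr.
apply: eq_bigr => i _; rewrite -scalerAl pmeanZ pmean_stein mderiv_hermp pmeanZ.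
by rewrite expr2; ring.
Qed.

Lemma pmean_hermp (x : nat -> R) k : \sum_(i < n) x i ^+ 2 = 1 ->
  pmean (hermp x k) = (k == 0%N)%:R.
Proof.
move=> x1; case: k => [|[|k]]; first exact: pmean1.
  rewrite [hermp x 1]/(linp x) pmean_sum big1// => i _.
  rewrite pmeanZ -[mX i]mulr1 pmean_stein -mpolyC1 mderivC.
  by rewrite -(scale0r 0) pmeanZ mul0r mulr0.
by rewrite hermpS pmeanB pmeanZ pmean_linp_hermp// subrr.
Qed.

(* Integrating by parts [k] times leaves only the monomials of degree [k]. *)
Lemma pmean_X_hermp (x : nat -> R) k m : \sum_(i < n) x i ^+ 2 = 1 -> (mdeg m <= k)%N ->
  pmean (mpolyX R m * hermp x k) =
  if mdeg m == k then k`!%:R * \prod_(i < n) x i ^+ m i else 0.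
Proof.
move=> x1; have [j] := ubnP (mdeg m); elim: j k m => // j ih k m mj mk.
have [m0|m0] := eqVneq (mdeg m) 0%N.
  have -> : m = mnm0 by apply/eqP; rewrite -mdeg_eq0 m0.
  rewrite mpolyX0 mul1r pmean_hermp// mdeg0; case: k {mk} => [|k] //=.
  by rewrite fact0 mul1r big1// => i _; rewrite mnm0E.
have [i mi] : exists i, m i != 0%N.
  apply/existsP; apply: contraNT m0; rewrite negb_exists => /forallP h.
  by rewrite mdegE big1// => i _; apply/eqP; have := h i; rewrite negbK.
pose m' : multinom n := mnm_sub m (mnm1 i).
have mE : m = mnm_add (mnm1 i) m'.
  by apply/mnmP => l; rewrite mnmDE mnmBE mnm1E; case: eqP => [<-|_];
    rewrite ?subnKC ?lt0n// add0n subn0.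
have dm : mdeg m = (mdeg m').+1 by rewrite mE mdegD mdeg1.
case: k => [|k] in mk *; first by rewrite dm in mk.
rewrite dm ltnS in mk; rewrite dm ltnS in mj.
rewrite {1}mE mpolyXD -mulrA pmean_stein mderivM pmeanD.
rewrite mderivX -scalerAl pmeanZ mderiv_hermp -scalerAr pmeanZ.
rewrite (ih k m') // dm eqSS.
(* The derivative that falls on the monomial lowers its degree but not the Hermite index, so the
   mean vanishes by induction. The truncated exponent at [m' i = 0] has coefficient 0. *)
have -> : (m' i)%:R * pmean (mpolyX R (mnm_sub m' (mnm1 i)) * hermp x k.+1) = 0.
  have [->|mi'] := eqVneq (m' i) 0%N; first by rewrite mul0r.
  have lt : (mdeg (mnm_sub m' (mnm1 i)) < mdeg m')%N.
    have e : m' = mnm_add (mnm1 i) (mnm_sub m' (mnm1 i)).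
      apply/mnmP => l; rewrite mnmDE [in RHS]mnmBE mnm1E; case: eqP => [<-|_];
        by rewrite ?subnKC ?lt0n// add0n subn0.
    by rewrite {2}e mdegD mdeg1.
  rewrite ih ?(ltn_trans lt mj) ?(leqW (leq_trans (ltnW lt) mk))//.
  by rewrite (ltn_eqF (leqW (leq_trans lt mk))) mulr0.
rewrite add0r; case: eqP => _; last by rewrite mulr0.
rewrite factS natrM -!mulrA; congr (_ * _); rewrite mulrCA; congr (_ * _).
rewrite (bigD1 i)//= [in RHS](bigD1 i)//= mulrA -exprS.
have -> : m i = (m' i).+1 by rewrite mE mnmDE mnm1E eqxx.
congr (_ * _); apply: eq_bigr => l li.
by rewrite [in RHS]mE mnmDE mnm1E eq_sym (negbTE li).
Qed.

Definition normp : mp := \sum_(i < n) mX i * mX i.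

Lemma meval_normp (v : 'I_n -> R) : meval v normp = \sum_(i < n) v i ^+ 2.
Proof.
rewrite (raddf_sum (meval _)); apply: eq_bigr => i _.
by rewrite /= mevalM mevalXU expr2.
Qed.

Lemma euler_normp k :
  \sum_(i < n) mX i * mderiv i (normp ^+ k) = (k.*2)%:R *: normp ^+ k.
Proof.
have d1 i : mderiv i (1 : mp) = 0 by rewrite -mpolyC1 mderivC.
have dX i j : mderiv i (mX j) = (i == j)%:R.
  rewrite mderivX mnm1E eq_sym; case: eqP => [->|_]; last by rewrite scale0r.
  rewrite scale1r -mpolyX0; congr mpolyX; apply/mnmP => l.
  by rewrite mnmBE subnn mnm0E.
have dn i : mderiv i normp = 2%:R *: mX i.
  rewrite (raddf_sum (mderiv i)) (bigD1 i)//= big1 => [|j ji].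
    by rewrite addr0 mderivM dX eqxx mul1r mulr1 -mulr2n scaler_nat.
  by rewrite mderivM dX eq_sym (negbTE ji) mul0r mulr0 addr0.
elim: k => [|k ih].
  by rewrite scale0r big1// => i _; rewrite expr0 d1 mulr0.
have -> : \sum_(i < n) mX i * mderiv i (normp ^+ k.+1) =
  \sum_(i < n) (2%:R *: (mX i * mX i * normp ^+ k) + normp * (mX i * mderiv i (normp ^+ k))).
  apply: eq_bigr => i _; rewrite exprS mderivM dn mulrDr; congr (_ + _).
    by rewrite -scalerAl -scalerAr mulrA.
  by rewrite mulrCA.
rewrite big_split /= -scaler_sumr -mulr_suml -mulr_sumr ih -exprS.
by rewrite -scalerAr -exprS -scalerDl doubleS -natrD.
Qed.

(** The even moments of |g|. Stein's identity, with Euler's identity for the homogeneous polynomial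
    |g|^(2k), gives E|g|^(2k+2) = (n + 2k) E|g|^(2k). *)
Lemma pmean_normpX k : pmean (normp ^+ k) = \prod_(j < k) (n + j.*2)%:R.
Proof.
elim: k => [|k ih]; first by rewrite expr0 pmean1 big_ord0.
rewrite big_ord_recr /= -ih exprS mulr_suml.
under eq_bigr do rewrite -mulrA.
rewrite pmean_sum.
under eq_bigr do rewrite pmean_stein mderivM.
rewrite -pmean_sum big_split /= euler_normp.
have -> : \sum_(i < n) mderiv i (mX i) * normp ^+ k = n%:R *: normp ^+ k.
  rewrite -mulr_suml (eq_bigr (fun=> 1)) => [|i _].
    by rewrite sumr_const card_ord scaler_nat mulr_natl.
  rewrite mderivX mnm1E eqxx scale1r -mpolyX0; congr mpolyX; apply/mnmP => l.
  by rewrite mnmBE subnn mnm0E.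
by rewrite -scalerDl -natrD pmeanZ mulrC.
Qed.

End gaussian_polynomials.

(** * Functions of one linear form, the reproducing formula, and concentration of the norm *)

Section gaussian_vectors.
Variable R : realType.
Implicit Types (x y g : nat -> R) (psi F : R -> R) (n d k m : nat).

Definition dot n x g : R := \sum_(i < n) x i * g i.

Definition nrm2 n g : R := \sum_(i < n) g i ^+ 2.

Lemma nrm2_ge0 n g : 0 <= nrm2 n g.
Proof. by apply: sumr_ge0 => i _; exact: sqr_ge0. Qed.

Lemma growth_dot n x : growth n (dot n x).
Proof.
by apply: growth_sum => i _; apply: growthM; [exact: growth_cst|exact: growth_coord].
Qed.

Lemma growth_nrm2 n : growth n (nrm2 n).
Proof. by apply: growth_sum => i _; apply: growthX; exact: growth_coord. Qed.

Lemma growth_comp n F G : pgrowth F -> growth n G -> growth n (fun g => F (G g)).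
Proof.
move=> [m [C C0 hC]] gG.
apply: (@growth_le _ _ _ (fun g => C * (1 + G g ^+ 2) ^+ m)) => [|g].
  apply: growthM; first exact: growth_cst.
  by apply: growthX; apply: growthD; [exact: growth_cst|exact: growthX].
by rewrite (le_trans (hC _))// ler_norm.
Qed.

Lemma growth_sqrt_nrm2 n : growth n (fun g => Num.sqrt (nrm2 n g)).
Proof.
apply: (@growth_le _ _ _ (fun g => 1 + nrm2 n g)) => [|g].
  by apply: growthD; [exact: growth_cst|exact: growth_nrm2].
have h0 := nrm2_ge0 n g; have s0 := sqrtr_ge0 (nrm2 n g).
rewrite !ger0_norm ?addr_ge0//.
have := sqr_sqrtr h0; have := sqr_ge0 (Num.sqrt (nrm2 n g) - 1); nra.
Qed.

(** This is [gmeann_line] with all exponents 0, where its middle clause gives Q = 1. *)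
Lemma gmeann_dot n x psi : continuous psi -> mpg psi -> nrm2 n x = 1 ->
  gmeann n (fun g => psi (dot n x g)) = gint psi.
Proof.
move=> cp mp x1; have [Q [_ Q1 hQ]] := gmeann_line n x (fun=> 0%N).
have := hQ _ cp mp; rewrite -/(nrm2 n x) x1 sqrtr1.
under [in X in _ = X -> _]eq_fun do rewrite Q1// mul1r mulr1.
by move=> <-; congr gmeann; apply/funext => g; rewrite [\prod_(_ < _) _]big1 ?mulr1.
Qed.

(* Given [dot n y], the mean of a polynomial of degree [d] is a polynomial of
   degree at most [d] in [dot n y]. *)
Lemma gmeann_orthogonal n d y psi (p : mpoly n R) : continuous psi -> mpg psi ->
  p \is ishomog1 d mdeg ->
  (forall k, (k <= d)%N -> gint (fun t => psi t * t ^+ k) = 0) -> nrm2 n y = 1 ->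
  gmeann n (fun g => psi (dot n y g) * meval (fun i : 'I_n => g i) p) = 0.
Proof.
move=> cp mp /dhomogP hp ortho y1.
under eq_fun do rewrite mevalE mulr_sumr.
rewrite gmeann_sum big_seq big1// => m /hp /= md.
have -> : (fun g => psi (dot n y g) * (mcoeff m p * \prod_(i < n) g i ^+ m i)) =
  fun g => mcoeff m p * (psi (dot n y g) * \prod_(i < n) g i ^+ nth 0%N (val m) i).
  apply/funext => g; rewrite mulrCA; congr (_ * (_ * _)).
  by apply: eq_bigr => i _; rewrite (mnm_nth 0%N).
rewrite gmeannZ; have [Q [sQ _ hQ]] := gmeann_line n y (nth 0%N (val m)).
rewrite hQ// -/(nrm2 n y) y1 sqrtr1.
have {}sQ : (size Q <= d.+1)%N.
  rewrite (leq_trans sQ)// ltnS -md mdegE leq_eqVlt; apply/orP; left; apply/eqP.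
  by apply: eq_bigr => i _; rewrite (mnm_nth 0%N).
have -> : (fun w => psi (1 * w) * Q.[w]) =
  fun w => \sum_(k < size Q) Q`_k * (psi w * w ^+ k).
  apply/funext => w; rewrite mul1r horner_coef mulr_sumr.
  by apply: eq_bigr => k _; rewrite mulrCA.
have mk (k : nat) : mpg (fun w => psi w * w ^+ k) by apply: mpgM => //; exact: mpgX.
rewrite -gmeanE; last first.
  by apply: mpg_sum => k; apply: mpgM; [exact: mpg_cst|exact: mk].
rewrite gmean_sum big1 ?mulr0// => k _.
by rewrite gmeanZ gmeanE// ortho ?mulr0// -ltnS (leq_trans (ltn_ord k)).
Qed.

Lemma continuous_hermite d : continuous (@hermite R d).
Proof.
have -> : @hermite R d = fun u => (\sum_(m < d./2.+1) hcoef R d m *: 'X^(d - m.*2)).[u].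
  apply/funext => u; rewrite (@hermiteE _ d./2.+1)// horner_sum.
  by apply: eq_bigr => m _; rewrite hornerZ hornerXn.
exact: continuous_horner.
Qed.

Lemma mpg_hermite d : mpg (@hermite R d).
Proof.
have -> : @hermite R d = fun u => \sum_(m < d./2.+1) hcoef R d m * u ^+ (d - m.*2).
  by apply/funext => u; rewrite (@hermiteE _ d./2.+1).
by apply: mpg_sum => m; apply: mpgM; [exact: mpg_cst|exact: mpgX].
Qed.

Lemma gmeann_reproducing n d x (p : mpoly n R) : p \is ishomog1 d mdeg ->
  nrm2 n x = 1 ->
  gmeann n (fun g => meval (fun i : 'I_n => g i) p * hermite d (dot n x g)) =
  d`!%:R * meval (fun i : 'I_n => x i) p.
Proof.
move=> /dhomogP hp x1.
have -> : gmeann n (fun g => meval (fun i : 'I_n => g i) p * hermite d (dot n x g)) =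
    pmean (p * hermp n x d).
  by congr gmeann; apply/funext => g; rewrite mevalM meval_hermp.
rewrite {1}(mpolyE p) mulr_suml pmean_sum mevalE mulr_sumr big_seq [RHS]big_seq.
apply: eq_bigr => m /hp /= md; rewrite -scalerAl pmeanZ pmean_X_hermp ?md//.
by rewrite eqxx mulrCA.
Qed.

(** The moment E|g|^(2k), equivalent to n^k. *)
Definition rho n k : R := \prod_(j < k) (n + j.*2)%:R.

Lemma gmeann_nrm2X n k : gmeann n (fun g => nrm2 n g ^+ k) = rho n k.
Proof.
rewrite /rho -pmean_normpX; congr gmeann; apply/funext => g.
by rewrite rmorphXn /= meval_normp.
Qed.

(** The mean of (|g|^(2k) / n^k - 1)^2, expanded; its convergence to 0 is the concentration of |g|^2
    / n at 1. *)
Definition fluct n k : R := rho n (k + k) / n%:R ^+ (k + k) - 2 * (rho n k / n%:R ^+ k) + 1.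

Let ratio n k g : R := nrm2 n g ^+ k / n%:R ^+ k.

Let growth_ratio n k : growth n (ratio n k).
Proof. by apply: growthM; [apply: growthX; exact: growth_nrm2|exact: growth_cst]. Qed.

Lemma gmeann_fluct n k : gmeann n (fun g => (ratio n k g - 1) ^+ 2) = fluct n k.
Proof.
have -> : (fun g => (ratio n k g - 1) ^+ 2) =
  fun g => nrm2 n g ^+ (k + k) * (n%:R ^+ (k + k))^-1 +
    (- 2 * (n%:R ^+ k)^-1) * nrm2 n g ^+ k + 1.
  apply/funext => g; rewrite /ratio !exprD invfM.
  move: (_ ^+ k) (_ ^+ k)^-1 => a b; ring.
rewrite gmeannD gmeannD gmeannZr gmeannZ !gmeann_nrm2X gmeann_cst /fluct.
by rewrite !mulNr -[2 / _ * _]mulrA [_^-1 * _]mulrC.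
Qed.

(** The inequality 2ab <= tau a^2 + b^2 / tau replaces Cauchy-Schwarz. A small [tau] makes the first
    term negligible, and then a large n the second. *)
Lemma gmeann_concentration n k x F (tau : R) : 0 < tau ->
  continuous F -> mpg F -> nrm2 n x = 1 ->
  gmeann n (fun g => `|ratio n k g - 1| * `|F (dot n x g)|) <=
  (tau * gint (fun t => F t ^+ 2) + fluct n k / tau) / 2.
Proof.
move=> tau0 cF mF x1.
have cF2 : continuous (fun t => F t ^+ 2).
  exact: (continuous_compR cF (@exprn_continuous R 2)).
have mF2 : mpg (fun t => F t ^+ 2).
  by under eq_fun do rewrite expr2; exact: mpgM.
have gF := growth_comp mF.2 (growth_dot n x).
have gr : growth n (fun g => ratio n k g - 1).
  by apply: growthB; [exact: growth_ratio|exact: growth_cst].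
rewrite -(gmeann_dot cF2 mF2 x1) -gmeann_fluct -gmeannZ -gmeannZr -gmeannD -gmeannZr.
apply: gmeann_le.
- by apply: growthM; exact: growth_norm.
- apply: growthM; last exact: growth_cst.
  apply: growthD; apply: growthM; by [exact: growth_cst|exact: growthX].
move=> g; rewrite -(real_normK (num_real (ratio n k g - 1))).
rewrite -(real_normK (num_real (F _))).
move: (normr_ge0 (F (dot n x g))) (normr_ge0 (ratio n k g - 1)).
move: `|_| `|_| => b a a0 b0.
rewrite -subr_ge0.
have -> : (tau * a ^+ 2 + b ^+ 2 / tau) / 2 - b * a = (tau * a - b) ^+ 2 / (2 * tau).
  by field; rewrite gt_eqF.
by rewrite divr_ge0 ?sqr_ge0// mulr_ge0// ltW.
Qed.

Lemma gmeann_upper n d x (tau : R) : (0 < n)%N -> 0 < tau -> nrm2 n x = 1 ->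
  gmeann n (fun g => Num.sqrt (nrm2 n g) ^+ d * `|hermite d (dot n x g)|) <=
  Num.sqrt n%:R ^+ d * (gint (fun t => `|hermite d t|) +
    (tau * gint (fun t => hermite d t ^+ 2) + fluct n d / tau) / 2).
Proof.
move=> n0 tau0 x1; have nr0 : 0 < n%:R :> R by rewrite ltr0n.
have cH := @continuous_hermite d; have mH := mpg_hermite d.
have cN : continuous (fun t : R => `|hermite d t|).
  by apply: (continuous_compR cH); exact: norm_continuous.
rewrite -(gmeann_dot cN (mpg_norm mH) x1).
apply: (le_trans (y := Num.sqrt n%:R ^+ d * (gmeann n (fun g => `|hermite d (dot n x g)|) +
  gmeann n (fun g => `|ratio n d g - 1| * `|hermite d (dot n x g)|)))); last first.
  by rewrite ler_wpM2l ?exprn_ge0 ?sqrtr_ge0// lerD2l gmeann_concentration.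
have gH := growth_norm (growth_comp mH.2 (growth_dot n x)).
have gr : growth n (fun g => `|ratio n d g - 1|).
  by apply: growth_norm; apply: growthB; [exact: growth_ratio|exact: growth_cst].
rewrite -gmeannD -gmeannZ; apply: gmeann_le.
- by apply: growthM => //; apply: growthX; exact: growth_sqrt_nrm2.
- apply: growthM; first exact: growth_cst.
  by apply: growthD => //; exact: growthM.
move=> g; rewrite -{2}[`|hermite _ _|]mul1r -mulrDl mulrA ler_wpM2r//.
have s0 : 0 < Num.sqrt n%:R :> R by rewrite sqrtr_gt0.
(* The claim becomes a <= 1 + |a^2 - 1| for a >= 0. Squaring brings in only the even moments of |g|,
   which are explicit. *)
pose a := (Num.sqrt (nrm2 n g) / Num.sqrt n%:R) ^+ d.
have a0 : 0 <= a by rewrite exprn_ge0// divr_ge0// ?sqrtr_ge0.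
have aE : ratio n d g = a ^+ 2.
  rewrite /ratio /a -exprM mulnC exprM expr_div_n !sqr_sqrtr ?nrm2_ge0// ?ltW//.
  by rewrite expr_div_n.
have -> : Num.sqrt (nrm2 n g) ^+ d = Num.sqrt n%:R ^+ d * a.
  by rewrite /a -exprMn mulrCA divff ?gt_eqF// mulr1.
have sd : 0 <= Num.sqrt n%:R ^+ d :> R by rewrite exprn_ge0// ltW.
rewrite ler_wpM2l// aE.
have -> : a ^+ 2 - 1 = (a - 1) * (a + 1) by ring.
rewrite normrM (ger0_norm (_ : 0 <= a + 1)) ?addr_ge0//.
have := ler_norm (a - 1); have := normr_ge0 (a - 1); nra.
Qed.

(** Replacing |g|^(2k) by n^k costs at most n^k times the mean of | |g|^(2k) / n^k - 1 | |<x, g>^l|,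
    because |psi| <= 1; concentration bounds it. *)
Lemma gmeann_trace_term n k l x psi (tau : R) : (0 < n)%N -> 0 < tau ->
  continuous psi -> mpg psi -> (forall t, `|psi t| <= 1) -> nrm2 n x = 1 ->
  `|gmeann n (fun g => nrm2 n g ^+ k * (dot n x g ^+ l * psi (dot n x g))) -
    n%:R ^+ k * gint (fun t => t ^+ l * psi t)| <=
  n%:R ^+ k * ((tau * gint (fun t => (t ^+ l) ^+ 2) + fluct n k / tau) / 2).
Proof.
move=> n0 tau0 cp mp p1 x1; have nr0 : 0 < n%:R ^+ k :> R by rewrite exprn_gt0 ?ltr0n.
have cX : continuous (fun t : R => t ^+ l) by exact: exprn_continuous.
have mXp : mpg (fun t => t ^+ l * psi t) by apply: mpgM => //; exact: mpgX.
have cXp : continuous (fun t : R => t ^+ l * psi t) by exact: continuous_mulR.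
rewrite -(gmeann_dot cXp mXp x1) -gmeannZ -gmeannB.
have gX := growthX l (growth_dot n x).
have gp := growth_comp mp.2 (growth_dot n x).
have gr : growth n (fun g => `|ratio n k g - 1|).
  by apply: growth_norm; apply: growthB; [exact: growth_ratio|exact: growth_cst].
apply: (le_trans (y := gmeann n (fun g => n%:R ^+ k *
    (`|ratio n k g - 1| * `|dot n x g ^+ l|)))); last first.
  rewrite gmeannZ ler_wpM2l ?(ltW nr0)//.
  exact: (@gmeann_concentration n k x (fun t => t ^+ l) tau tau0 cX (mpgX R l) x1).
apply: gmeann_norm_le.
- apply: growthB; apply: growthM => //; last exact: growthM.
  + by apply: growthX; exact: growth_nrm2.
  + exact: growthM.
  + exact: growth_cst.
- apply: growthM; first exact: growth_cst.
  by apply: growthM => //; exact: growth_norm.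
move=> g; rewrite -mulrBl !normrM [leRHS]mulrA ler_pM ?mulr_ge0//.
  rewrite -{2}(ger0_norm (ltW nr0)) -normrM mulrBr mulr1 /ratio.
  by rewrite mulrCA divff ?mulr1// gt_eqF.
by rewrite ler_piMr.
Qed.

(** The inequality a <= (a^2 + 1) / 2 with a = (|g| / sqrt n)^d passes to an even moment. It is
    asymptotically sharp since a concentrates at 1. *)
Lemma gmeann_normX_le n d : (0 < n)%N ->
  gmeann n (fun g => Num.sqrt (nrm2 n g) ^+ d) <=
  Num.sqrt n%:R ^+ d * ((rho n d / n%:R ^+ d + 1) / 2).
Proof.
move=> n0; have nr0 : 0 < n%:R :> R by rewrite ltr0n.
have s0 : 0 < Num.sqrt n%:R :> R by rewrite sqrtr_gt0.
rewrite -gmeann_nrm2X -gmeannZr -[X in (_ + X) / 2](gmeann_cst n) -gmeannD -gmeannZr -gmeannZ.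
apply: gmeann_le.
- by apply: growthX; exact: growth_sqrt_nrm2.
- apply: growthM; first exact: growth_cst.
  apply: growthM; last exact: growth_cst.
  by apply: growthD; [exact: growth_ratio|exact: growth_cst].
move=> g; pose a := (Num.sqrt (nrm2 n g) / Num.sqrt n%:R) ^+ d.
have aE : ratio n d g = a ^+ 2.
  rewrite /ratio /a -exprM mulnC exprM expr_div_n !sqr_sqrtr ?nrm2_ge0// ?ltW//.
  by rewrite expr_div_n.
have -> : Num.sqrt (nrm2 n g) ^+ d = Num.sqrt n%:R ^+ d * a.
  by rewrite /a -exprMn mulrCA divff ?gt_eqF// mulr1.
have sd : 0 <= Num.sqrt n%:R ^+ d :> R by rewrite exprn_ge0// ltW.
rewrite ler_wpM2l// -/(ratio n d g) aE.
have := sqr_ge0 (a - 1); nra.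
Qed.

End gaussian_vectors.

(** * Exchange of a bounded functional with a Gaussian mean *)

Section exchange.
Variables (R : realType) (T : Type).
Implicit Types (v : (nat -> R) -> T -> R) (g h : nat -> R) (n m k : nat).

Definition bounded_by (M : R) (f : T -> R) := forall t, `|f t| <= M.

Definition bfun (f : T -> R) := exists M, bounded_by M f.

(** Linearity is imposed on bounded functions only: the functionals to be used come from an operator
    on bounded functions, extended by a junk value. *)
Record bounded_functional (q : (T -> R) -> R) : Prop := BoundedFunctional {
  bfD : forall f f', bfun f -> bfun f' -> q (fun t => f t + f' t) = q f + q f';
  bfZ : forall a f, bfun f -> q (fun t => a * f t) = a * q f;
  bf_le : exists2 C, 0 <= C & forall M f, bounded_by M f -> `|q f| <= C * M
}.

Lemma bfun_cst (c : R) : bfun (fun=> c).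
Proof. by exists `|c| => t. Qed.

Lemma bfunD f f' : bfun f -> bfun f' -> bfun (fun t => f t + f' t).
Proof.
move=> [M hM] [M' hM']; exists (M + M') => t.
by rewrite (le_trans (ler_normD _ _))// lerD.
Qed.

Lemma bfunM f f' : bfun f -> bfun f' -> bfun (fun t => f t * f' t).
Proof. by move=> [M hM] [M' hM']; exists (M * M') => t; rewrite normrM ler_pM. Qed.

Lemma bfun_sum n (f : 'I_n -> T -> R) : (forall i, bfun (f i)) ->
  bfun (fun t => \sum_(i < n) f i t).
Proof.
move=> bf; elim: n f bf => [|n ih] f bf.
  by under eq_fun do rewrite big_ord0; exact: bfun_cst.
by under eq_fun do rewrite big_ord_recl; apply: bfunD => //; exact: ih.
Qed.

Section functional.
Variable q : (T -> R) -> R.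
Hypothesis hq : bounded_functional q.

Lemma bf_sum n (a : 'I_n -> R) (f : 'I_n -> T -> R) : (forall i, bfun (f i)) ->
  q (fun t => \sum_(i < n) a i * f i t) = \sum_(i < n) a i * q (f i).
Proof.
move=> bf; elim: n a f bf => [|n ih] a f bf.
  rewrite big_ord0; under eq_fun do rewrite big_ord0.
  by have := bfZ hq 0 (bfun_cst 0); under eq_fun do rewrite mul0r; rewrite mul0r.
rewrite big_ord_recl -ih//; under eq_fun do rewrite big_ord_recl.
rewrite bfD//; first by rewrite bfZ.
  by apply: bfunM => //; exact: bfun_cst.
by apply: bfun_sum => i; apply: bfunM => //; exact: bfun_cst.
Qed.

Lemma bfB f f' : bfun f -> bfun f' -> q (fun t => f t - f' t) = q f - q f'.
Proof.
move=> bf bf'; under eq_fun do rewrite -mulN1r.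
rewrite bfD// ?bfZ ?mulN1r//.
by apply: bfunM => //; exact: bfun_cst.
Qed.

Let w m (a : R) : R := (1 + a ^+ 2) ^+ m.

Let w_ge0 m a : 0 <= w m a.
Proof. exact: le_trans (weight_ge1 _ _). Qed.

Section grid.
Variable N : nat.
Hypothesis N0 : (0 < N)%N.

(** Index of [a] rounded down to a multiple of 1 / N when |a| < N. Otherwise the index [N * N] is
    returned, whose node is 0, so that only finitely many nodes occur. *)
Definition grid_index (a : R) : nat :=
  if `|a| < N%:R then Num.truncn ((a + N%:R) * N%:R) else (N * N)%N.

Definition grid_node (k : nat) : R := k%:R / N%:R - N%:R.

Let K := (2 * N * N).+1.

Local Notation idx := grid_index.
Local Notation node := grid_node.

Let nr0 : 0 < N%:R :> R. Proof. by rewrite ltr0n. Qed.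

Lemma grid_index_lt a : (idx a < K)%N.
Proof.
rewrite /grid_index /K; case: ifP => [aN|_]; last first.
  by rewrite ltnS -mulnA leq_pmull.
move: aN; rewrite ltr_norml => /andP[a1 a2].
have a0 : 0 <= (a + N%:R) * N%:R by rewrite mulr_ge0//; lra.
have /andP[t1 _] := truncn_itv a0.
rewrite ltnS -(ler_nat R) (le_trans t1)// !natrM ler_wpM2r//; lra.
Qed.

(** Inside the grid the error is at most the mesh 1 / N; outside, the node is 0 and |a| <= a^2 / N
    because |a| >= N. *)
Lemma grid_node_near a : `|node (idx a) - a| <= (1 + a ^+ 2) / N%:R.
Proof.
rewrite /grid_index; case: ifP => [aN|/negbT aN].
  have a0 : 0 <= (a + N%:R) * N%:R.
    by move: aN; rewrite ltr_norml => /andP[a1 a2]; rewrite mulr_ge0//; lra.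
  have /andP[t1 t2] := truncn_itv a0.
  have -> : node (Num.truncn ((a + N%:R) * N%:R)) - a =
      ((Num.truncn ((a + N%:R) * N%:R))%:R - (a + N%:R) * N%:R) / N%:R.
    by rewrite /grid_node; field; rewrite gt_eqF.
  have i0 : 0 <= N%:R^-1 :> R by rewrite invr_ge0 ltW.
  rewrite normrM (ger0_norm i0) ler_wpM2r//.
  rewrite ler_norml; have := sqr_ge0 a; rewrite -natr1 in t2; lra.
rewrite -leNgt in aN.
have -> : node (N * N) - a = - a.
  by rewrite /grid_node natrM mulfK ?gt_eqF// subrr sub0r.
rewrite normrN ler_pdivlMr//.
have <- : `|a| ^+ 2 = a ^+ 2 by exact: (real_normK (num_real a)).
move: aN nr0 (normr_ge0 a); move: `|a| N%:R => x y; nra.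
Qed.

Lemma weight_grid_node m a : w m (node (idx a)) <= (8 * (1 + a ^+ 2)) ^+ (2 * m).
Proof.
have N1 : 1 <= N%:R :> R by rewrite ler1n.
have h : `|node (idx a)| <= 2 * (1 + a ^+ 2).
  have -> : node (idx a) = (node (idx a) - a) + a by ring.
  rewrite (le_trans (ler_normD _ _))//.
  have := grid_node_near a; have a2 := sqr_ge0 a.
  have : (1 + a ^+ 2) / N%:R <= 1 + a ^+ 2.
    by rewrite ler_pdivrMr// ler_peMr// addr_ge0.
  have := sqr_ge0 (`|a| - 1); have := normr_ge0 a.
  have <- : `|a| ^+ 2 = a ^+ 2 by exact: (real_normK (num_real a)).
  nra.
rewrite /w exprM lerXn2r// ?nnegrE ?addr_ge0 ?sqr_ge0//.
rewrite -(real_normK (num_real (node _))).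
have := normr_ge0 (node (idx a)); have := sqr_ge0 a; nra.
Qed.

(** The rounded family takes finitely many values, so both sides are the same finite sum, weighted
    by the means of the indicators of the grid cells. *)
Lemma gmean_exchange_grid (v : R -> T -> R) (hv : forall a, bfun (v a)) :
  gmean (fun a => q (v (node (idx a)))) =
  q (fun t => gmean (fun a => v (node (idx a)) t)).
Proof.
pose p (k : 'I_K) : R := gmean (fun a => (idx a == k)%:R).
have e (F : R -> R) a : F (node (idx a)) = \sum_(k < K) F (node k) * (idx a == k)%:R.
  rewrite (bigD1 (Ordinal (grid_index_lt a)))//= eqxx mulr1 big1 ?addr0// => k /negbTE kn.
  by rewrite (_ : (idx a == k) = false) ?mulr0// eq_sym -[RHS]kn.
have -> : (fun t => gmean (fun a => v (node (idx a)) t)) =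
    fun t => \sum_(k < K) p k * v (node k) t.
  apply/funext => t; under eq_fun do rewrite (e (fun x => v x t)).
  by rewrite gmean_sum; apply: eq_bigr => k _; rewrite gmeanZ mulrC.
rewrite bf_sum//; under eq_fun do rewrite (e (fun x => q (v x))).
by rewrite gmean_sum; apply: eq_bigr => k _; rewrite gmeanZ mulrC.
Qed.

End grid.

(* Bounded functionals commute with the Gaussian mean of a locally Lipschitz
   family: replace the variable by its rounding on a grid of mesh [1 / N]. *)
Lemma gmean_exchange1 (v : R -> T -> R) m (C : R) : 0 <= C ->
  (forall a t, `|v a t| <= C * w m a) ->
  (forall a b t, `|v a t - v b t| <= C * `|a - b| * w m a * w m b) ->
  gmean (fun a => q (v a)) = q (fun t => gmean (fun a => v a t)).
Proof.
move=> C0 vC vL; have [Cq Cq0 hC] := bf_le hq.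
have bv a : bfun (v a) by exists (C * w m a) => t; exact: vC.
(* Up to the factor C, this dominates the family at [a], the family at the rounding of [a], and N
   times their difference: the first factor bounds the weight at the node, the second the weight at
   [a] times the rounding error. *)
pose W a : R := (8 * (1 + a ^+ 2)) ^+ (2 * m) * (1 + a ^+ 2) ^+ m.+1.
have W0 a : 0 <= W a.
  have := sqr_ge0 a => a2.
  by rewrite mulr_ge0// exprn_ge0//; lra.
have pW c : pgrowth (fun a => c * W a).
  apply: pgrowthZ; apply: pgrowthM; last first.
    by exists m.+1, 1 => // t; rewrite mul1r ger0_norm// (le_trans ler01)// weight_ge1.
  exists (2 * m)%N, (8 ^+ (2 * m)) => [|t]; first exact: exprn_ge0.
  by rewrite exprMn ger0_norm// mulr_ge0 ?exprn_ge0// addr_ge0// sqr_ge0.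
pose D := gmean W.
suff key N : (0 < N)%N -> `|gmean (fun a => q (v a)) - q (fun t => gmean (fun a => v a t))| <=
    2 * (Cq * (C * D)) / N%:R.
  apply/eqP; rewrite -subr_eq0 -normr_le0; apply/ler_addgt0Pl => e e0; rewrite addr0.
  have D0 : 0 <= D.
    by apply: gmean_ge0 => //; have := pW 1; under eq_fun do rewrite mul1r.
  have K0 : 0 <= 2 * (Cq * (C * D)) by rewrite !mulr_ge0.
  have [N N0 hN] : exists2 N, (0 < N)%N & 2 * (Cq * (C * D)) / e <= N%:R.
    exists (Num.truncn (2 * (Cq * (C * D)) / e)).+1 => //.
    by rewrite ltW// truncnS_gt.
  apply: le_trans (key N N0) _.
  by rewrite ler_pdivrMr ?ltr0n// [e * _]mulrC -ler_pdivrMr.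
move=> N0; have nr0 : 0 < N%:R :> R by rewrite ltr0n.
pose r a := grid_node N (grid_index N a).
have rC a t : `|v (r a) t| <= C * W a.
  rewrite (le_trans (vC _ _))// ler_wpM2l// (le_trans (weight_grid_node N0 m a))//.
  have a2 := sqr_ge0 a.
  by rewrite /W ler_peMr ?exprn_ge0 ?weight_ge1//; lra.
have vCW a t : `|v a t| <= C * W a.
  have a2 := sqr_ge0 a; rewrite (le_trans (vC _ _))// ler_wpM2l//.
  have h := weight_le a (leqnSn m); rewrite (le_trans h)//.
  by rewrite /W ler_peMl ?exprn_ege1 ?exprn_ge0//; lra.
have dC a t : `|v a t - v (r a) t| <= C / N%:R * W a.
  rewrite (le_trans (vL _ _ _))// -!mulrA ler_wpM2l// mulrA.
  have a2 := sqr_ge0 a.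
  rewrite distrC; apply: le_trans (ler_pM _ _ (ler_wpM2r (w_ge0 m a) (grid_node_near N0 a)) (weight_grid_node N0 m a)) _.
  - by rewrite mulr_ge0.
  - exact: w_ge0.
  rewrite /W [_ ^+ m.+1]exprS /w le_eqVlt; apply/orP; left; apply/eqP.
  move: (1 + a ^+ 2) => b; move: (b ^+ m) (_ ^+ (2 * m)) N%:R^-1 => x y z; ring.
have gm_le (F : R -> R) c : 0 <= c -> (forall a, `|F a| <= c * W a) -> `|gmean F| <= c * D.
  move=> c0 Fc; have pF : pgrowth F.
    by apply: pgrowth_le (pW c) _ => a; rewrite (le_trans (Fc a))// ler_norm.
  rewrite /D -gmeanZ ler_norml -gmeanN; apply/andP; split; apply: gmean_le => //.
  - by under eq_fun do rewrite -mulN1r; apply: pgrowthZ.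
  - by move=> a; have := Fc a; rewrite ler_norml => /andP[].
  - by move=> a; have := Fc a; rewrite ler_norml => /andP[].
have e1 : `|gmean (fun a => q (v a)) - gmean (fun a => q (v (r a)))| <=
    Cq * (C / N%:R * D).
  rewrite -gmeanN -gmeanD mulrA; apply: gm_le => [|a].
    by rewrite !mulr_ge0// invr_ge0 ltW.
  by rewrite -bfB// -mulrA; apply: hC => t; exact: dC.
have bE : bfun (fun t => gmean (fun a => v a t)).
  by exists (C * D) => t; apply: gm_le.
have bE' : bfun (fun t => gmean (fun a => v (r a) t)).
  by exists (C * D) => t; apply: gm_le => // a; exact: rC.
have e2 : `|q (fun t => gmean (fun a => v (r a) t)) - q (fun t => gmean (fun a => v a t))| <=
    Cq * (C / N%:R * D).
  rewrite -bfB//; apply: hC => t; rewrite distrC -gmeanN -gmeanD.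
  by apply: gm_le => [|a]; [rewrite divr_ge0// ltW|exact: dC].
have e3 : gmean (fun a => q (v (r a))) = q (fun t => gmean (fun a => v (r a) t)).
  exact: gmean_exchange_grid.
have -> : 2 * (Cq * (C * D)) / N%:R = Cq * (C / N%:R * D) + Cq * (C / N%:R * D).
  by field; rewrite gt_eqF.
apply: le_trans (lerD e1 e2); rewrite e3.
exact: ler_distD.
Qed.

End functional.

(** The regularity in g that rounding requires. It is uniform in t because a bounded functional is
    controlled by suprema over t, and the weights at both g and h make the class stable under
    products. *)
Definition lipgrowth n v := exists m, exists2 C, 0 <= C &
  (forall g t, `|v g t| <= C * weightn n m g) /\
  (forall g h t, `|v g t - v h t| <=
     C * (\sum_(i < n) `|g i - h i|) * weightn n m g * weightn n m h).

Lemma lipgrowth_slice n v a : lipgrowth n.+1 v -> lipgrowth n (fun g => v (scons a g)).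
Proof.
move=> [m [C C0 [h1 h2]]]; have w0 : 0 <= (1 + a ^+ 2) ^+ m.
  by rewrite exprn_ge0// addr_ge0// sqr_ge0.
have w1 := weight_ge1 a m.
exists m, (C * (1 + a ^+ 2) ^+ m * (1 + a ^+ 2) ^+ m); first by rewrite !mulr_ge0.
split=> [g t|g h t].
  rewrite (le_trans (h1 _ _))// weightn_scons mulrA ler_wpM2r ?weightn_ge0//.
  by rewrite ler_peMr// mulr_ge0.
rewrite (le_trans (h2 _ _ _))// !weightn_scons big_ord_recl /= subrr normr0 add0r.
move: (\sum_(i < n) _) (weightn n m g) (weightn n m h) (_ ^+ m) => x y z u.
by rewrite le_eqVlt; apply/orP; left; apply/eqP; ring.
Qed.

Lemma lipgrowth_growth n v t : lipgrowth n v -> growth n (fun g => v g t).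
Proof. by move=> [m [C C0 [h1 _]]]; exists m, C. Qed.

(** The inner means are exchanged by induction on slices, the outer one by [gmean_exchange1]. The
    inner mean inherits the Lipschitz bound, with the constant [D] of exponent [m + m] because the
    weight of the common coordinates occurs twice. *)
Lemma gmeann_exchange q n v : bounded_functional q -> lipgrowth n v ->
  gmeann n (fun g => q (v g)) = q (fun t => gmeann n (fun g => v g t)).
Proof.
move=> hq; elim: n v => [//|n ih] v lv.
rewrite [LHS]/=.
under eq_fun do rewrite (ih (fun g => v (scons _ g)) (lipgrowth_slice _ lv)).
have [m [C C0 [h1 h2]]] := lv; pose D := gmeann n (@weightn R n (m + m)).
have D0 : 0 <= D by apply: gmeann_ge0 => [|g]; [exact: growth_weightn|exact: weightn_ge0].
apply: (@gmean_exchange1 q hq _ m (C * D)); first exact: mulr_ge0.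
  move=> a t; rewrite mulrAC /D -gmeannZ.
  apply: gmeann_norm_le => [||g].
  - exact: (lipgrowth_growth t (lipgrowth_slice a lv)).
  - by apply: growthM; [exact: growth_cst|exact: growth_weightn].
  rewrite (le_trans (h1 _ _))// weightn_scons mulrA ler_wpM2l ?mulr_ge0 ?w_ge0//.
    by rewrite exprn_ge0// addr_ge0// sqr_ge0.
  by rewrite weightn_le// leq_addr.
move=> a b t; rewrite -gmeannB.
have -> : C * D * `|a - b| * (1 + a ^+ 2) ^+ m * (1 + b ^+ 2) ^+ m =
    C * `|a - b| * (1 + a ^+ 2) ^+ m * (1 + b ^+ 2) ^+ m * D.
  by move: (_ ^+ m) (_ ^+ m) => x y; ring.
rewrite /D -gmeannZ; apply: gmeann_norm_le => [||g].
- apply: growthB; first exact: (lipgrowth_growth t (lipgrowth_slice a lv)).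
  exact: (lipgrowth_growth t (lipgrowth_slice b lv)).
- by apply: growthM; [exact: growth_cst|exact: growth_weightn].
rewrite (le_trans (h2 _ _ _))// !weightn_scons big_ord_recl /= weightnD.
rewrite [\sum_(i < n) _]big1 ?addr0 => [|i _]; last by rewrite subrr normr0.
move: (weightn n m g) (_ ^+ m) (_ ^+ m) => x y z.
by rewrite le_eqVlt; apply/orP; left; apply/eqP; ring.
Qed.

Let dist_ge0 n g h : 0 <= \sum_(i < n) `|g i - h i|.
Proof. exact: sumr_ge0. Qed.

Lemma lipgrowth_cst n (b : T -> R) : bfun b -> lipgrowth n (fun=> b).
Proof.
move=> [M hM]; exists 0%N, `|M| => //; split=> [g t|g h t].
  by rewrite (le_trans (hM t))// (le_trans (ler_norm M))// ler_peMr ?weightn_ge1.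
by rewrite subrr normr0 !mulr_ge0// weightn_ge0.
Qed.

Lemma lipgrowth_coord n i : (i < n)%N -> lipgrowth n (fun g _ => g i).
Proof.
move=> ni; have [m [C C0 hC]] := @growth_coord R n i ni; exists m, (C + 1).
  by rewrite addr_ge0.
split=> [g _|g h _]; first by rewrite (le_trans (hC g))// ler_wpM2r ?weightn_ge0// lerDl.
rewrite -!mulrA -[leLHS]mul1r ler_pM ?lerDr// -[leLHS]mulr1 ler_pM//.
  by rewrite (bigD1 (Ordinal ni))//= lerDl sumr_ge0.
by rewrite -[leLHS]mulr1 ler_pM ?weightn_ge1.
Qed.

Lemma lipgrowthD n v v' : lipgrowth n v -> lipgrowth n v' ->
  lipgrowth n (fun g t => v g t + v' g t).
Proof.
move=> [m [C C0 [h1 h2]]] [k [D D0 [h3 h4]]].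
exists (m + k)%N, (C + D); first exact: addr_ge0.
have lm g : weightn n m g <= weightn n (m + k) g by rewrite weightn_le// leq_addr.
have lk g : weightn n k g <= weightn n (m + k) g by rewrite weightn_le// leq_addl.
split=> [g t|g h t].
  rewrite (le_trans (ler_normD _ _))// mulrDl lerD//.
    by rewrite (le_trans (h1 _ _))// ler_wpM2l.
  by rewrite (le_trans (h3 _ _))// ler_wpM2l.
rewrite opprD addrACA (le_trans (ler_normD _ _))// !mulrDl lerD//.
  rewrite (le_trans (h2 _ _ _))// ler_pM ?weightn_ge0// ?mulr_ge0 ?weightn_ge0//.
  by rewrite ler_wpM2l// mulr_ge0.
rewrite (le_trans (h4 _ _ _))// ler_pM ?weightn_ge0// ?mulr_ge0 ?weightn_ge0//.
by rewrite ler_wpM2l// mulr_ge0.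
Qed.

Lemma lipgrowthM n v v' : lipgrowth n v -> lipgrowth n v' ->
  lipgrowth n (fun g t => v g t * v' g t).
Proof.
move=> [m [C C0 [h1 h2]]] [k [D D0 [h3 h4]]].
exists (m + k)%N, (C * D + C * D); first by rewrite addr_ge0// mulr_ge0.
have w0 j g : 0 <= weightn n j g by exact: weightn_ge0.
have lm g : weightn n m g <= weightn n (m + k) g by rewrite weightn_le// leq_addr.
have lk g : weightn n k g <= weightn n (m + k) g by rewrite weightn_le// leq_addl.
split=> [g t|g h t].
  rewrite normrM (le_trans (ler_pM _ _ (h1 g t) (h3 g t)))// mulrACA -weightnD.
  by rewrite ler_wpM2r// lerDl mulr_ge0.
have -> : v g t * v' g t - v h t * v' h t =
    v g t * (v' g t - v' h t) + (v g t - v h t) * v' h t by ring.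
rewrite (le_trans (ler_normD _ _))// !normrM !mulrDl lerD//.
  rewrite (le_trans (ler_pM _ _ (h1 g t) (h4 g h t)))//.
  apply: (@le_trans _ _ (C * D * (\sum_(i < n) `|g i - h i|) *
     (weightn n m g * weightn n k g) * weightn n k h)).
    move: (\sum_(i < n) _) (weightn n m g) (weightn n k g) (weightn n k h) => x y z u.
    by rewrite le_eqVlt; apply/orP; left; apply/eqP; ring.
  by rewrite -weightnD ler_wpM2l// !mulr_ge0.
rewrite (le_trans (ler_pM _ _ (h2 g h t) (h3 h t)))//.
apply: (@le_trans _ _ (C * D * (\sum_(i < n) `|g i - h i|) *
   weightn n m g * (weightn n m h * weightn n k h))).
  move: (\sum_(i < n) _) (weightn n m g) (weightn n m h) (weightn n k h) => x y z u.
  by rewrite le_eqVlt; apply/orP; left; apply/eqP; ring.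
by rewrite -weightnD ler_wpM2r// ler_wpM2l// !mulr_ge0.
Qed.

Lemma lipgrowth_sum n (I : Type) (r : seq I) (v : I -> (nat -> R) -> T -> R) :
  (forall i, lipgrowth n (v i)) -> lipgrowth n (fun g t => \sum_(i <- r) v i g t).
Proof.
move=> lv; elim: r => [|i r ih].
  under eq_fun => g do under eq_fun do rewrite big_nil.
  exact/lipgrowth_cst/bfun_cst.
by under eq_fun => g do under eq_fun do rewrite big_cons; exact: lipgrowthD.
Qed.

Lemma lipgrowth_prod n (I : Type) (r : seq I) (v : I -> (nat -> R) -> T -> R) :
  (forall i, lipgrowth n (v i)) -> lipgrowth n (fun g t => \prod_(i <- r) v i g t).
Proof.
move=> lv; elim: r => [|i r ih].
  under eq_fun => g do under eq_fun do rewrite big_nil.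
  exact/lipgrowth_cst/bfun_cst.
by under eq_fun => g do under eq_fun do rewrite big_cons; exact: lipgrowthM.
Qed.

Lemma lipgrowthX n v k : lipgrowth n v -> lipgrowth n (fun g t => v g t ^+ k).
Proof.
move=> lv; elim: k => [|k ih]; first exact/lipgrowth_cst/bfun_cst.
by under eq_fun => g do under eq_fun do rewrite exprS; exact: lipgrowthM.
Qed.

Lemma lipgrowth_comp n v (F : R -> R) : (forall x y, `|F x - F y| <= `|x - y|) ->
  lipgrowth n v -> lipgrowth n (fun g t => F (v g t)).
Proof.
move=> hF [m [C C0 [h1 h2]]]; exists m, (`|F 0| + C); first by rewrite addr_ge0.
split=> [g t|g h t].
  rewrite mulrDl (_ : F _ = F 0 + (F (v g t) - F 0)); last by ring.
  rewrite (le_trans (ler_normD _ _))// lerD ?ler_peMr ?weightn_ge1//.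
  by rewrite (le_trans (hF _ _))// subr0.
rewrite (le_trans (hF _ _))// (le_trans (h2 _ _ _))//.
by rewrite !ler_wpM2r ?weightn_ge0// lerDr.
Qed.

End exchange.

(** * Scalars and functions on the sphere *)

Section scalars.
Variable R : realType.

(* What the proof uses of the real part on R or C. *)
Record real_part (K : scalars R) (re : K -> R) : Prop := RealPart {
  rpD : forall z w, re (z + w) = re z + re w;
  rpZ : forall a z, re (ofR a * z) = a * re z;
  rp1 : re 1 = 1;
  rp_le : forall z, re z <= reS `|z|;
  rp_norming : forall w M, (forall z, re (z * w) <= M * reS `|z|) -> reS `|w| <= M;
  rp_riesz : forall l : K -> R, (forall z w, l (z + w) = l z + l w) ->
    (forall a z, l (ofR a * z) = a * l z) -> exists c, forall z, l z = re (z * c)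
}.

Lemma real_part_real : @real_part (real_scalars R) id.
Proof.
split=> // [z|w M h|l lD lZ]; first exact: ler_norm.
  have := h 1; have := h (-1).
  rewrite mulN1r mul1r normrN normr1 mulr1 => h1 h2.
  by rewrite ler_norml lerNl h1 h2.
by exists (l 1) => z; rewrite -{1}[z]mulr1; exact: lZ.
Qed.

Lemma real_part_complex : @real_part (complex_scalars R) (@complex.Re R).
Proof.
split=> [[a b] [c d]|a [b c]||z|w M h|l lD lZ] //=.
- by rewrite mul0r subr0.
- have := normc_ge_Re z; rewrite -(@real_complex_Re_norm R z) lecR.
  exact: le_trans (ler_norm _).
- have [w0|w0] := eqVneq (w : R[i]) 0.
    have : complex.Re (1 * w) <= M * complex.Re `|1 : R[i]| := h 1.
    by rewrite w0 mulr0 normr1 mulr1 Normc.normc0.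
  have n0 : 0 < complex.Re `|w|.
    rewrite lt_neqAle (@reS_norm_ge0 R (complex_scalars R)) andbT eq_sym.
    by apply: contra_neq w0; exact: (@reS_norm_eq0 R (complex_scalars R)).
  (* Testing with the conjugate of w gives |w|^2 <= M |w|. *)
  have := h (conjc w); rewrite normcJ mulrC -sqr_normc.
  have -> : complex.Re (`|w| ^+ 2) = complex.Re `|w| ^+ 2.
    by rewrite -[in LHS](@real_complex_Re_norm R w) -rmorphXn.
  by rewrite expr2 ler_pM2r.
(* The representing scalar is c = l(1) - i l(i), as Re((a + i b) c) = a l(1) + b l(i). *)
exists (Complex (l 1) (- l (Complex 0 1))) => -[a b].
have -> : Complex a b = real_complex R a * 1 + real_complex R b * Complex 0 1.
  by rewrite /= mulr1; congr Complex; rewrite /=; ring.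
rewrite lD (lZ a) (lZ b) /=; ring.
Qed.

Section theory.
Variables (K : scalars R) (re : K -> R).
Hypothesis hre : real_part re.

Lemma rp0 : re 0 = 0.
Proof. by have := rpZ hre 0 1; rewrite rmorph0 !mul0r. Qed.

Lemma rp_ofR a : re (ofR a) = a.
Proof. by rewrite -[ofR a]mulr1 (rpZ hre) (rp1 hre) mulr1. Qed.

Lemma rp_mulr_ofR a z : re (z * ofR a) = a * re z.
Proof. by rewrite mulrC (rpZ hre). Qed.

Lemma rpN z : re (- z) = - re z.
Proof.
by have := rpZ hre (-1) z; rewrite rmorphN rmorph1 !mulN1r.
Qed.

Lemma rp_norm_le z : `|re z| <= reS `|z|.
Proof. by rewrite ler_norml lerNl -rpN -{1}normrN !(rp_le hre). Qed.

Lemma rp_sum (I : Type) (r : seq I) (P : pred I) (F : I -> K) :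
  re (\sum_(i <- r | P i) F i) = \sum_(i <- r | P i) re (F i).
Proof. by elim/big_rec2: _ => [|i a b _ <-]; rewrite ?rp0 ?(rpD hre). Qed.

Lemma rp_inj z w : (forall x, re (x * z) = re (x * w)) -> z = w.
Proof.
move=> h; apply/eqP; rewrite -subr_eq0; apply/eqP/reS_norm_eq0/eqP.
rewrite eq_le reS_norm_ge0 andbT; apply: (rp_norming hre) => x.
by rewrite mul0r mulrBr (rpD hre) rpN h subrr.
Qed.

End theory.
End scalars.

(** * Homogeneous polynomials on the sphere and their radial extensions *)

Section sphere_functions.
Variables (R : realType) (n : nat).
Implicit Types (y e : sphere R n) (g x : nat -> R).

Definition crd y (i : nat) : R :=
  if insub i is Some j then val y ord0 j else 0.

Lemma crdE y (i : 'I_n) : crd y i = val y ord0 i.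
Proof. by rewrite /crd valK. Qed.

Lemma nrm2_crd y : nrm2 n (crd y) = 1.
Proof.
have /eqP := valP y; rewrite /norm2 => h.
have s0 : 0 <= \sum_i val y ord0 i ^+ 2 by apply: sumr_ge0 => i _; exact: sqr_ge0.
have -> : nrm2 n (crd y) = \sum_i val y ord0 i ^+ 2.
  by apply: eq_bigr => i _; rewrite crdE.
by rewrite -[LHS]sqr_sqrtr// h expr1n.
Qed.

Definition radius g : R := Num.sqrt (nrm2 n g).

(* [g / |g|], with the junk value [e] at [g = 0]. *)
Definition polar e g : sphere R n := insubd e (\row_i (g i / radius g)).

Lemma radius_ge0 g : 0 <= radius g.
Proof. exact: sqrtr_ge0. Qed.

Lemma radius_sqr g : radius g ^+ 2 = nrm2 n g.
Proof. by rewrite sqr_sqrtr ?nrm2_ge0. Qed.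

(** At g = 0 both sides vanish whatever the junk direction, so no later formula has to exclude the
    origin. *)
Lemma polarK e g (i : 'I_n) : radius g * crd (polar e g) i = g i.
Proof.
have [g0|g0] := eqVneq (radius g) 0.
  have h : nrm2 n g = 0 by rewrite -radius_sqr g0 expr0n.
  move/eqP: h; rewrite psumr_eq0 => [/allP/(_ i)|j _]; last exact: sqr_ge0.
  by rewrite mem_index_enum sqrf_eq0 g0 mul0r => /(_ isT)/eqP.
rewrite crdE /polar val_insubd ifT.
  by rewrite mxE mulrC divfK.
rewrite /norm2 (_ : \sum_j _ = 1) ?sqrtr1//.
under eq_bigr do rewrite mxE exprMn.
by rewrite -mulr_suml -/(nrm2 n g) -radius_sqr -exprMn divff// expr1n.
Qed.

Lemma dot_polarl e x g : dot n x g = radius x * dot n (crd (polar e x)) g.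
Proof.
by rewrite mulr_sumr; apply: eq_bigr => i _; rewrite mulrA polarK.
Qed.

Lemma meval_homog (K : comRingType) d (p : mpoly n K) (a : K) (v : 'I_n -> K) :
  p \is ishomog1 d mdeg -> meval (fun i => a * v i) p = a ^+ d * meval v p.
Proof.
move=> /dhomogP hp; rewrite !mevalE mulr_sumr big_seq [RHS]big_seq.
apply: eq_bigr => m /hp /= md; rewrite [RHS]mulrCA; congr (_ * _).
rewrite -md mdegE -prodrXr -big_split /=; apply: eq_bigr => i _.
by rewrite exprMn.
Qed.

Definition spoly d (F : sphere R n -> R) := exists2 p : mpoly n R,
  p \is ishomog1 d mdeg & forall y, F y = meval (fun i : 'I_n => crd y i) p.

Lemma spoly_radial d F : spoly d F -> exists2 p : mpoly n R,
  p \is ishomog1 d mdeg & (forall y, F y = meval (fun i : 'I_n => crd y i) p) /\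
  forall e g, radius g ^+ d * F (polar e g) = meval (fun i : 'I_n => g i) p.
Proof.
move=> [p hp Fp]; exists p => //; split=> // e g.
rewrite Fp -meval_homog//; congr meval; apply/funext => i.
exact: polarK.
Qed.

Lemma spoly0 d : spoly d (fun=> 0).
Proof. by exists 0 => [|y]; rewrite ?rpred0// meval0. Qed.

Lemma spolyD d F G : spoly d F -> spoly d G -> spoly d (fun y => F y + G y).
Proof.
move=> [p hp Fp] [q hq Gq]; exists (p + q); first exact: rpredD.
by move=> y; rewrite mevalD Fp Gq.
Qed.

Lemma spolyZ d a F : spoly d F -> spoly d (fun y => a * F y).
Proof.
move=> [p hp Fp]; exists (a *: p); first exact: rpredZ.
by move=> y; rewrite mevalZ Fp.
Qed.

Lemma spoly_sum d (I : Type) (r : seq I) (P : pred I) F :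
  (forall i, P i -> spoly d (F i)) -> spoly d (fun y => \sum_(i <- r | P i) F i y).
Proof.
move=> hF; elim: r => [|i r ih].
  by under eq_fun do rewrite big_nil; exact: spoly0.
under eq_fun do rewrite big_cons; case: (boolP (P i)) => Pi //.
by apply: spolyD => //; exact: hF.
Qed.

(** Monomials are indexed by words [w] instead of exponents, since a power of <x, g> expands over
    words without multinomial coefficients. *)
Definition radial_monomial m k (w : 'I_k -> 'I_n) : mpoly n R :=
  normp R n ^+ m * \prod_(j < k) mpolyX R (mnm1 (w j)).

Lemma radial_monomial_homog m k (w : 'I_k -> 'I_n) :
  radial_monomial m w \is ishomog1 (m.*2 + k) mdeg.
Proof.
apply: dhomogM.
  rewrite -mul2n; apply: dhomogMn; apply: rpred_sum => i _.
  rewrite -[2%N](_ : (1 * 2)%N = _)//; apply: dhomogMn.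
  by rewrite dhomogX; apply/eqP; exact: mdeg1.
elim: k w => [|k ih] w; first by rewrite big_ord0; exact: dhomog1.
rewrite big_ord_recl; have h1 : mpolyX R (mnm1 (w ord0)) \is ishomog1 1 mdeg.
  by rewrite dhomogX; apply/eqP; exact: mdeg1.
exact: dhomogM h1 (ih (fun j => w (lift ord0 j))).
Qed.

Lemma meval_radial_monomial m k (w : 'I_k -> 'I_n) g :
  meval (fun i : 'I_n => g i) (radial_monomial m w) =
  nrm2 n g ^+ m * \prod_(j < k) g (w j).
Proof.
rewrite mevalM rmorphXn /= meval_normp; congr (_ * _).
by rewrite rmorph_prod; apply: eq_bigr => j _; rewrite /= mevalXU.
Qed.

(* A monomial of lower degree and of the same parity is homogeneous of degree
   [d] on the sphere, after multiplication by a power of [|y|^2]. *)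
Lemma spoly_monomial d m k (w : 'I_k -> 'I_n) : (m.*2 + k = d)%N ->
  spoly d (fun y => \prod_(j < k) crd y (w j)).
Proof.
move=> <-; exists (radial_monomial m w); first exact: radial_monomial_homog.
by move=> y; rewrite meval_radial_monomial nrm2_crd expr1n mul1r.
Qed.

Section scalar_valued.
Variables (K : scalars R) (re : K -> R).
Hypothesis hre : real_part re.

(** The coordinates are real, so the real part can be taken coefficient by coefficient. *)
Lemma spoly_re d (f : sphere R n -> K) z :
  f \in is_hpoly (fun y : sphere R n => val y) d -> spoly d (fun y => re (z * f y)).
Proof.
move=> /asboolP[p /dhomogP hp fp].
exists (\sum_(m <- msupp p) re (z * mcoeff m p) *: mpolyX R m).
  rewrite big_seq; apply: rpred_sum => m /hp md; apply: rpredZ.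
  by rewrite dhomogX md.
move=> y; rewrite fp mevalE mulr_sumr (rp_sum hre) raddf_sum.
apply: eq_bigr => m _; rewrite /= mevalZ mevalX mulrA.
rewrite (_ : \prod_i _ = ofR (\prod_(i < n) crd y i ^+ m i)).
  by rewrite (rp_mulr_ofR hre) mulrC.
by rewrite rmorph_prod; apply: eq_bigr => i _; rewrite rmorphXn crdE.
Qed.

Lemma spoly_ofR d F c : spoly d F ->
  (fun y => ofR (F y) * c : K) \in is_hpoly (fun y : sphere R n => val y) d.
Proof.
move=> [p hp Fp]; apply/asboolP; exists (c *: map_mpoly ofR p).
  apply: rpredZ; apply/dhomogP => m mp; move/dhomogP: hp; apply.
  move: mp; rewrite !mcoeff_msupp mcoeff_map_mpoly; apply: contra_neq => ->.
  exact: rmorph0.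
move=> y; rewrite mevalZ mulrC Fp; congr (_ * _).
rewrite mevalE [map_mpoly _ _]/(map_mpoly _ _) /map_mpoly /mmap raddf_sum rmorph_sum.
apply: eq_bigr => m _; rewrite /= mmap1_id mul_mpolyC mevalZ mevalX rmorphM; congr (_ * _).
by rewrite rmorph_prod; apply: eq_bigr => i _; rewrite rmorphXn crdE.
Qed.

End scalar_valued.
End sphere_functions.

Lemma ofR_norm_id (R : realType) (K : scalars R) (V : normedModType K) (x : V) :
  ofR (reS `|x|) = `|x|.
Proof. by rewrite -normr_id ofR_norm. Qed.

(** * The Banach space of bounded functions with values in R or C *)

Section bounded_functions.
Variables (R : realType) (K : scalars R) (T : Type).

Definition is_bounded : {pred T -> K} :=
  fun f => `[< exists M, forall t, reS `|f t| <= M >].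

Lemma is_bounded_submod : submod_closed is_bounded.
Proof.
split=> [|a f g /asboolP[M hM] /asboolP[N hN]]; apply/asboolP.
  by exists (reS `|0 : K|) => t.
exists (reS `|a| * M + N) => t.
rewrite [X in reS `|X|](_ : _ = a * f t + g t)//.
rewrite (le_trans (reS_normD _ _))// reS_normM lerD// ler_wpM2l//.
exact: reS_norm_ge0.
Qed.

HB.instance Definition _ := GRing.isSubmodClosed.Build K (T -> K) is_bounded
  is_bounded_submod.

Record bounded_function := BoundedFunction {
  bounded_fun :> T -> K;
  bounded_funP : bounded_fun \in is_bounded
}.

HB.instance Definition _ := [isSub for bounded_fun].
HB.instance Definition _ := [Choice of bounded_function by <:].
HB.instance Definition _ := [SubChoice_isSubLmodule of bounded_function by <:].

Implicit Types f g : bounded_function.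

Let supn f := sup [set reS `|f t| | t in [set: T]].

Let le_supn f t : reS `|f t| <= supn f.
Proof.
apply: ub_le_sup; last by exists t.
by have /asboolP[M hM] := bounded_funP f; exists M => _ [u _ <-].
Qed.

Let supn_le f (M : R) : 0 <= M -> (forall t, reS `|f t| <= M) -> supn f <= M.
Proof.
move=> M0 fM; have [T0|T0] := eqVneq [set: T] set0.
  by rewrite /supn T0 image_set0 sup0.
by apply: ge_sup => [|_ [t Bt <-]]; [exact/image_nonempty/set0P|exact: fM].
Qed.

Let supn_ge0 f : 0 <= supn f.
Proof.
have [T0|/set0P[t _]] := eqVneq [set: T] set0; first by rewrite /supn T0 image_set0 sup0.
exact: le_trans (reS_norm_ge0 _) (le_supn f t).
Qed.

Definition bounded_norm f : K := ofR (supn f).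

Let bounded_normD f g : bounded_norm (f + g) <= bounded_norm f + bounded_norm g.
Proof.
rewrite /bounded_norm -rmorphD ofR_le supn_le ?addr_ge0 ?supn_ge0// => t.
exact: le_trans (reS_normD _ _) (lerD (le_supn f t) (le_supn g t)).
Qed.

Let bounded_normZ (a : K) f : bounded_norm (a *: f) = `|a| * bounded_norm f.
Proof.
have le b h : supn (b *: h) <= reS `|b| * supn h.
  apply: supn_le => [|t]; first by rewrite mulr_ge0 ?reS_norm_ge0.
  rewrite [X in reS `|X|](_ : _ = b * h t)// reS_normM.
  by rewrite ler_wpM2l ?reS_norm_ge0.
rewrite /bounded_norm -ofR_norm -rmorphM; congr (ofR _).
apply/eqP; rewrite eq_le le /=.
have [->|a0] := eqVneq a 0.
  have -> : reS `|0 : K| = 0.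
    by apply: (can_inj (@ofRK _ K)); rewrite ofR_norm normr0 rmorph0.
  by rewrite mul0r.
have ra : reS `|a| * reS `|a^-1| = 1.
  rewrite -reS_normM divff//.
  by apply: (can_inj (@ofRK _ K)); rewrite ofR_norm normr1 rmorph1.
have := ler_wpM2l (reS_norm_ge0 a) (le a^-1 (a *: f)).
by rewrite scalerA mulVf// scale1r mulrA ra mul1r.
Qed.

Let bounded_norm_eq0 f : bounded_norm f = 0 -> f = 0.
Proof.
rewrite /bounded_norm -(rmorph0 ofR) => /(can_inj (@ofRK _ K)) f0.
apply/val_inj/funext => t; apply/reS_norm_eq0/eqP.
by rewrite eq_le reS_norm_ge0 -f0 le_supn.
Qed.

HB.instance Definition _ := Lmodule_isNormed.Build K bounded_function
  bounded_normD bounded_normZ bounded_norm_eq0.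

Lemma bounded_fun_le_norm f t : reS `|f t| <= reS `|f|.
Proof. by rewrite [X in _ <= reS X](_ : _ = ofR (supn f))// ofRK. Qed.

Lemma bounded_norm_le f (M : R) : 0 <= M -> (forall t, reS `|f t| <= M) ->
  reS `|f| <= M.
Proof. by move=> M0 h; rewrite [X in reS X](_ : _ = ofR (supn f))// ofRK supn_le. Qed.

Variable re : K -> R.
Hypothesis hre : real_part re.

Let ball_ofR f g (e : R) : ball f (ofR e) g -> forall t, reS `|f t - g t| <= e.
Proof.
rewrite -ball_normE /= => /ltW fg t.
apply: (le_trans (bounded_fun_le_norm (f - g) t)).
by rewrite -(@ofR_le _ K) ofR_norm_id.
Qed.

(* The limit is found through its real parts [re (z * f t)], because the
   completeness of the scalar field itself is not available. *)
Lemma bounded_function_complete (F : set_system bounded_function) :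
  ProperFilter F -> cauchy F -> cvg F.
Proof.
move=> FF /cauchyP Fc.
have near e : 0 < e -> exists f, F (ball f (ofR e)).
  by move=> e0; apply: Fc; rewrite -(rmorph0 ofR) lt_def (can_eq (@ofRK _ K))
    ofR_le -lt_def.
pose G t z : bounded_function -> R := fun f => re (z * f t).
have close f g e t z : ball f (ofR e) g -> `|G t z f - G t z g| <= reS `|z| * e.
  move=> /ball_ofR/(_ t) fg.
  rewrite /G -(rpN hre) -(rpD hre) -mulrBr (le_trans (rp_norm_le hre _))//.
  by rewrite reS_normM ler_wpM2l ?reS_norm_ge0.
have cG t z : cvg (G t z @ F).
  apply: cauchy_cvg; apply: cauchy_exP => e e0.
  have p0 : 0 < reS `|z| + 1 by rewrite ltr_wpDl ?reS_norm_ge0.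
  have [f hf] := near (e / (reS `|z| + 1)) (divr_gt0 e0 p0).
  exists (G t z f); suff : F (G t z @^-1` ball (G t z f) e) by [].
  apply: filterS hf => g fg; rewrite /preimage /= -ball_normE /=.
  apply: le_lt_trans (close _ _ _ _ _ fg) _.
  by rewrite mulrCA -[ltRHS]mulr1 ltr_pM2l// ltr_pdivrMr// mul1r ltrDl.
have /choice[c hc] t : exists c, forall z, lim (G t z @ F) = re (z * c).
  apply: (rp_riesz hre) => [z w|a z].
    have -> : G t (z + w) = G t z \+ G t w.
      by apply/funext => f; rewrite /G /= mulrDl (rpD hre).
    by apply/cvg_lim => //; apply: cvgD; exact: cG.
  have -> : G t (ofR a * z) = fun f => a * G t z f.
    by apply/funext => f; rewrite /G -mulrA (rpZ hre).
  by apply/cvg_lim => //; apply: cvgM; [exact: cvg_cst|exact: cG].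
have approx f e t : 0 < e -> F (ball f (ofR e)) -> reS `|f t - c t| <= e.
  move=> e0 Ff; apply: (rp_norming hre) => z.
  rewrite mulrBr (rpD hre) (rpN hre) -hc -/(G t z f) [leRHS]mulrC.
  apply/ler_addgt0Pl => d d0.
  have := cG t z; rewrite -[cvg _]/(G t z @ F --> lim (G t z @ F)).
  move=> /cvgrPdist_le/(_ d d0) hd.
  have [g [fg hg]] := filter_ex (filterI Ff hd).
  have := close f g e t z fg; move: hg; rewrite !ler_norml.
  move=> /andP[h1 h2] /andP[h3 h4]; lra.
have [f0 hf0] := near 1 ltr01.
have cb : c \in is_bounded.
  apply/asboolP; exists (1 + reS `|f0|) => t.
  rewrite -[c t](subrK (f0 t)) (le_trans (reS_normD _ _))// lerD//.
    by rewrite -normrN opprB; exact: approx hf0.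
  exact: bounded_fun_le_norm.
apply/cvg_ex; exists (BoundedFunction cb); apply/cvgrPdist_le => e e0.
(* A positive element of [K] equals its own norm, hence comes from [R]. *)
have eE : e = ofR (reS e).
  by rewrite -[e in RHS](gtr0_norm e0) ofR_norm gtr0_norm.
have re0 : 0 < reS e / 2.
  rewrite divr_gt0// lt_def -(can_eq (@ofRK _ K)) -(@ofR_le _ K) -eE rmorph0.
  by rewrite -lt_def.
have [f hf] := near _ re0; apply: filterS (hf) => g fg /=.
rewrite eE -ofR_norm_id ofR_le; apply: bounded_norm_le => [|t].
  by move: re0; lra.
rewrite [X in reS `|X|](_ : _ = (c t - f t) + (f t - g t)); last by rewrite addrA subrK.
rewrite (le_trans (reS_normD _ _))// [reS e]splitr lerD//.
  by rewrite -normrN opprB; exact: approx hf.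
exact: (ball_ofR fg t).
Qed.

Definition bounded_banach : completeNormedModType K :=
  HB.pack bounded_function
    (Uniform_isComplete.Build bounded_function bounded_function_complete).

End bounded_functions.

(** * Upper bound *)

Section restriction_of_scalars.
Variables (R : realType) (K : scalars R) (V : lmodType K).

(** A separate alias keeps the structure over [R] from clashing with the given one over [K]. *)
Definition real_module : Type := V.

HB.instance Definition _ := GRing.Zmodule.on real_module.

Let scale (a : R) (v : real_module) : real_module := (ofR a : K) *: (v : V).

Let scaleA a b v : scale a (scale b v) = scale (a * b) v.
Proof. by rewrite /scale scalerA rmorphM. Qed.

Let scale1 : left_id 1 scale.
Proof. by move=> v; rewrite /scale rmorph1 scale1r. Qed.

Let scaleDr : right_distributive scale +%R.
Proof. by move=> a u v; rewrite /scale scalerDr. Qed.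

Let scaleDl v : {morph scale^~ v : a b / a + b}.
Proof. by move=> a b; rewrite /scale rmorphD scalerDl. Qed.

HB.instance Definition _ := GRing.Zmodule_isLmodule.Build R real_module
  scaleA scale1 scaleDr scaleDl.

End restriction_of_scalars.

(* Only the real part of a functional is extended; the scalar field is
   recovered by means of [rp_riesz]. *)
Lemma hahn_banach_norm (R : realType) (K : scalars R) (X Y : normedModType K)
    (j : {linear X -> Y}) (f : X -> R) :
  (forall x, `|j x| = `|x|) ->
  (forall x x', f (x + x') = f x + f x') ->
  (forall a x, f ((ofR a : K) *: x) = a * f x) ->
  (forall x, f x <= reS `|x|) ->
  exists u : Y -> R, [/\ forall v w, u (v + w) = u v + u w,
    forall a v, u ((ofR a : K) *: v) = a * u v, forall x, u (j x) = f x &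
    forall v, `|u v| <= reS `|v|].
Proof.
move=> jn fD fZ fle.
pose V := real_module Y; pose U := real_module X.
have fL : scalar (f : U -> R) by move=> a x y; rewrite fD fZ.
have jL : linear (j : U -> V) by move=> a x y; exact: linearP.
pose F : {scalar U} := HB.pack (f : U -> R) (GRing.isLinear.Build R U R *%R f fL).
pose J : {linear U -> V} := HB.pack (j : U -> V) (GRing.isLinear.Build R U V *:%R (j : U -> V) jL).
pose p (v : V) : R := reS `|v : Y|.
have pD (v w : V) : setT v -> setT w -> p (v + w) <= p v + p w.
  by move=> _ _; rewrite /p -(@ofR_le _ K) rmorphD !ofR_norm_id ler_normD.
have pZ a (v : V) : 0 <= a -> setT v -> p (a *: v) = a * p v.
  move=> a0 _; apply: (can_inj (@ofRK _ K)); rewrite /p rmorphM !ofR_norm_id.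
  by rewrite [X in `|X|](_ : _ = (ofR a : K) *: (v : Y))// normrZ norm_ofR ger0_norm.
have Fp (x : U) : setT (J x) -> F x <= p (J x).
  by move=> _; rewrite /p [X in `|X|](_ : _ = j x)// jn; exact: fle.
have [g [gD gZ gj gle]] := @hahn_banach R V setT p I (fun _ _ _ _ => I)
  (fun _ _ _ => I) pD pZ U J F Fp.
exists g; split=> // v; rewrite ler_norml lerNl gle// andbT.
have := gle ((-1) *: (v : V)) I; rewrite gZ mulN1r => /le_trans; apply.
by rewrite /p (_ : -1 *: (v : V) = - (v : Y)) ?normrN//; exact: (scaleN1r (v : V)).
Qed.

(* Holds for both [sphere_poly] and [ball_poly], whose elements are determined,
   norm included, by their restrictions to the sphere. *)
Record sphere_model (R : realType) (K : scalars R) n d (X : normedModType K)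
    (ev : X -> sphere R n -> K) : Prop := SphereModel {
  smP : forall a x x' y, ev (a *: x + x') y = a * ev x y + ev x' y;
  sm_poly : forall x, ev x \in is_hpoly (fun y : sphere R n => val y) d;
  sm_surj : forall f, f \in is_hpoly (fun y : sphere R n => val y) d ->
    exists x, ev x = f;
  sm_le : forall x y, reS `|ev x y| <= reS `|x|;
  sm_ge : forall x M, 0 <= M -> (forall y, reS `|ev x y| <= M) -> reS `|x| <= M
}.

Section sphere_model_theory.
Variables (R : realType) (K : scalars R) (n d : nat) (X : normedModType K).
Variable ev : X -> sphere R n -> K.
Hypothesis hev : sphere_model d ev.

Lemma smD x x' y : ev (x + x') y = ev x y + ev x' y.
Proof. by have := smP hev 1 x x' y; rewrite scale1r mul1r. Qed.

Lemma sm0 y : ev 0 y = 0.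
Proof. by have := smP hev (-1) 0 0 y; rewrite scaler0 addr0 mulN1r addNr. Qed.

Lemma smZ a x y : ev (a *: x) y = a * ev x y.
Proof. by have := smP hev a x 0 y; rewrite addr0 sm0 addr0. Qed.

Lemma sm_inj x x' : (forall y, ev x y = ev x' y) -> x = x'.
Proof.
move=> h; apply/eqP; rewrite -subr_eq0 -normr_le0 -ofR_norm_id -(rmorph0 ofR) ofR_le.
apply: (sm_ge hev) => // y; have -> : ev (x - x') y = 0.
  by have := smP hev (-1) x' x y; rewrite scaleN1r addrC mulN1r => ->; rewrite h addNr.
by rewrite -(@ofR_le _ K) ofR_norm normr0 rmorph0.
Qed.

End sphere_model_theory.

Lemma dotX (R : realType) n k (x g : nat -> R) :
  dot n x g ^+ k =
  \sum_(w : {ffun 'I_k -> 'I_n}) (\prod_(j < k) x (w j)) * \prod_(j < k) g (w j).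
Proof.
rewrite -[LHS](_ : \prod_(j < k) dot n x g = _); last by rewrite prodr_const card_ord.
rewrite (bigA_distr_bigA (fun _ (i : 'I_n) => x i * g i)).
by apply: eq_bigr => w _; rewrite big_split.
Qed.

Lemma hermite_dotE (R : realType) n d (x g : nat -> R) :
  hermite d (dot n x g) = \sum_(m < d./2.+1) \sum_(w : {ffun 'I_(d - m.*2) -> 'I_n})
    hcoef R d m * (\prod_(j < d - m.*2) x (w j)) * \prod_(j < d - m.*2) g (w j).
Proof.
rewrite (@hermiteE _ d./2.+1)//; apply: eq_bigr => m _.
by rewrite dotX mulr_sumr; apply: eq_bigr => w _; rewrite mulrA.
Qed.

Lemma double_le_half (d : nat) (m : 'I_d./2.+1) : (m.*2 <= d)%N.
Proof.
by rewrite -[leqRHS]odd_double_half (leq_trans _ (leq_addl _ _))// leq_double -ltnS.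
Qed.

Section upper_bound.
Variables (R : realType) (K : scalars R) (re : K -> R) (n d : nat).
Hypothesis hre : real_part re.
Variables (X : normedModType K) (ev : X -> sphere R n -> K).
Hypothesis hev : sphere_model d ev.
Variable e : sphere R n.

Section extension.
Variables (Y : normedModType K) (j : {linear X -> Y}).
Hypothesis jn : forall x, `|j x| = `|x|.
Variable u : sphere R n -> Y -> R.
Hypothesis uD : forall y v w, u y (v + w) = u y v + u y w.
Hypothesis uZ : forall y a v, u y ((ofR a : K) *: v) = a * u y v.
Hypothesis uj : forall y x, u y (j x) = re (ev x y).
Hypothesis u_le : forall y v, `|u y v| <= reS `|v|.

(** The real part at [y] of the projection of [v]; a scalar z in front of the projection is moved
    onto [v]. *)
Let avg (v : Y) (y : sphere R n) : R := d`!%:R^-1 *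
  gmeann n (fun g => radius n g ^+ d * u (polar e g) v * hermite d (dot n (crd y) g)).

(** Expanding He_d(<y, g>) over words makes the mean a finite combination of monomials in y of
    degrees d - 2m, all of them d-homogeneous on the sphere. *)
Lemma hermite_average_poly v : exists x, forall z y, re (z * ev x y) = avg (z *: v) y.
Proof.
pose l m (w : {ffun 'I_(d - m.*2) -> 'I_n}) v := gmeann n (fun g =>
  radius n g ^+ d * u (polar e g) v * \prod_(i < d - m.*2) g (w i)).
(* For fixed [v], each real coefficient is R-linear in z, hence equal to re (z c): this c is the
   coefficient in [K]. *)
have /(_ _)/cid-/all_sig[c hc] (i : {m : nat & {ffun 'I_(d - m.*2) -> 'I_n}}) :
    exists c, forall z, l (tag i) (tagged i) (z *: v) = re (z * c).
  apply: (rp_riesz hre) => [z z'|a z].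
    rewrite -gmeannD; congr gmeann; apply/funext => g.
    by rewrite scalerDl uD mulrDr mulrDl.
  rewrite -gmeannZ; congr gmeann; apply/funext => g.
  by rewrite -scalerA uZ -!mulrA mulrCA.
pose f (y : sphere R n) : K := \sum_(m < d./2.+1) \sum_(w : {ffun 'I_(d - m.*2) -> 'I_n})
  ofR (d`!%:R^-1 * hcoef R d m * \prod_(i < d - m.*2) crd y (w i)) *
  c (existT _ (m : nat) w).
have fP : f \in is_hpoly (fun y : sphere R n => val y) d.
  rewrite -[f](_ : \sum_(m < d./2.+1) \sum_(w : {ffun 'I_(d - m.*2) -> 'I_n}) (fun y : sphere R n =>
    ofR (d`!%:R^-1 * hcoef R d m * \prod_(i < d - m.*2) crd y (w i)) *
    c (existT _ (m : nat) w)) = _).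
    apply: rpred_sum => m _; apply: rpred_sum => w _.
    apply: spoly_ofR; apply: spolyZ.
    apply: (@spoly_monomial R n d m); apply: subnKC; exact: double_le_half.
  by apply/funext => y; rewrite fct_sumE; apply: eq_bigr => m _; rewrite fct_sumE.
have [x xf] := sm_surj hev fP; exists x => z y.
rewrite xf /f mulr_sumr (rp_sum hre) /avg.
under [in RHS]eq_fun do rewrite hermite_dotE mulr_sumr.
rewrite gmeann_sum mulr_sumr; apply: eq_bigr => m _.
rewrite mulr_sumr (rp_sum hre).
under [in RHS]eq_fun do rewrite mulr_sumr.
rewrite gmeann_sum mulr_sumr; apply: eq_bigr => w _.
rewrite mulrCA (rpZ hre) -hc -mulrA -mulrA; congr (_ * _).
rewrite -gmeannZ; congr gmeann; apply/funext => g /=.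
exact: mulrCA.
Qed.

(** On the image of X the functionals are evaluations, and the mean is the reproducing formula for
    the real polynomial re (z f). *)
Lemma avg_reproduces x z y : avg (z *: j x) y = re (z * ev x y).
Proof.
have [p hp [ep rp]] := spoly_radial (spoly_re hre z (sm_poly hev x)).
rewrite /avg -linearZ /= ep.
under eq_fun do rewrite uj (smZ hev) (rp e).
rewrite gmeann_reproducing ?nrm2_crd// mulKf// pnatr_eq0 -lt0n fact_gt0.
Qed.

Lemma avg_le C v y :
  d`!%:R^-1 * gmeann n (fun g => radius n g ^+ d * `|hermite d (dot n (crd y) g)|) <= C ->
  avg v y <= C * reS `|v|.
Proof.
move=> hC; have v0 : 0 <= reS `|v| by rewrite -(@ofR_le _ K) rmorph0 ofR_norm_id.
rewrite (le_trans _ (ler_wpM2r v0 hC))// -mulrA ler_wpM2l ?invr_ge0//.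
rewrite -gmeannZr.
have gr : growth n (fun g => radius n g ^+ d * `|hermite d (dot n (crd y) g)| * reS `|v|).
  apply: growthM; last exact: growth_cst.
  apply: growthM; first by apply: growthX; exact: growth_sqrt_nrm2.
  by apply/growth_norm/growth_comp; [exact: (mpg_hermite R d).2|exact: growth_dot].
have le g : `|radius n g ^+ d * u (polar e g) v * hermite d (dot n (crd y) g)| <=
    radius n g ^+ d * `|hermite d (dot n (crd y) g)| * reS `|v|.
  rewrite !normrM (ger0_norm (exprn_ge0 _ (radius_ge0 _ _))) mulrAC.
  by rewrite ler_wpM2l// mulr_ge0// exprn_ge0// radius_ge0.
apply: gmeann_le => //; last by move=> g; rewrite (le_trans (ler_norm _))//.
by apply: growth_le gr _ => g; rewrite (le_trans (le g))// ler_norm.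
Qed.

End extension.

Lemma proj_const_in_le (Y : normedModType K) (j : {linear X -> Y}) (C : R) :
  (forall x, `|j x| = `|x|) -> 0 <= C ->
  (forall y : sphere R n,
    d`!%:R^-1 * gmeann n (fun g => radius n g ^+ d * `|hermite d (dot n (crd y) g)|) <= C) ->
  (proj_const_in j <= C%:E)%E.
Proof.
move=> jn C0 hC.
have /choice[u hu] (y : sphere R n) := @hahn_banach_norm _ _ _ _ j (fun x => re (ev x y)) jn
  (fun x x' => etrans (congr1 re (smD hev x x' y)) (rpD hre _ _))
  (fun a x => etrans (congr1 re (smZ hev (ofR a) x y)) (rpZ hre _ _))
  (fun x => le_trans (rp_le hre _) (sm_le hev x y)).
have uD y v w : u y (v + w) = u y v + u y w by case: (hu y).
have uZ y a v : u y ((ofR a : K) *: v) = a * u y v by case: (hu y).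
have uj y x : u y (j x) = re (ev x y) by case: (hu y).
have u_le y v : `|u y v| <= reS `|v| by case: (hu y).
have /choice[S hS] := hermite_average_poly uD uZ.
have eqS x x' : (forall z y, re (z * ev x y) = re (z * ev x' y)) -> x = x'.
  by move=> h; apply: (sm_inj hev) => y; apply: (rp_inj hre) => z.
have Sj x : S (j x) = x.
  by apply: eqS => z y; rewrite hS (avg_reproduces uj).
(* [S] comes from choice, but its values are determined by the real parts re (z .) for all z.
   Absorbing [a] into z yields linearity over [K], although each [u y] is only R-linear. *)
have SL : linear S.
  move=> a v w; apply: eqS => z y.
  rewrite (smP hev) mulrDr (rpD hre) mulrA !hS scalerDr scalerA -mulrDr -gmeannD.
  congr (_ * _); congr gmeann; apply/funext => g.
  by rewrite uD mulrDr mulrDl.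
have S_le v : reS `|S v| <= C * reS `|v|.
  have v0 : 0 <= reS `|v| by rewrite -(@ofR_le _ K) rmorph0 ofR_norm_id.
  apply: (sm_ge hev) => [|y]; first exact: mulr_ge0.
  apply: (rp_norming hre) => z; rewrite hS (le_trans (avg_le u_le _ (hC y)))//.
  rewrite -mulrA ler_wpM2l// -(@ofR_le _ K) rmorphM !ofR_norm_id normrZ.
  by rewrite mulrC.
have PL : linear (j \o S) by move=> a v w; rewrite /= SL linearP.
pose P : {linear Y -> Y} := HB.pack (j \o S) (GRing.isLinear.Build K Y Y *:%R (j \o S) PL).
apply: (@le_trans _ _ (opnorm P)).
  apply: ereal_inf_lbound; exists P => //; split.
  - apply: bounded_linear_continuous; apply/linear_boundedP.
    exists (ofR C); split; first by rewrite realE -(rmorph0 ofR) ofR_le C0.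
    move=> r Cr v; rewrite jn -ofR_norm_id (le_trans _ (ler_wpM2r (normr_ge0 _) (ltW Cr)))//.
    by rewrite -[`|v|]ofR_norm_id -rmorphM ofR_le.
  - by move=> v; rewrite /= Sj.
  - apply/seteqP; split=> [_ [v _ <-]|_ [x _ <-]]; first by exists (S v).
    by exists (j x) => //=; rewrite Sj.
apply: ge_ereal_sup => _ [v v1 <-]; rewrite lee_fin /= jn (le_trans (S_le v))//.
rewrite ler_piMr// -(@ofR_le _ K) ofR_norm_id rmorph1; exact: v1.
Qed.

Lemma proj_const_le (C : R) : 0 <= C -> (forall y : sphere R n,
    d`!%:R^-1 * gmeann n (fun g => radius n g ^+ d * `|hermite d (dot n (crd y) g)|) <= C) ->
  (proj_const X <= C%:E)%E.
Proof.
by move=> C0 hC; apply: ge_ereal_sup => _ [Y [j [jn ->]]]; exact: proj_const_in_le.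
Qed.

End upper_bound.

(** * Lower bound *)

Section projection_on_polynomials.
Variable R : realType.
Implicit Types (psi : R -> R) (d k : nat).

Lemma moment_odd k : odd k -> moment R k = 0.
Proof.
have [m] := ubnP k; elim: m k => // m ih [//|[_ _|k]].
  by rewrite momentS mul0r.
rewrite !ltnS => km /=; rewrite negbK => ok.
by rewrite momentS /= ih ?mulr0// ltnW.
Qed.

Lemma pmean_odd n k (p : mpoly n R) : p \is ishomog1 k mdeg -> odd k -> pmean p = 0.
Proof.
move=> /dhomogP hp ok; rewrite (mpolyE p) pmean_sum big_seq big1// => m /hp /= mk.
rewrite pmeanZ pmeanX.
have [i oi] : exists i, odd (m i).
  apply/existsP; apply: contraTT ok; rewrite negb_exists => /forallP h.
  rewrite -mk mdegE; apply: (big_ind (fun x => ~~ odd x)) => [//|x y|i _]; last exact: h.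
  by rewrite oddD => /negbTE -> /negbTE ->.
by rewrite (bigD1 i)//= moment_odd// mul0r mulr0.
Qed.

Definition hmoment k d : R := gmean (fun t => t ^+ k * hermite d t).

Lemma hmomentSS k d :
  hmoment k d.+2 = hmoment k.+1 d.+1 - d.+1%:R * hmoment k d.
Proof.
rewrite /hmoment -gmeanZ -gmeanN -gmeanD; congr gmean; apply/funext => t.
by rewrite hermiteS exprS; ring.
Qed.

(** Integration by parts against He_(d+1), obtained from the recurrences alone; these link three
    consecutive degrees, so the induction carries two. *)
Lemma hmomentS k d : hmoment k d.+1 = k%:R * hmoment k.-1 d.
Proof.
suff h : (forall k, hmoment k d.+1 = k%:R * hmoment k.-1 d) /\
    (forall k, hmoment k d.+2 = k%:R * hmoment k.-1 d.+1) by case: h.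
elim: d {k} => [|d [ih1 ih2]].
  have e j : hmoment j 1 = hmoment j.+1 0.
    rewrite /hmoment; congr gmean; apply/funext => t.
    by rewrite hermite1 hermite0 mulr1 -exprSr.
  have e1 k : hmoment k 1 = k%:R * hmoment k.-1 0.
    rewrite e /hmoment; under eq_fun do rewrite hermite0 mulr1.
    by under [in RHS]eq_fun do rewrite hermite0 mulr1; exact: momentS.
  split=> [//|k]; rewrite hmomentSS e1 -pred_Sn.
  case: k => [|k]; first by rewrite !mul0r mul1r subrr.
  by rewrite -pred_Sn e -[k.+2%:R]natr1; ring.
split=> // k; rewrite hmomentSS ih2 -pred_Sn.
case: k => [|k]; first by rewrite ih1 !mul0r !mulr0 subrr.
rewrite -pred_Sn (hmomentSS k) ih1 -pred_Sn -[k.+2%:R]natr1 -[d.+2%:R]natr1; ring.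
Qed.

Lemma hmoment_lt k d : (k < d)%N -> hmoment k d = 0.
Proof.
elim: d k => [//|d ih] [|k] kd; first by rewrite hmomentS mul0r.
by rewrite hmomentS ih ?mulr0.
Qed.

Lemma hmoment_diag d : hmoment d d = d`!%:R.
Proof.
elim: d => [|d ih]; last by rewrite hmomentS ih factS natrM.
rewrite /hmoment fact0 -[RHS](gmean_cst (1 : R)); congr gmean; apply/funext => t.
by rewrite hermite0 mulr1.
Qed.

(** The projection of [psi] in the Gaussian inner product, built degree by degree by subtracting a
    Hermite component. *)
Lemma poly_projection psi d : exists2 r : {poly R}, (size r <= d.+1)%N &
  forall k, (k <= d)%N -> gmean (fun t => (psi t - r.[t]) * t ^+ k) = 0.
Proof.
elim: d => [|d [r sr hr]].
  exists (gmean psi)%:P; first exact: (leq_trans (size_polyC_leq1 _)).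
  move=> k; rewrite leqn0 => /eqP ->.
  under eq_fun do rewrite hornerC expr0 mulr1.
  by rewrite gmeanD gmeanN gmean_cst subrr.
have [h sh hE] : exists2 h : {poly R}, (size h <= d.+2)%N & forall t, h.[t] = hermite d.+1 t.
  exists (\sum_(m < d.+1./2.+1) hcoef R d.+1 m *: 'X^(d.+1 - m.*2)).
    apply: (leq_trans (size_sum _ _ _)); apply/bigmax_leqP => m _.
    by rewrite (leq_trans (size_scale_leq _ _))// size_polyXn ltnS leq_subr.
  move=> t; rewrite horner_sum (@hermiteE _ d.+1./2.+1)//.
  by apply: eq_bigr => m _; rewrite hornerZ hornerXn.
(* He_(d+1) is orthogonal to the lower powers, so the previous conditions survive; its pairing with
   t^(d+1) is (d+1)!, which fixes the coefficient. *)
pose c := gmean (fun t => (psi t - r.[t]) * t ^+ d.+1) / d.+1`!%:R.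
exists (r + c *: h).
  rewrite (leq_trans (size_polyD _ _))// geq_max (leq_trans sr)//=.
  exact: leq_trans (size_scale_leq _ _) sh.
move=> k kd.
have -> : (fun t => (psi t - (r + c *: h).[t]) * t ^+ k) =
    fun t => (psi t - r.[t]) * t ^+ k - c * (t ^+ k * hermite d.+1 t).
  by apply/funext => t; rewrite hornerD hornerZ hE; ring.
rewrite gmeanD gmeanN gmeanZ -/(hmoment _ _).
move: kd; rewrite leq_eqVlt => /predU1P[->|kd]; last first.
  by rewrite hr// hmoment_lt// mulr0 subrr.
by rewrite hmoment_diag divfK ?subrr// pnatr_eq0 -lt0n fact_gt0.
Qed.

End projection_on_polynomials.

Section trace.
Variables (R : realType) (n d : nat) (psi : R -> R).
Hypotheses (cpsi : continuous psi) (mpsi : mpg psi).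
Implicit Types (y e : sphere R n) (g h : nat -> R).

(* Only the projection of [psi] on the polynomials of degree at most [d]
   contributes, and its monomials of the wrong parity have mean zero. *)
Lemma spoly_average m (w : 'I_(d - m.*2) -> 'I_n) : (m.*2 <= d)%N ->
  spoly d (fun y => gmeann n (fun g =>
    nrm2 n g ^+ m * \prod_(j < d - m.*2) g (w j) * psi (dot n (crd y) g))).
Proof.
move=> md; pose p := radial_monomial R m w.
have hp : p \is ishomog1 d mdeg.
  by rewrite -[X in ishomog1 X](subnKC md) radial_monomial_homog.
have pE g : meval (fun i : 'I_n => g i) p = nrm2 n g ^+ m * \prod_(j < d - m.*2) g (w j).
  exact: meval_radial_monomial.
move: p hp pE => p hp pE.
have [r sr hr] := poly_projection psi d.
have cr : continuous (fun t : R => r.[t]) by exact: continuous_horner.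
pose phi t := psi t - r.[t].
have cphi : continuous phi.
  apply: continuous_addR => // t; apply: cvgN; exact: cr.
have mphi : mpg phi by apply: mpgD => //; apply/mpgN/mpg_horner.
have -> : (fun y => gmeann n (fun g => nrm2 n g ^+ m *
      \prod_(j < d - m.*2) g (w j) * psi (dot n (crd y) g))) =
    fun y => \sum_(k < d.+1) \sum_(v : {ffun 'I_k -> 'I_n})
      r`_k * pmean (p * \prod_(j < k) mpolyX R (mnm1 (v j))) *
      \prod_(j < k) crd y (v j).
  apply/funext => y.
  have := @gmeann_orthogonal R n d (crd y) phi p cphi mphi hp.
  have ort k : (k <= d)%N -> gint (fun t => phi t * t ^+ k) = 0.
    by move=> kd; rewrite -gmeanE ?hr//; apply: mpgM => //; exact: mpgX.
  move=> /(_ ort (nrm2_crd y)) E.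
  have -> : (fun g => nrm2 n g ^+ m * \prod_(j < d - m.*2) g (w j) *
      psi (dot n (crd y) g)) =
    fun g => phi (dot n (crd y) g) * meval (fun i : 'I_n => g i) p +
      r.[dot n (crd y) g] * meval (fun i : 'I_n => g i) p.
    by apply/funext => g; rewrite pE /phi; ring.
  rewrite gmeannD E add0r.
  under eq_fun do rewrite (horner_coef_wide _ sr) mulr_suml.
  rewrite gmeann_sum; apply: eq_bigr => k _.
  under eq_fun do rewrite dotX -mulrA mulr_suml mulr_sumr.
  rewrite gmeann_sum; apply: eq_bigr => v _.
  rewrite mulrAC -gmeannZ; congr gmeann; apply/funext => g.
  have -> : meval (fun i : 'I_n => g i) (p * \prod_(j < k) mpolyX R (mnm1 (v j))) =
      meval (fun i : 'I_n => g i) p * \prod_(j < k) g (v j).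
    rewrite mevalM rmorph_prod; congr (_ * _).
    by apply: eq_bigr => i _; rewrite /= mevalXU.
  by move: (\prod_(_ < k) crd _ _) (\prod_(_ < k) g _) (meval _ p) => a b c; ring.
apply: spoly_sum => k _; apply: spoly_sum => v _.
have [ok|ek] := boolP (odd (d + k)).
  rewrite [X in spoly _ X](_ : _ = fun=> 0); first exact: spoly0.
  apply/funext => y; rewrite (@pmean_odd _ _ (d + k))// ?mulr0 ?mul0r//.
  apply: dhomogM => //.
  by have := radial_monomial_homog R 0 v; rewrite /radial_monomial expr0 mul1r.
apply: spolyZ.
apply: (@spoly_monomial R n d (d - k)./2).
by rewrite even_halfK ?subnK -1?ltnS// oddB -1?ltnS// -oddD.
Qed.

End trace.

Section lower_bound.
Variables (R : realType) (n d : nat) (psi : R -> R).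
Hypotheses (cpsi : continuous psi) (mpsi : mpg psi) (psi1 : forall t, `|psi t| <= 1).
Hypothesis lpsi : lipgrowth n (fun g (y : sphere R n) => psi (dot n (crd y) g)).
Variables (B : (sphere R n -> R) -> sphere R n -> R) (C : R).
Hypothesis C0 : 0 <= C.
Hypothesis BD : forall f f' y, bfun f -> bfun f' ->
  B (fun y => f y + f' y) y = B f y + B f' y.
Hypothesis BZ : forall a f y, bfun f -> B (fun y => a * f y) y = a * B f y.
Hypothesis B_le : forall M f, bounded_by M f -> bounded_by (C * M) (B f).
Hypothesis B_poly : forall f, bfun f -> spoly d (B f).
Hypothesis B_id : forall f, spoly d f -> B f = f.
Variable e : sphere R n.
Implicit Types (y : sphere R n) (g h : nat -> R).

Let ridge g y : R := psi (dot n (crd y) g).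

Let bridge g : bfun (ridge g).
Proof. by exists 1 => y; exact: psi1. Qed.

Let a m (w : 'I_(d - m.*2) -> 'I_n) g : R :=
  nrm2 n g ^+ m * \prod_(j < d - m.*2) g (w j).

Let b m (w : 'I_(d - m.*2) -> 'I_n) g : R := \prod_(j < d - m.*2) g (w j).

(** Coefficient functionals of [B]: by the reproducing formula, d! |g|^d B f(g/|g|) is the sum of
    the [hcoef R d m * (a w g * q w f)]. *)
Let q m (w : 'I_(d - m.*2) -> 'I_n) (f : sphere R n -> R) : R :=
  gmeann n (fun h => radius n h ^+ d * B f (polar e h) * b w h).

Let growth_radius k : growth n (fun g => radius n g ^+ k).
Proof. by apply: growthX; exact: growth_sqrt_nrm2. Qed.

Let growth_b m (w : 'I_(d - m.*2) -> 'I_n) : growth n (b w).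
Proof. by apply: growth_prod => j _; exact: growth_coord. Qed.

Let bfq m (w : 'I_(d - m.*2) -> 'I_n) : bounded_functional (q w).
Proof.
pose D := gmeann n (fun h => radius n h ^+ d * `|b w h|).
have gD : growth n (fun h => radius n h ^+ d * `|b w h|).
  by apply: growthM => //; exact: growth_norm.
have rb0 h : 0 <= radius n h ^+ d * `|b w h|.
  by rewrite mulr_ge0// exprn_ge0// radius_ge0.
split=> [f f' bf bf'|c f bf|].
- rewrite /q -gmeannD; congr gmeann; apply/funext => h.
  by rewrite BD// mulrDr mulrDl.
- rewrite /q -gmeannZ; congr gmeann; apply/funext => h.
  by rewrite BZ// -!mulrA mulrCA.
exists (C * D); first by rewrite mulr_ge0// gmeann_ge0.
move=> M f fM; rewrite mulrAC /D -gmeannZ.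
have le h : `|radius n h ^+ d * B f (polar e h) * b w h| <=
    C * M * (radius n h ^+ d * `|b w h|).
  rewrite !normrM (ger0_norm (exprn_ge0 _ (radius_ge0 _ _))) mulrAC mulrC.
  by rewrite ler_wpM2r// B_le.
have gr : growth n (fun h => C * M * (radius n h ^+ d * `|b w h|)).
  by apply: growthM => //; exact: growth_cst.
apply: gmeann_norm_le => //.
by apply: growth_le gr _ => h; rewrite (le_trans (le h))// ler_norm.
Qed.

Let lip_a m (w : 'I_(d - m.*2) -> 'I_n) : lipgrowth n (fun g (_ : sphere R n) => a w g).
Proof.
apply: lipgrowthM.
  apply: lipgrowthX; apply: lipgrowth_sum => i.
  by apply: lipgrowthX; exact: lipgrowth_coord.
by apply: lipgrowth_prod => j; exact: lipgrowth_coord.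
Qed.

(** Since d and d - 2m have the same parity, the homogenised kernel is a polynomial in g: the square
    roots and the junk direction at 0 disappear, and the Lipschitz condition of the exchange
    holds. *)
Lemma radius_hermite_polar g h :
  radius n g ^+ d * hermite d (dot n (crd (polar e g)) h) =
  \sum_(m < d./2.+1) hcoef R d m * (nrm2 n g ^+ m * dot n g h ^+ (d - m.*2)).
Proof.
rewrite (@hermiteE _ d./2.+1)// mulr_sumr; apply: eq_bigr => m _.
rewrite (dot_polarl e g h) exprMn -radius_sqr -exprM mul2n.
by rewrite [X in _ = _ * X]mulrA -exprD subnKC ?double_le_half// mulrCA.
Qed.

(** This plays the role of a trace: [Phi_le] bounds it through the norm of [B], and [trace_formula]
    gives it a value independent of [B]. *)
Let Phi : R := gmeann n (fun g => radius n g ^+ d * B (ridge g) (polar e g)).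

Let Phi_le : Phi <= C * gmeann n (fun g => radius n g ^+ d).
Proof.
rewrite -gmeannZ.
have gr : growth n (fun g => C * radius n g ^+ d).
  by apply: growthM => //; exact: growth_cst.
have le g : `|radius n g ^+ d * B (ridge g) (polar e g)| <= C * radius n g ^+ d.
  rewrite normrM (ger0_norm (exprn_ge0 _ (radius_ge0 _ _))) mulrC.
  rewrite ler_wpM2r ?exprn_ge0 ?radius_ge0// -[C]mulr1.
  by apply: B_le => y; exact: psi1.
apply: gmeann_le => // [|g]; last by rewrite (le_trans (ler_norm _)).
by apply: growth_le gr _ => g; rewrite (le_trans (le g))// ler_norm.
Qed.

Let inner m (y : sphere R n) : R := gmeann n (fun g =>
  nrm2 n g ^+ m * (dot n (crd y) g ^+ (d - m.*2) * psi (dot n (crd y) g))).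

(* The trace of [B]: expanding the reproducing kernel in [B (ridge g)], each
   coefficient functional [q w] commutes with the mean over [g] and then only
   sees [B] on polynomials, where it is the identity. *)
Lemma trace_formula : d`!%:R * Phi =
  \sum_(m < d./2.+1) hcoef R d m *
    gmeann n (fun h => nrm2 n h ^+ (d - m) * inner m (polar e h)).
Proof.
have step1 g : d`!%:R * (radius n g ^+ d * B (ridge g) (polar e g)) =
    \sum_(m < d./2.+1) \sum_(w : {ffun 'I_(d - m.*2) -> 'I_n})
      hcoef R d m * (a w g * q w (ridge g)).
  have [p hp [ep rp]] := spoly_radial (B_poly (bridge g)).
  rewrite mulrCA ep -(gmeann_reproducing hp (nrm2_crd _)) -gmeannZ.
  have -> : (fun h => radius n g ^+ d * (meval (fun i : 'I_n => h i) p *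
        hermite d (dot n (crd (polar e g)) h))) =
      fun h => \sum_(m < d./2.+1) \sum_(w : {ffun 'I_(d - m.*2) -> 'I_n})
        hcoef R d m * a w g * (radius n h ^+ d * B (ridge g) (polar e h) * b w h).
    apply/funext => h; rewrite mulrCA radius_hermite_polar mulr_sumr -(rp e).
    apply: eq_bigr => m _; rewrite dotX !mulr_sumr; apply: eq_bigr => w _.
    rewrite /a /b; move: (B _ _) (\prod_(_ < _) g _) (\prod_(_ < _) h _) => x u v; ring.
  rewrite gmeann_sum; apply: eq_bigr => m _; rewrite gmeann_sum.
  by apply: eq_bigr => w _; rewrite gmeannZ mulrA.
rewrite /Phi -gmeannZ; under eq_fun do rewrite step1.
rewrite gmeann_sum; apply: eq_bigr => m _; rewrite gmeann_sum.
have step2 (w : 'I_(d - m.*2) -> 'I_n) :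
    gmeann n (fun g => a w g * q w (ridge g)) =
    q w (fun y => gmeann n (fun g => a w g * ridge g y)).
  have -> : (fun g => a w g * q w (ridge g)) = fun g => q w (fun y => a w g * ridge g y).
    by apply/funext => g; rewrite (bfZ (bfq w)).
  exact: (gmeann_exchange (bfq w) (lipgrowthM (lip_a w) lpsi)).
have step3 (w : 'I_(d - m.*2) -> 'I_n) :
    B (fun y => gmeann n (fun g => a w g * ridge g y)) =
    fun y => gmeann n (fun g => a w g * ridge g y).
  by apply: B_id; apply: spoly_average => //; exact: double_le_half.
under eq_bigr do rewrite gmeannZ step2 /q step3.
rewrite -mulr_sumr; congr (_ * _); rewrite -gmeann_sum; congr gmeann.
apply/funext => h.
have -> : nrm2 n h ^+ (d - m) * inner m (polar e h) =
    gmeann n (fun g => \sum_(w : {ffun 'I_(d - m.*2) -> 'I_n})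
      radius n h ^+ d * (a w g * ridge g (polar e h)) * b w h).
  rewrite /inner -gmeannZ; congr gmeann; apply/funext => g.
  (* The sum over words is reassembled into a power of <h, g>; its homogeneity leaves |h| with the
     exponent d + (d - 2m) = 2 (d - m). *)
  transitivity (radius n h ^+ d * dot n h g ^+ (d - m.*2) *
      (nrm2 n g ^+ m * ridge g (polar e h))).
    have -> : radius n h ^+ d * dot n h g ^+ (d - m.*2) =
        nrm2 n h ^+ (d - m) * dot n (crd (polar e h)) g ^+ (d - m.*2).
      rewrite (dot_polarl e h g) exprMn mulrA -exprD -radius_sqr -exprM.
      by rewrite addnBA ?double_le_half// addnn -doubleB mul2n.
    by rewrite /ridge; move: (_ ^+ m) (_ ^+ (d - m.*2)) => x y; ring.
  rewrite dotX mulr_sumr mulr_suml; apply: eq_bigr => w _.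
  rewrite /a /b; move: (\prod_(_ < _) h _) (\prod_(_ < _) g _) (nrm2 n g ^+ m) => x y z.
  ring.
rewrite gmeann_sum; apply: eq_bigr => w _.
by rewrite -gmeannZ -gmeannZr.
Qed.

(** In the trace formula, [inner m] is close to n^m E[Z^(d-2m) psi(Z)] uniformly on the sphere, and
    the outer mean contributes the moment [rho R n (d - m)]. To leading order the left side is n^d
    E[He_d(Z) psi(Z)]. *)
Lemma trace_lower_bound (tau : R) : (0 < n)%N -> 0 < tau ->
  \sum_(m < d./2.+1)
    (hcoef R d m * gint (fun t => t ^+ (d - m.*2) * psi t) -
     `|hcoef R d m| * ((tau * gint (fun t => (t ^+ (d - m.*2)) ^+ 2) + fluct R n m / tau) / 2))
    * (rho R n (d - m) * n%:R ^+ m) <=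
  d`!%:R * (C * (Num.sqrt n%:R ^+ d * ((rho R n d / n%:R ^+ d + 1) / 2))).
Proof.
move=> n0 tau0; apply: (@le_trans _ _ (d`!%:R * Phi)); last first.
  rewrite ler_wpM2l// (le_trans Phi_le)// ler_wpM2l//.
  exact: gmeann_normX_le.
rewrite trace_formula; apply: ler_sum => m _.
pose kap := gint (fun t => t ^+ (d - m.*2) * psi t).
pose err := (tau * gint (fun t => (t ^+ (d - m.*2)) ^+ 2) + fluct R n m / tau) / 2.
have hI y : `|inner m y - n%:R ^+ m * kap| <= n%:R ^+ m * err.
  exact: gmeann_trace_term (nrm2_crd y).
have err0 : 0 <= n%:R ^+ m * err := le_trans (normr_ge0 _) (hI e).
pose W := gmeann n (fun h => nrm2 n h ^+ (d - m) * inner m (polar e h)).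
have gN : growth n (fun h => nrm2 n h ^+ (d - m)).
  by apply: growthX; exact: growth_nrm2.
have hW : `|W - rho R n (d - m) * (n%:R ^+ m * kap)| <= rho R n (d - m) * (n%:R ^+ m * err).
  rewrite -!gmeann_nrm2X -!gmeannZr -gmeannB.
  have le h : `|nrm2 n h ^+ (d - m) * inner m (polar e h) -
      nrm2 n h ^+ (d - m) * (n%:R ^+ m * kap)| <= nrm2 n h ^+ (d - m) * (n%:R ^+ m * err).
    rewrite -mulrBr normrM ger0_norm ?exprn_ge0 ?nrm2_ge0//.
    by rewrite ler_wpM2l// exprn_ge0// nrm2_ge0.
  have gr : growth n (fun h => nrm2 n h ^+ (d - m) * (n%:R ^+ m * err)).
    by apply: growthM => //; exact: growth_cst.
  apply: gmeann_norm_le => //.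
  by apply: growth_le gr _ => h; rewrite (le_trans (le h))// ler_norm.
rewrite -/kap -/err -/W.
move: hW; rewrite ler_norml => /andP[h1 h2].
(* The coefficients alternate in sign: the lower or the upper estimate of [W] is used accordingly,
   and the error always enters as - |hcoef|. *)
have [c0|c0] := leP 0 (hcoef R d m).
  rewrite (ger0_norm c0) -mulrBr -mulrA ler_wpM2l//.
  by apply: le_trans (_ : rho R n (d - m) * (n%:R ^+ m * kap) -
    rho R n (d - m) * (n%:R ^+ m * err) <= _); [rewrite le_eqVlt; apply/orP; left; apply/eqP; ring|lra].
rewrite (ltr0_norm c0) mulNr opprK -mulrDr -mulrA ler_wnM2l ?(ltW c0)//.
apply: (@le_trans _ _ (rho R n (d - m) * (n%:R ^+ m * kap) +
    rho R n (d - m) * (n%:R ^+ m * err))); first by lra.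
by rewrite le_eqVlt; apply/orP; left; apply/eqP; ring.
Qed.

End lower_bound.

(** * From projections of the space of bounded functions to the trace estimate *)

Section lower_bound_banach.
Variables (R : realType) (K : scalars R) (re : K -> R) (n d : nat).
Hypothesis hre : real_part re.
Variables (X : normedModType K) (ev : X -> sphere R n -> K).
Hypothesis hev : sphere_model d ev.
Variable e : sphere R n.

Notation Y := (bounded_banach (sphere R n) hre).

Let ev_bounded x : ev x \in @is_bounded R K (sphere R n).
Proof. by apply/asboolP; exists (reS `|x|) => y; exact: sm_le hev x y. Qed.

Let j0 x : Y := BoundedFunction (ev_bounded x).

Let j0_linear : linear j0.
Proof. by move=> a x x'; apply/val_inj/funext => y; exact: (smP hev). Qed.

Let j : {linear X -> Y} := HB.pack j0 (GRing.isLinear.Build K X Y *:%R j0 j0_linear).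

Let normY_le (v : Y) (M : R) : 0 <= M ->
  (forall y, reS `|(v : bounded_function K _) y| <= M) -> reS `|v| <= M.
Proof. exact: bounded_norm_le. Qed.

Let le_normY (v : Y) y : reS `|(v : bounded_function K _) y| <= reS `|v|.
Proof. exact: bounded_fun_le_norm. Qed.

Let j_iso x : `|j x| = `|x|.
Proof.
have n0 (V : normedModType K) (v : V) : 0 <= reS `|v|.
  by rewrite -(@ofR_le _ K) rmorph0 ofR_norm_id.
rewrite -ofR_norm_id -[RHS]ofR_norm_id; congr (ofR _).
apply/eqP; rewrite eq_le normY_le ?n0//=; last by move=> y; exact: sm_le hev x y.
by apply: (sm_ge hev) => // y; exact: (le_normY (j x) y).
Qed.

Section projection.
Variables (P : {linear Y -> Y}) (C : R).
Hypotheses (PP : P \o P =1 P) (rP : range P = range j) (PC : (opnorm P <= C%:E)%E).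

Let P_le (v : Y) (M : R) : 0 <= M -> reS `|v| <= M -> reS `|P v| <= C * M.
Proof.
move=> M0 vM.
have le1 (w : Y) : `|w| <= 1 -> reS `|P w| <= C.
  move=> w1; rewrite -lee_fin; apply: le_trans PC.
  by apply: ereal_sup_ubound; exists w.
have C0 : 0 <= C.
  have := le1 0; rewrite linear0 normr0 -(rmorph0 ofR) ofRK; apply.
  by rewrite rmorph0 ler01.
apply: le_trans (ler_wpM2l C0 vM).
have [->|v0] := eqVneq v 0.
  by rewrite linear0 normr0 -(rmorph0 ofR) ofRK mulr0.
have nv : 0 < `|v| by rewrite normr_gt0.
have := le1 (`|v|^-1 *: v).
rewrite normrZ normfV normr_id mulVf ?gt_eqF// => /(_ (lexx _)).
rewrite linearZ /= normrZ normfV normr_id -(@ofR_le _ K) -(@ofR_le _ K (reS _)).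
rewrite rmorphM !ofR_norm_id -[X in ofR (reS X) <= _]ger0_norm; last first.
  by rewrite mulr_ge0// invr_ge0 ltW.
by rewrite ofR_norm ger0_norm ?mulr_ge0// ?invr_ge0 ?(ltW nv)// mulrC ler_pdivrMr.
Qed.

Let embed_proof (f : sphere R n -> R) :
  (if `[< bfun f >] then (fun y => ofR (f y)) else fun=> 0) \in
  @is_bounded R K (sphere R n).
Proof.
apply/asboolP; case: asboolP => [[M hM]|_]; last by exists (reS `|0 : K|).
by exists M => y; rewrite norm_ofR ofRK.
Qed.

Let embed f : Y := BoundedFunction (embed_proof f).

Let embedE f y : bfun f -> (embed f : bounded_function K _) y = ofR (f y).
Proof. by move=> bf; rewrite /embed /= asboolT. Qed.

(** Restricting to real functions and taking real parts does not increase the bound and still fixes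
    the real polynomials, so the trace argument is purely real even over C. *)
Let B f y : R := re ((P (embed f) : bounded_function K _) y).

Let bfun_spoly (f : sphere R n -> R) : spoly d f -> bfun f.
Proof.
move=> sf; have [x xf] := sm_surj hev (@spoly_ofR R n K d f 1 sf); exists (reS `|x|) => y.
have := sm_le hev x y.
by rewrite xf mulr1 norm_ofR ofRK.
Qed.

Lemma projection_trace_bound (psi : R -> R) (tau : R) :
  continuous psi -> mpg psi -> (forall t, `|psi t| <= 1) ->
  lipgrowth n (fun g (y : sphere R n) => psi (dot n (crd y) g)) ->
  (0 < n)%N -> 0 < tau ->
  \sum_(m < d./2.+1)
    (hcoef R d m * gint (fun t => t ^+ (d - m.*2) * psi t) -
     `|hcoef R d m| * ((tau * gint (fun t => (t ^+ (d - m.*2)) ^+ 2) + fluct R n m / tau) / 2))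
    * (rho R n (d - m) * n%:R ^+ m) <=
  d`!%:R * (C * (Num.sqrt n%:R ^+ d * ((rho R n d / n%:R ^+ d + 1) / 2))).
Proof.
move=> cpsi mpsi psi1 lpsi n0 tau0.
have C0 : 0 <= C.
  have n1 : reS `|0 : Y| <= 1.
    by rewrite normr0 -(rmorph0 ofR) ofRK ler01.
  have := P_le ler01 n1; rewrite mulr1; apply: le_trans.
  by rewrite -(@ofR_le _ K) rmorph0 ofR_norm_id.
apply: (@trace_lower_bound R n d psi cpsi mpsi psi1 lpsi B C C0) => //.
- move=> f f' y bf bf'; rewrite /B -(rpD hre); congr re.
  have -> : embed (fun y => f y + f' y) = embed f + embed f'.
    apply/val_inj/funext => z; rewrite [LHS]embedE ?rmorphD; last exact: bfunD.
    by rewrite [RHS](_ : _ = (embed f : bounded_function K _) z +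
      (embed f' : bounded_function K _) z)// !embedE.
  by rewrite linearD.
- move=> a f y bf; rewrite /B -(rpZ hre); congr re.
  have -> : embed (fun y => a * f y) = (ofR a : K) *: embed f.
    apply/val_inj/funext => z; rewrite [LHS]embedE ?rmorphM; last first.
      by apply: bfunM => //; exact: bfun_cst.
    by rewrite [RHS](_ : _ = ofR a * (embed f : bounded_function K _) z)// !embedE.
  by rewrite linearZ.
- move=> M f fM y.
  have M0 : 0 <= M := le_trans (normr_ge0 _) (fM e).
  rewrite (le_trans (rp_norm_le hre _))// (le_trans (le_normY _ _))//.
  apply: P_le => //; apply: normY_le => // z.
  by rewrite embedE ?norm_ofR ?ofRK//; exists M.
- move=> f bf.
  have [x _ xf] : range j (P (embed f)) by rewrite -rP; exists (embed f).
  have -> : B f = fun y => re (1 * ev x y).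
    by apply/funext => y; rewrite /B -xf mul1r.
  exact: (spoly_re hre 1 (sm_poly hev x)).
- move=> f sf; apply/funext => y.
  have [x xf] := sm_surj hev (@spoly_ofR R n K d f 1 sf).
  have ex : embed f = j x.
    apply/val_inj/funext => z; rewrite [LHS]embedE; last exact: bfun_spoly.
    by rewrite [RHS](_ : _ = ev x z)// xf mulr1.
  have [w _ wx] : range P (j x) by rewrite rP; exists x.
  have Px : P (embed f) = embed f by rewrite ex -wx; exact: PP.
  by rewrite /B Px embedE ?(rp_ofR hre)//; exact: bfun_spoly.
Qed.

End projection.

Lemma proj_const_ge (psi : R -> R) (tau : R) :
  continuous psi -> mpg psi -> (forall t, `|psi t| <= 1) ->
  lipgrowth n (fun g (y : sphere R n) => psi (dot n (crd y) g)) ->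
  (0 < n)%N -> 0 < tau ->
  (((\sum_(m < d./2.+1)
    (hcoef R d m * gint (fun t => t ^+ (d - m.*2) * psi t) -
     `|hcoef R d m| * ((tau * gint (fun t => (t ^+ (d - m.*2)) ^+ 2) + fluct R n m / tau) / 2))
    * (rho R n (d - m) * n%:R ^+ m)) /
  (d`!%:R * (Num.sqrt n%:R ^+ d * ((rho R n d / n%:R ^+ d + 1) / 2))))%:E <=
  proj_const X)%E.
Proof.
move=> cpsi mpsi psi1 lpsi n0 tau0.
have D0 : 0 < d`!%:R * (Num.sqrt n%:R ^+ d * ((rho R n d / n%:R ^+ d + 1) / 2)).
  rewrite mulr_gt0 ?ltr0n ?fact_gt0// mulr_gt0 ?exprn_gt0 ?sqrtr_gt0 ?ltr0n//.
  rewrite divr_gt0// ltr_wpDl// divr_ge0 ?exprn_ge0//.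
  by rewrite prodr_ge0.
apply: le_ereal_sup_tmp; exists (proj_const_in j); first by exists Y, j.
apply: le_ereal_inf_tmp => _ [P [_ PP rP] <-].
have := @projection_trace_bound P _ PP rP _ psi tau cpsi mpsi psi1 lpsi n0 tau0.
(* An infinite norm makes the bound trivial, and the value at 0 excludes -oo. *)
case E : (opnorm P) => [r| |] h; last 2 first.
- by rewrite leey.
- have : ((reS `|P 0|)%:E <= opnorm P)%E.
    by apply: ereal_sup_ubound; exists 0 => //; rewrite /= normr0 ler01.
  by rewrite E.
rewrite lee_fin ler_pdivrMr// mulrCA; apply: h.
by rewrite lexx.
Qed.

End lower_bound_banach.

(** * A Lipschitz approximation of the sign *)

Section clip.
Variable R : realType.

Definition clip (x : R) : R := Num.max (-1) (Num.min 1 x).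

Lemma clip_le1 x : `|clip x| <= 1.
Proof.
rewrite /clip ler_norml le_max lexx /= ge_max ge_min lexx /= andbT; lra.
Qed.

Lemma clip_lipschitz x y : `|clip x - clip y| <= `|x - y|.
Proof.
have c z : [\/ z <= -1 /\ clip z = -1, 1 <= z /\ clip z = 1 | (-1 <= z <= 1) /\ clip z = z].
  rewrite /clip; have /orP[z1|z1] := le_total 1 z.
    by apply: Or32; split=> //; rewrite min_l// max_r//; lra.
  have /orP[z2|z2] := le_total z (-1).
    by apply: Or31; split=> //; rewrite min_r// max_l.
  by apply: Or33; rewrite z1 z2 min_r// max_r.
have h1 := ler_norm (x - y); have h2 := ler_norm (y - x); rewrite distrC in h2.
rewrite ler_norml; case: (c x) => [] [cx ->]; case: (c y) => [] [cy ->]; lra.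
Qed.

Lemma clip_id x : `|x| <= 1 -> clip x = x.
Proof.
rewrite ler_norml => /andP[h1 h2].
by rewrite /clip (min_idPr h2) (max_idPr h1).
Qed.

Lemma clip_sg x : 1 <= `|x| -> x * clip x = `|x|.
Proof.
rewrite ler_normr /clip => /orP[h|h].
  by rewrite (min_idPl h) max_r ?mulr1 ?gtr0_norm//; lra.
by rewrite min_r ?max_l ?ltr0_norm ?mulrN1//; lra.
Qed.

(** For |lam x| >= 1 the product is exactly |x|; otherwise |x| < 1 / lam and the product is
    nonnegative. *)
Lemma clip_close (lam x : R) : 0 < lam -> `|x| - lam^-1 <= x * clip (lam * x).
Proof.
move=> l0; have li0 : 0 < lam^-1 by rewrite invr_gt0.
have lE : `|lam * x| = lam * `|x| by rewrite normrM gtr0_norm.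
have [h|h] := leP 1 `|lam * x|.
  rewrite -(ler_pM2l l0) [leRHS]mulrA clip_sg// lE mulrBr divff ?gt_eqF//; lra.
rewrite clip_id ?(ltW h)// mulrCA -expr2.
apply: (@le_trans _ _ 0); last by rewrite mulr_ge0 ?sqr_ge0 ?(ltW l0).
by rewrite subr_le0 -[leRHS]mul1r -ler_pdivrMr// invrK mulrC -lE ltW.
Qed.

End clip.

Section sphere_points.
Variables (R : realType) (n : nat).

Lemma sphere_nonempty : (0 < n)%N -> exists e : sphere R n, True.
Proof.
move=> n0; pose x : 'rV[R]_n := \row_i (i == Ordinal n0)%:R.
have x1 : norm2 x == 1.
  rewrite /norm2 (bigD1 (Ordinal n0))//= mxE eqxx big1 => [|i ni].
    by rewrite expr1n addr0 sqrtr1.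
  by rewrite mxE (negbTE ni) expr0n.
by exists (exist _ x x1).
Qed.

Lemma crd_le1 (y : sphere R n) (i : 'I_n) : `|crd y i| <= 1.
Proof.
by rewrite crdE (le_trans (coord_le_norm2 _ _))// (eqP (valP y)).
Qed.

Lemma lipgrowth_hermite_dot d :
  lipgrowth n (fun g (y : sphere R n) => hermite d (dot n (crd y) g)).
Proof.
under eq_fun => g do under eq_fun do rewrite (@hermiteE _ d./2.+1)//.
apply: lipgrowth_sum => m; apply: lipgrowthM.
  by apply: lipgrowth_cst; exact: bfun_cst.
apply: lipgrowthX; apply: lipgrowth_sum => i; apply: lipgrowthM.
  by apply: lipgrowth_cst; exists 1 => y; exact: crd_le1.
exact: lipgrowth_coord.
Qed.

End sphere_points.

Section models.
Variables (R : realType) (K : scalars R) (n d : nat).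

Lemma sphere_model_sphere :
  sphere_model d (fun (f : sphere_poly K n d) (y : sphere R n) => f y).
Proof.
have nE (f : sphere_poly K n d) : `|f| = sup_norm [set: sphere R n] f by [].
split=> // [f|f /asboolP fP|f y|f M M0 fM].
- exact: hpolyP.
- by exists (HPoly (introT (asboolP _) fP)).
- by rewrite nE ofRK; exact: (le_supn (@sphere_setT_le1 R n)).
- by rewrite nE ofRK; apply: supn_le.
Qed.

(** By homogeneity the supremum over the ball is reached from the sphere. The point [e] serves as
    direction for x = 0; for n = d = 0 the sphere is empty and a nonzero constant would violate
    [sm_ge]. *)
Lemma sphere_model_ball (e : sphere R n) :
  sphere_model d (fun (f : ball_poly K n d) (y : sphere R n) => f (val y)).
Proof.
have nE (f : ball_poly K n d) : `|f| = sup_norm (@unit_ball R n) f by [].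
split=> // [f|f /asboolP[p hp fp]|f y|f M M0 fM].
- by have /asboolP[p hp fp] := hpolyP f; apply/asboolP; exists p.
- have gP : (fun x : 'rV[R]_n => meval (fun i => ofR (x ord0 i)) p : K) \in
      is_hpoly (@idfun 'rV[R]_n) d by apply/asboolP; exists p.
  by exists (HPoly gP); apply/funext => y; rewrite fp.
- rewrite nE ofRK; apply: (le_supn (@unit_ball_le1 R n)).
  by rewrite /unit_ball /= (eqP (valP y)).
- rewrite nE ofRK; apply: supn_le => // x x1.
  have [u ->] : exists u : sphere R n, x = norm2 x *: val u.
    have [x0|x0] := eqVneq (norm2 x) 0.
      exists e; rewrite x0 scale0r; apply/rowP => i; rewrite mxE.
      by apply/eqP; rewrite -normr_le0 -x0; exact: coord_le_norm2.
    have u1 : norm2 ((norm2 x)^-1 *: x) == 1.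
      by rewrite norm2Z ger0_norm ?invr_ge0 ?norm2_ge0// mulVf.
    by exists (exist (fun x : 'rV[R]_n => norm2 x == 1) _ u1); rewrite /= scalerA divff// scale1r.
  rewrite [f _]ball_poly_homog reS_normM -[leRHS]mul1r ler_pM ?reS_norm_ge0//.
  rewrite -(@ofR_le _ K) ofR_norm rmorph1 normrX norm_ofR exprn_ile1//.
    by rewrite -(rmorph0 ofR) ofR_le.
  by rewrite -(rmorph1 ofR) ofR_le ger0_norm ?norm2_ge0.
Qed.

End models.

(** * Limits *)

Section expectation.
Variable R : realType.
Notation mu := (@lebesgue_measure R).

(** [gauss] agrees almost everywhere with the Radon-Nikodym derivative of [normal_prob 0 1], because
    both have the same integral over every measurable set. *)
Lemma ge0_integral_normal_prob (f : R -> \bar R) :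
  (forall x, 0 <= f x)%E -> measurable_fun setT f ->
  (\int[normal_prob 0 1]_x f x = \int[mu]_x (f x * (gauss x)%:E))%E.
Proof.
move=> f0 mf; have nmu := @normal_prob_dominates R 0 1.
have mg : measurable_fun setT (fun x : R => (gauss x)%:E).
  by apply/measurable_EFinP; exact: measurable_gauss.
have mD := measurable_int _ (Radon_Nikodym_SigmaFinite.f_integrable nmu).
rewrite -(Radon_Nikodym_SigmaFinite.change_of_variables nmu f0 measurableT mf).
apply: ae_eq_integral => //; [exact: emeasurable_funM|exact: emeasurable_funM|].
apply: ae_eqe_mul2l; apply: integral_ae_eq => //.
- exact: Radon_Nikodym_SigmaFinite.f_integrable.
- by move=> E _ mE; rewrite -Radon_Nikodym_SigmaFinite.f_integral.
Qed.

Lemma expectation_normal (dsp : measure_display) (W : measurableType dsp)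
    (P : probability W R) (Z : {RV P >-> R}) (F : R -> R) :
  (forall A : set R, measurable A -> distribution P Z A = normal_prob 0 1 A) ->
  mpg F -> (forall t, 0 <= F t) -> ('E_P[fun w => F (Z w)] = (gint F)%:E)%E.
Proof.
move=> hZ mF F0; rewrite unlock.
have mF' : measurable_fun setT (EFin \o F) by apply/measurable_EFinP; exact: mF.1.
have F0' t : (0 <= (EFin \o F) t)%E by rewrite lee_fin.
(* The library has two measurable structures on R, with the same sets. *)
have mZ : measurable_fun setT (Z : W -> measurableTypeR R) := measurable_funPT Z.
have := @ge0_integral_pushforward _ _ W (measurableTypeR R) R Z mZ P setT
  (EFin \o F) measurableT mF' (fun t _ => F0' t).
rewrite preimage_setT => <-.
transitivity (\int[normal_prob 0 1]_x (EFin \o F) x)%E.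
  by apply: eq_measure_integral => A mA _; exact: hZ.
rewrite ge0_integral_normal_prob// /gint /Rintegral fineK//.
apply: integrable_fin_num => //; exact: (gauss_integrable mF.1 mF.2).
Qed.

End expectation.

(** * Limits of the moments and of the two bounds *)

Section asymptotics.
Variable R : realType.
Implicit Types (n d k : nat) (psi : R -> R) (tau : R).

Lemma cvg_natD_ratio k : ((n + k)%:R / n%:R : R) @[n --> \oo] --> (1 : R).
Proof.
have inv0 : (n%:R^-1 : R) @[n --> \oo] --> (0 : R).
  rewrite gtr0_cvgV0; first exact: cvgr_idn.
  by near=> n; rewrite ltr0n; near: n; exact: nbhs_infty_gt.
have h : (1 + k%:R * n%:R^-1 : R) @[n --> \oo] --> (1 + k%:R * 0 : R).
  by apply: cvgD; [exact: cvg_cst|apply: cvgM => //; exact: cvg_cst].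
rewrite mulr0 addr0 in h; apply: cvg_trans h; apply: near_eq_cvg; near=> n.
rewrite natrD mulrDl divff// pnatr_eq0 -lt0n; near: n; exact: nbhs_infty_gt.
Unshelve. all: by end_near. Qed.

Lemma cvg_prod1 (I : Type) (r : seq I) (f : I -> nat -> R) :
  (forall i, f i n @[n --> \oo] --> (1 : R)) -> \prod_(i <- r) f i n @[n --> \oo] --> (1 : R).
Proof.
move=> hf; elim: r => [|i r ih].
  by under eq_fun do rewrite big_nil; exact: cvg_cst.
under eq_fun do rewrite big_cons.
have h := cvgM (hf i) ih; rewrite mulr1 in h; exact: h.
Qed.

Lemma cvg_sumR (I : Type) (r : seq I) (f : I -> nat -> R) (a : I -> R) :
  (forall i, f i n @[n --> \oo] --> a i) ->
  \sum_(i <- r) f i n @[n --> \oo] --> \sum_(i <- r) a i.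
Proof.
move=> hf; elim: r => [|i r ih].
  by rewrite big_nil; under eq_fun do rewrite big_nil; exact: cvg_cst.
by rewrite big_cons; under eq_fun do rewrite big_cons; apply: cvgD.
Qed.

Lemma cvg_rho k : rho R n k / n%:R ^+ k @[n --> \oo] --> (1 : R).
Proof.
have -> : (fun n => rho R n k / n%:R ^+ k) = fun n => \prod_(j < k) ((n + j.*2)%:R / n%:R).
  by apply/funext => n; rewrite /rho prodf_div prodr_const card_ord.
by apply: cvg_prod1 => j; exact: cvg_natD_ratio.
Qed.

Lemma cvg_fluct k : fluct R n k @[n --> \oo] --> (0 : R).
Proof.
rewrite -[X in _ --> X](_ : 1 - 2 * 1 + 1 = _); last by ring.
apply: cvgD; last exact: cvg_cst.
apply: cvgB; first exact: cvg_rho.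
by apply: cvgM; [exact: cvg_cst|exact: cvg_rho].
Qed.

(** d! times the binomial coefficient is n (n + 1) ... (n + d - 1), a product of d factors
    equivalent to n. *)
Lemma cvg_bin_ratio d : 'C(n + d - 1, d)%:R / n%:R ^+ d @[n --> \oo] --> (d`!%:R^-1 : R).
Proof.
have f0 : d`!%:R != 0 :> R by rewrite pnatr_eq0 -lt0n fact_gt0.
have h : \prod_(i < d) ((n + (d - i.+1))%:R / n%:R) / d`!%:R @[n --> \oo] -->
    (1 * d`!%:R^-1 : R).
  apply: cvgM; last exact: cvg_cst.
  by apply: cvg_prod1 => j; exact: cvg_natD_ratio.
rewrite mul1r in h; apply: cvg_trans h; apply: near_eq_cvg; near=> n.
have n0 : (0 < n)%N by near: n; exact: nbhs_infty_gt.
rewrite prodf_div prodr_const card_ord -natr_prod.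
have -> : (\prod_(i < d) (n + (d - i.+1)) = 'C(n + d - 1, d) * d`!)%N.
  rewrite bin_ffact ffact_prod; apply: eq_bigr => i _.
  have id := ltn_ord i; rewrite addnBA// -[i.+1]add1n subnDA.
  by [].
by rewrite natrM mulrAC [X in X / _ = _]mulfK.
Unshelve. all: by end_near. Qed.

(* Only the eventual behaviour matters, so that [lam n] may be infinite for
   finitely many [n]. *)
Lemma cvg_ratio_squeeze (lam : nat -> \bar R) (s t : nat -> R) (L c : R) :
  (\forall n \near \oo, 0 < s n) -> (\forall n \near \oo, 0 < t n) ->
  (forall eps, 0 < eps -> \forall n \near \oo,
    (((L - eps) * s n)%:E <= lam n <= ((L + eps) * s n)%:E)%E) ->
  s n / t n @[n --> \oo] --> c ->
  (lam n / (t n)%:E)%E @[n --> \oo] --> (L * c)%:E.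
Proof.
move=> s0 t0 h st.
have fx : fine (lam n) / s n @[n --> \oo] --> L.
  apply/cvgrPdist_le => eps eps0; near=> n.
  have sn : 0 < s n by near: n.
  have : (((L - eps) * s n)%:E <= lam n <= ((L + eps) * s n)%:E)%E.
    by near: n; exact: h.
  case: (lam n) => [r| |] /andP[h1 h2].
  - move: h1 h2; rewrite !lee_fin -(ler_pdivlMr _ _ sn) -(ler_pdivrMr _ _ sn) => h1 h2.
    by rewrite /= ler_norml; apply/andP; split; lra.
  - by rewrite leye_eq in h2.
  - by rewrite leeNy_eq in h1.
have hx : ((fine (lam n) / s n) * (s n / t n))%:E @[n --> \oo] --> (L * c)%:E.
  by apply: cvg_EFin; [exact: nearW|exact: cvgM].
apply: cvg_trans hx; apply: near_eq_cvg; near=> n.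
have sn : 0 < s n by near: n.
have tn : 0 < t n by near: n.
have : (((L - 1) * s n)%:E <= lam n <= ((L + 1) * s n)%:E)%E.
  by near: n; exact: h.
case: (lam n) => [r| |] /andP[h1 h2].
- rewrite inver gt_eqF// -EFinM; congr (_%:E).
  by rewrite /= mulrA divfK// gt_eqF.
- by rewrite leye_eq in h2.
- by rewrite leeNy_eq in h1.
Unshelve. all: by end_near. Qed.

Lemma continuous_clip : continuous (@clip R).
Proof.
move=> x; apply/cvgrPdist_le => e e0; apply/nbhs_ballP; exists e => // y.
move=> /= xy; apply: le_trans (clip_lipschitz x y) _; exact: ltW.
Qed.

Lemma continuous_clip_hermite d (lam : R) : continuous (fun t => clip (lam * hermite d t)).
Proof.
apply: continuous_compR continuous_clip.
by apply: continuous_mulR; [move=> t; exact: cvg_cst|exact: continuous_hermite].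
Qed.

Lemma mpg_clip_hermite d (lam : R) : mpg (fun t => clip (lam * hermite d t)).
Proof.
split; first by apply: continuous_measurable_fun; exact: continuous_clip_hermite.
by exists 0%N, 1 => // t; rewrite expr0 mulr1 clip_le1.
Qed.

(** The sum is E[He_d(Z) clip(lam He_d(Z))], the leading term of the trace estimate; [clip_close]
    compares it with E|He_d(Z)|. *)
Lemma gint_hermite_clip d (lam : R) : 0 < lam ->
  gint (fun t => `|hermite d t|) - lam^-1 <=
  \sum_(m < d./2.+1) hcoef R d m *
    gint (fun t => t ^+ (d - m.*2) * clip (lam * hermite d t)).
Proof.
move=> l0; have mH := mpg_hermite R d; have mc := mpg_clip_hermite d lam.
rewrite -gmeanE; last exact: mpg_norm.
rewrite -[X in _ - X](gmean_cst (lam^-1)) -gmeanN -gmeanD.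
have -> : \sum_(m < d./2.+1) hcoef R d m *
    gint (fun t => t ^+ (d - m.*2) * clip (lam * hermite d t)) =
    gmean (fun t => hermite d t * clip (lam * hermite d t)).
  transitivity (gmean (fun t => \sum_(m < d./2.+1)
      hcoef R d m * (t ^+ (d - m.*2) * clip (lam * hermite d t)))).
    rewrite gmean_sum; apply: eq_bigr => m _; rewrite gmeanZ gmeanE//.
    by apply: mpgM => //; exact: mpgX.
  congr gmean; apply/funext => t; rewrite [X in _ = X * _](@hermiteE _ d./2.+1)// mulr_suml.
  by apply: eq_bigr => m _; rewrite mulrA.
apply: gmean_le => [||t].
- by apply: pgrowthD; [exact: (mpg_norm mH).2|exact: pgrowth_cst].
- exact: (mpgM mH mc).2.
- exact: clip_close.
Qed.

Lemma sqrt_natX n d : Num.sqrt (n%:R ^+ d) = Num.sqrt n%:R ^+ d :> R.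
Proof.
rewrite -{1}(sqr_sqrtr (ler0n R n)) -exprM mulnC exprM sqrtr_sqr ger0_norm// exprn_ge0// sqrtr_ge0.
Qed.

Section bounds.
Variables (d : nat) (K : scalars R) (re : K -> R) (X : nat -> normedModType K).
Variable ev : forall n, X n -> sphere R n -> K.
Hypothesis hre : real_part re.
Hypothesis hev : forall n, (0 < n)%N -> sphere_model d (@ev n).

Let L := gint (fun t : R => `|hermite d t|).

Let fact0 : 0 < d`!%:R :> R.
Proof. by rewrite ltr0n fact_gt0. Qed.

Let fact1 : 1 <= d`!%:R :> R.
Proof. by rewrite ler1n fact_gt0. Qed.

Let div_fact_le (x : R) : 0 <= x -> x / d`!%:R <= x.
Proof. by move=> x0; rewrite ler_pdivrMr// ler_peMr. Qed.

Lemma proj_const_upper eps : 0 < eps -> \forall n \near \oo,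
  (proj_const (X n) <= ((L / d`!%:R + eps) * Num.sqrt (n%:R ^+ d))%:E)%E.
Proof.
move=> eps0; pose M := gint (fun t : R => hermite d t ^+ 2).
have M0 : 0 <= M by apply: gint_ge0 => t; exact: sqr_ge0.
have M1 : 0 < M + 1 by rewrite ltr_wpDl.
(* Then [tau * M < eps], so the limit of [up] is strictly below the target and [up n] is below it
   eventually. *)
pose tau := eps / (M + 1); have tau0 : 0 < tau by rewrite divr_gt0.
pose up n : R := d`!%:R^-1 * (L + (tau * M + fluct R n d / tau) / 2).
have up_cvg : up n @[n --> \oo] --> d`!%:R^-1 * (L + (tau * M + 0 / tau) / 2).
  apply: cvgM; first exact: cvg_cst.
  apply: cvgD; first exact: cvg_cst.
  apply: cvgM; last exact: cvg_cst.
  apply: cvgD; first exact: cvg_cst.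
  by apply: cvgM; [exact: cvg_fluct|exact: cvg_cst].
have tM : tau * M < eps by rewrite /tau mulrAC ltr_pdivrMr// ltr_pM2l// ltrDl.
have tM0 : 0 <= tau * M by rewrite mulr_ge0// ltW.
have lim_lt : d`!%:R^-1 * (L + (tau * M + 0 / tau) / 2) < L / d`!%:R + eps.
  rewrite mul0r addr0 mulrDr [_ * L]mulrC ltrD2l mulrC.
  by apply: (@le_lt_trans _ _ (tau * M / 2)); [apply: div_fact_le|]; lra.
near=> n.
have n0 : (0 < n)%N by near: n; exact: nbhs_infty_gt.
have [e _] := sphere_nonempty R n0.
have upn : up n <= L / d`!%:R + eps.
  by near: n; exact: cvgr_le up_cvg _ lim_lt.
have bound (y : sphere R n) : d`!%:R^-1 *
    gmeann n (fun g => radius n g ^+ d * `|hermite d (dot n (crd y) g)|) <=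
    (L / d`!%:R + eps) * Num.sqrt (n%:R ^+ d).
  rewrite sqrt_natX; apply: (@le_trans _ _ (up n * Num.sqrt n%:R ^+ d)); last first.
    by rewrite ler_wpM2r// exprn_ge0// sqrtr_ge0.
  rewrite /up -mulrA ler_wpM2l ?invr_ge0// mulrC.
  exact: (gmeann_upper d n0 tau0 (nrm2_crd y)).
apply: (proj_const_le hre (hev n0) e _ bound).
apply: le_trans (bound e); rewrite mulr_ge0 ?invr_ge0//.
apply: gmeann_ge0 => [|g]; last by rewrite mulr_ge0// exprn_ge0// radius_ge0.
apply: growthM; first by apply: growthX; exact: growth_sqrt_nrm2.
by apply/growth_norm/growth_comp; [exact: (mpg_hermite R d).2|exact: growth_dot].
Unshelve. all: by end_near. Qed.

Lemma proj_const_lower eps : 0 < eps -> \forall n \near \oo,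
  (((L / d`!%:R - eps) * Num.sqrt (n%:R ^+ d))%:E <= proj_const (X n))%E.
Proof.
move=> eps0; pose M k := gint (fun t : R => (t ^+ (d - k.*2)) ^+ 2).
have M0 k : 0 <= M k by apply: gint_ge0 => t; exact: sqr_ge0.
pose S := \sum_(m < d./2.+1) `|hcoef R d m| * M m.
have S0 : 0 <= S by apply: sumr_ge0 => m _; rewrite mulr_ge0.
have S1 : 0 < S + 1 by rewrite ltr_wpDl.
(* Clipping costs 1 / lam = eps / 4 and the Young term, with [tau] below, less than eps / 2. The
   remaining quarter gives the strict inequality that the passage to large n needs. *)
pose lam := 4 / eps; have lam0 : 0 < lam by rewrite divr_gt0.
pose tau := eps / (S + 1); have tau0 : 0 < tau by rewrite divr_gt0.
pose psi t := clip (lam * hermite d t).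
pose kap k := gint (fun t => t ^+ (d - k.*2) * psi t).
pose c n (m : 'I_d./2.+1) := hcoef R d m * kap m -
  `|hcoef R d m| * ((tau * M m + fluct R n m / tau) / 2).
pose den n := d`!%:R * ((rho R n d / n%:R ^+ d + 1) / 2).
pose lo n := (\sum_(m < d./2.+1) c n m * (rho R n (d - m) / n%:R ^+ (d - m))) / den n.
pose l := (\sum_(m < d./2.+1) (hcoef R d m * kap m -
  `|hcoef R d m| * ((tau * M m + 0 / tau) / 2)) * 1) / (d`!%:R * ((1 + 1) / 2)).
have lo_cvg : lo n @[n --> \oo] --> l.
  apply: cvgM.
    apply: cvg_sumR => m; apply: cvgM; last exact: cvg_rho.
    apply: cvgB; first exact: cvg_cst.
    apply: cvgM; first exact: cvg_cst.
    apply: cvgM; last exact: cvg_cst.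
    apply: cvgD; first exact: cvg_cst.
    by apply: cvgM; [exact: cvg_fluct|exact: cvg_cst].
  apply: cvgV; first by rewrite mulf_neq0 ?gt_eqF// divr_gt0// addr_gt0.
  apply: cvgM; first exact: cvg_cst.
  apply: cvgM; last exact: cvg_cst.
  by apply: cvgD; [exact: cvg_rho|exact: cvg_cst].
have lE : l = (\sum_(m < d./2.+1) hcoef R d m * kap m - tau * S / 2) / d`!%:R.
  rewrite /l divff// mulr1; congr (_ / _).
  rewrite /S -mulrA mulr_suml mulr_sumr -sumrB; apply: eq_bigr => m _.
  by rewrite mul0r addr0 mulr1; congr (_ - _); move: `|_| (M _) => x y; ring.
have tS : tau * S < eps by rewrite /tau mulrAC ltr_pdivrMr// ltr_pM2l// ltrDl.
have l_gt : L / d`!%:R - eps < l.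
  have h := gint_hermite_clip d lam0; rewrite -/L /lam invf_div in h.
  rewrite lE; apply: (@lt_le_trans _ _ ((L - 3 / 4 * eps) / d`!%:R)); last first.
    rewrite ler_pM2r ?invr_gt0//; rewrite -/lam -/psi in h.
    by move: h; rewrite -/(kap _); move: (\sum_(m < _) _) => s; lra.
  rewrite mulrBl ltrD2l ltrN2 (le_lt_trans (div_fact_le _))//; lra.
near=> n.
have n0 : (0 < n)%N by near: n; exact: nbhs_infty_gt.
have nr0 : 0 < n%:R :> R by rewrite ltr0n.
have [e _] := sphere_nonempty R n0.
have lon : L / d`!%:R - eps <= lo n by near: n; exact: cvgr_ge lo_cvg _ l_gt.
have lpsi : lipgrowth n (fun g (y : sphere R n) => psi (dot n (crd y) g)).
  apply: (lipgrowth_comp (@clip_lipschitz R)); apply: lipgrowthM.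
    by apply: lipgrowth_cst; exact: bfun_cst.
  exact: lipgrowth_hermite_dot.
have key : (((\sum_(m < d./2.+1) c n m * (rho R n (d - m) * n%:R ^+ m)) /
    (d`!%:R * (Num.sqrt n%:R ^+ d * ((rho R n d / n%:R ^+ d + 1) / 2))))%:E <=
    proj_const (X n))%E.
  exact: (proj_const_ge hre (hev n0) e (@continuous_clip_hermite d lam)
    (mpg_clip_hermite d lam) (fun t => clip_le1 _) lpsi n0 tau0).
apply: le_trans key; rewrite lee_fin sqrt_natX.
have q0 : 0 < Num.sqrt n%:R ^+ d :> R by rewrite exprn_gt0// sqrtr_gt0.
apply: (@le_trans _ _ (lo n * Num.sqrt n%:R ^+ d)); first by rewrite ler_wpM2r// ltW.
(* The trace is of order n^d and its bound of order n^(d/2) times the norm: one of the two factors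
   cancels, the other is the growth rate of the projection constant. *)
have qq : n%:R ^+ d = Num.sqrt n%:R ^+ d * Num.sqrt n%:R ^+ d :> R.
  by rewrite -expr2 -exprM mulnC exprM sqr_sqrtr.
have sumE : \sum_(m < d./2.+1) c n m * (rho R n (d - m) * n%:R ^+ m) =
    n%:R ^+ d * \sum_(m < d./2.+1) c n m * (rho R n (d - m) / n%:R ^+ (d - m)).
  rewrite mulr_sumr; apply: eq_bigr => m _; rewrite [RHS]mulrCA; congr (_ * _).
  have md : (m <= d)%N by rewrite (leq_trans _ (double_le_half m))// -addnn leq_addr.
  have -> : n%:R ^+ d = n%:R ^+ (d - m) * n%:R ^+ m :> R by rewrite -exprD subnK.
  have : n%:R ^+ (d - m) != 0 :> R by rewrite expf_neq0// gt_eqF.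
  by move: (_ ^+ (d - m)) (_ ^+ m) (rho _ _ _) => x y z x0; field.
have w0 : 0 < (rho R n d / n%:R ^+ d + 1) / 2 :> R.
  by rewrite divr_gt0// ltr_wpDl// divr_ge0 ?prodr_ge0// exprn_ge0.
rewrite le_eqVlt; apply/orP; left; apply/eqP; rewrite sumE /lo /den.
have := lt0r_neq0 w0; move: ((_ + 1) / 2) => w w'; rewrite qq.
have := lt0r_neq0 fact0; have := lt0r_neq0 q0.
move: (\sum_(_ < _) _) (Num.sqrt _ ^+ d) (d`!%:R) => x q f q' f'.
by field; rewrite w' q' f'.
Unshelve. all: by end_near. Qed.

End bounds.

Lemma proj_const_cvg d (K : scalars R) (re : K -> R) (X : nat -> normedModType K)
    (ev : forall n, X n -> sphere R n -> K) (L := gint (fun t : R => `|hermite d t|)) :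
  real_part re ->
  (forall n, (0 < n)%N -> sphere_model d (ev n)) ->
  ((proj_const (X n) / (Num.sqrt 'C(n + d - 1, d)%:R)%:E)%E @[n --> \oo] -->
     (L%:E / (Num.sqrt d`!%:R)%:E)%E) /\
  ((proj_const (X n) / (Num.sqrt (n%:R ^+ d))%:E)%E @[n --> \oo] -->
     (L%:E / (d`!%:R)%:E)%E).
Proof.
move=> hre hev; have B eps : 0 < eps -> \forall n \near \oo,
    (((L / d`!%:R - eps) * Num.sqrt (n%:R ^+ d))%:E <= proj_const (X n) <=
    ((L / d`!%:R + eps) * Num.sqrt (n%:R ^+ d))%:E)%E.
  move=> eps0; apply: filterS2 (proj_const_lower hre hev eps0)
    (proj_const_upper hre hev eps0) => n.
  by rewrite -/L => -> ->.
have f0 : 0 < d`!%:R :> R by rewrite ltr0n fact_gt0.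
have sf0 : 0 < Num.sqrt d`!%:R :> R by rewrite sqrtr_gt0.
have s0 : \forall n \near \oo, 0 < Num.sqrt (n%:R ^+ d) :> R.
  by near=> n; rewrite sqrtr_gt0 exprn_gt0// ltr0n; near: n; exact: nbhs_infty_gt.
have t0 : \forall n \near \oo, 0 < Num.sqrt 'C(n + d - 1, d)%:R :> R.
  near=> n; have n0 : (0 < n)%N by near: n; exact: nbhs_infty_gt.
  by rewrite sqrtr_gt0 ltr0n bin_gt0 addnC -addnBA// leq_addr.
split.
  have -> : (L%:E / (Num.sqrt d`!%:R)%:E)%E = (L / d`!%:R * Num.sqrt d`!%:R)%:E.
    rewrite inver gt_eqF// -EFinM; congr (_%:E).
    rewrite -[X in _ / X * _]sqr_sqrtr ?(ltW f0)//; field; exact: lt0r_neq0.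
  apply: cvg_ratio_squeeze B _ => //.
  have h : Num.sqrt ('C(n + d - 1, d)%:R / n%:R ^+ d)^-1 @[n --> \oo] -->
      (Num.sqrt d`!%:R : R).
    apply: continuous_cvg; first exact: sqrt_continuous.
    have -> : d`!%:R = (d`!%:R^-1)^-1 :> R by rewrite invrK.
    apply: cvgV; [by rewrite invr_eq0 gt_eqF|exact: cvg_bin_ratio].
  by under eq_fun do rewrite -sqrtrV ?ler0n// -sqrtrM ?exprn_ge0// -invf_div.
have -> : (L%:E / (d`!%:R)%:E)%E = (L / d`!%:R * 1)%:E.
  by rewrite inver gt_eqF// mulr1.
apply: cvg_ratio_squeeze B _ => //.
apply: cvg_near_cst; near=> n; rewrite divff// gt_eqF//; near: n; exact: s0.
Unshelve. all: by end_near. Qed.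

End asymptotics.
Theorem theorem2p12 (R : realType) (d : nat)
    (dsp : measure_display) (W : measurableType dsp) (P : probability W R)
    (Z : {RV P >-> R})
    (Zgauss : forall A : set R, measurable A ->
      distribution P Z A = normal_prob 0 1 A) :
  let EHe := ('E_P[fun w => (`|hermite d (Z w)|)%R])%E in
  let by_binom (lambda : nat -> \bar R) :=
    (fun n : nat => lambda n / (Num.sqrt 'C(n + d - 1, d)%:R)%:E)%E @ \oo
      --> (EHe / (Num.sqrt d`!%:R)%:E)%E in
  let by_power (lambda : nat -> \bar R) :=
    (fun n : nat => lambda n / (Num.sqrt (n%:R ^+ d))%:E)%E @ \oo
      --> (EHe / (d`!%:R)%:E)%E in
  let lambda_ball n := proj_const (ball_poly (real_scalars R) n d) in
  let lambda_sphereC n := proj_const (sphere_poly (complex_scalars R) n d) in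
  let lambda_sphereR n := proj_const (sphere_poly (real_scalars R) n d) in
  [/\ by_binom lambda_ball /\ by_power lambda_ball,
      by_binom lambda_sphereC /\ by_power lambda_sphereC
    & by_binom lambda_sphereR /\ by_power lambda_sphereR].

Proof.
move=> EHe by_binom by_power lb lC lR.
have EE : EHe = (gint (fun t : R => `|hermite d t|))%:E.
  apply: (expectation_normal Zgauss) => //.
  by apply: mpg_norm; exact: mpg_hermite.
rewrite /by_binom /by_power EE; split.
- apply: (proj_const_cvg (@real_part_real R)
    (X := fun n => ball_poly (real_scalars R) n d)
    (ev := fun n (f : ball_poly (real_scalars R) n d) y => f (val y))) => n n0.
  by have [e _] := sphere_nonempty R n0; exact: sphere_model_ball.
- apply: (proj_const_cvg (@real_part_complex R)
    (X := fun n => sphere_poly (complex_scalars R) n d)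
    (ev := fun n (f : sphere_poly (complex_scalars R) n d) y => f y)) => n _.
  exact: sphere_model_sphere.
- apply: (proj_const_cvg (@real_part_real R)
    (X := fun n => sphere_poly (real_scalars R) n d)
    (ev := fun n (f : sphere_poly (real_scalars R) n d) y => f y)) => n _.
  exact: sphere_model_sphere.
Qed.
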